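(* Let $N\ge2$ and $k\ge1$ be integers, $N^+=\lfloor N/2\rfloor$, $N^-=\lfloor (N-1)/2\rfloor$, and let $$B_{k,N}=\begin{cases}\bigl(\widetilde B_k(ij/N)\bigr)_{0\le i,j\le N^+} & k \text{ even},\\ \bigl(\widetilde B_k(ij/N)\bigr)_{1\le i,j\le N^-} & k\text{ odd}.\end{cases}$$ For $k$ even, $$\det(B_{k,N})=(-1)^{\frac{N^+(N^++1)}{2}}N^{\frac{N^++1}{2}}2^{N^++1-N^-}\prod_{d\mid N}\ \prod_{\substack{\chi \bmod d\\ \chi(-1)=1}}\Bigl(\frac{(-1)^{\frac k2+1}k!}{(2\pi)^k}L(k,\chi)\Bigr),$$ where for $d=1$, $\chi$ is the trivial character and $L(k,\chi)=\zeta(k)$. For $k$ odd, $$\det(B_{k,N})=(-1)^{\frac{N^-(N^--1)}{2}}N^{\frac{N^-}{2}}\prod_{\substack{d\mid N\\ d>2}}\ \prod_{\substack{\chi\bmod d\\ \chi(-1)=-1}}\Bigl(\frac{(-1)^{\frac{k+1}{2}}k!}{(2\pi)^k}L(k,\chi)\Bigr).$$ In particular, $\det(B_{k,N})\neq0$.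
   Context: $B_k(x)$ is the $k$-th Bernoulli polynomial and $\widetilde B_k(x)=B_k(\{x\})$ is the periodic Bernoulli function, $\{x\}\in[0,1)$ the fractional part, with the convention $\widetilde B_1(0)=0$. Products over $\chi\bmod d$ run over Dirichlet characters modulo $d$ (not necessarily primitive), and $L(k,\chi)=\sum_{n\ge1}\chi(n)n^{-k}$ is the Dirichlet $L$-function; $\zeta$ is the Riemann zeta function. *)

(* Defs.v *)
From HB Require Import structures.
From mathcomp Require Export all_boot all_order all_algebra.
From mathcomp Require Import finmap cyclic.
From mathcomp Require Export complex.
From mathcomp Require Export all_classical all_reals all_analysis.
Export Order.TTheory GRing.Theory Num.Theory numFieldNormedType.Exports.
Global Set Implicit Arguments.
Global Unset Strict Implicit.
Global Unset Printing Implicit Defensive.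
#[global] Open Scope classical_set_scope.
#[global] Open Scope ring_scope.
#[global] Open Scope complex_scope.

(* The Bernoulli numbers b_0, ..., b_n (with b_1 = -1/2), from b_0 = 1 and
   \sum_(j < m.+2) 'C(m.+2, j) * b_j = 0, solved for b_(m.+1). *)
Fixpoint bernoulli_seq (R : numFieldType) (n : nat) : seq R :=
  if n is m.+1 then
    let s := bernoulli_seq R m in
    rcons s (- (\sum_(j < m.+1) 'C(m.+2, j)%:R * s`_j) / m.+2%:R)
  else [:: 1].

Definition bernoulli_number (R : numFieldType) (n : nat) : R :=
  (bernoulli_seq R n)`_n.

Definition bernoulli_poly (R : numFieldType) (k : nat) : {poly R} :=
  \poly_(j < k.+1) ('C(k, j)%:R * bernoulli_number R (k - j)).

Definition periodic_bernoulli (R : realType) (k : nat) (x : R) : R :=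
  let t := x - (Num.floor x)%:~R in
  if (k == 1%N) && (t == 0) then 0 else (bernoulli_poly R k).[t].

Definition Nplus (N : nat) : nat := N./2.
Definition Nminus (N : nat) : nat := N.-1./2.

Definition bernoulli_dim (k N : nat) : nat :=
  if odd k then Nminus N else (Nplus N).+1.

(* Ordinals start at 0, so the indices are shifted by odd k (0 or 1), giving
   the range 0..N^+ for k even and 1..N^- for k odd. *)
Definition bernoulli_mx (R : realType) (k N : nat) :
    'M[R]_(bernoulli_dim k N) :=
  \matrix_(i, j)
    periodic_bernoulli k (((odd k + i) * (odd k + j))%N%:R / N%:R).

(* Characters modulo d, extended by 0 to the integers not coprime to d. *)
Definition dirichlet_character (C : numFieldType) (d : nat) :
    set (int -> C) :=
  [set chi | [/\ chi 1 = 1,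
                 forall m n, chi (m * n) = chi m * chi n,
                 forall n, chi (n + d%:Z) = chi n
               & forall n, (chi n != 0) = coprimez n d%:Z]].

(* R[i] carries its norm topology through the alias R[i]^o. The series is the
   limit of its ordered partial sums, as k = 1 is only conditionally convergent. *)
Definition dirichlet_L (R : realType) (k : nat) (chi : int -> R[i]) : R[i] :=
  limn (fun m => (\sum_(1 <= n < m) chi n%:Z / n%:R ^+ k : R[i]^o)).

Arguments dirichlet_character : clear implicits.

Definition even_characters (C : numFieldType) (d : nat) : set (int -> C) :=
  [set chi | dirichlet_character C d chi /\ chi (-1) = 1].

Definition odd_characters (C : numFieldType) (d : nat) : set (int -> C) :=
  [set chi | dirichlet_character C d chi /\ chi (-1) = -1].

Arguments even_characters : clear implicits.
Arguments odd_characters : clear implicits.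

Lemma bernoulli_number_sum (R : numFieldType) (n : nat) :
  \sum_(j < n.+1) 'C(n.+1, j)%:R * bernoulli_number R j = (n == 0%N)%:R.
Proof.
have sz m : size (bernoulli_seq R m) = m.+1.
  by elim: m => //= m IH; rewrite size_rcons IH.
have nthS m j : (j <= m)%N ->
    (bernoulli_seq R m)`_j = bernoulli_number R j.
  elim: m => [|m IH]; first by rewrite leqn0 => /eqP->.
  rewrite leq_eqVlt => /predU1P[-> //|jm].
  by rewrite /= nth_rcons sz jm IH.
case: n => [|n]; first by rewrite big_ord1 bin0 mul1r.
rewrite big_ord_recr /= binSn {2}/bernoulli_number /= nth_rcons sz ltnn eqxx.
rewrite mulrCA divff ?pnatr_eq0// mulr1.
apply/eqP; rewrite subr_eq0; apply/eqP.
by apply: eq_bigr => j _; rewrite nthS // -ltnS.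
Qed.

Lemma dirichlet_character1 (C : numFieldType) (chi : int -> C) :
  dirichlet_character C 1 chi <-> chi = fun=> 1.
Proof.
split=> [[chi1 chiM chiD _]|->].
  have chi0 : chi 0 = 1 by rewrite -(chiD 0) add0r.
  by apply/funext => n; rewrite -chi0 -{1}(mulr0 n) chiM chi0 mulr1.
split=> // [m n|n]; first by rewrite mulr1.
by rewrite coprimezE coprimen1 oner_neq0.
Qed.

(* Needed for the products over characters: \big[op/idx]_(i \in A) F i is idx
   when F differs from idx at infinitely many points of A. *)
Lemma finite_dirichlet_character (C : numFieldType) (d : nat) :
  (0 < d)%N -> finite_set (dirichlet_character C d).
Proof.
move=> d0; pose p : {poly C} := 'X * ('X^(totient d) - 1).
have p0 : p != 0.
  by rewrite mulf_neq0 ?polyX_eq0// -size_poly_eq0 size_XnsubC// totient_gt0.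
have fin_roots : finite_set [set x | root p x].
  apply: contrapT => /(infinite_set_fset (size p))[B Bp].
  rewrite leqNgt => /negP; apply.
  by apply: max_poly_roots => //; [apply/allP => x /Bp | exact: fset_uniq].
have [s ps] : exists s : {fset C}, [set x | root p x] = [set` s].
  by exists (fset_set [set x | root p x]); rewrite fset_setK.
have chi_mod (chi : int -> C) n : dirichlet_character C d chi ->
    chi (n %% d%:Z)%Z = chi n.
  move=> [_ _ chiD _].
  have chiDn (m : nat) x : chi (x + (m * d)%N%:Z) = chi x.
    elim: m => [|m IH]; first by rewrite mul0n addr0.
    by rewrite mulSn addnC PoszD addrA chiD.
  have chiDz q x : chi (x + q * d%:Z) = chi x.
    case: q => m; first by rewrite -PoszM chiDn.
    by rewrite -(chiDn m.+1) NegzE mulNr -PoszM subrK.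
  by rewrite [in RHS](divz_eq n d%:Z) addrC chiDz.
have chi_root (chi : int -> C) n : dirichlet_character C d chi ->
    chi n \in s.
  move=> chiP; have [chi1 chiM chiD chiN0] := chiP.
  suff : [set` s] (chi n) by [].
  rewrite -ps /=; have [->|cn0] := eqVneq (chi n) 0.
    by rewrite rootE hornerM hornerX mul0r.
  have chiX (m : nat) x : chi (x ^+ m) = chi x ^+ m.
    by elim: m => [|m IH]; rewrite ?expr0// !exprS chiM IH.
  rewrite rootE hornerM hornerX !hornerE mulf_eq0 subr_eq0 (negPf cn0)/=.
  rewrite -(chi_mod _ n)//.
  have dn0 : d%:Z != 0 by rewrite eqz_nat -lt0n.
  have : coprimez (n %% d%:Z)%Z d%:Z.
    by rewrite -chiN0 chi_mod.
  have := modz_ge0 n dn0; case: (n %% _)%Z => // r _.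
  rewrite coprimezE /= => /Euler_exp_totient E.
  rewrite -chiX -chi1 -(chi_mod _ (_ ^+ _))// -[in X in _ == X](chi_mod _ 1)//.
  by rewrite -[Posz r]natz -natrX natz !modz_nat E.
pose f (g : {ffun 'I_d -> s}) (n : int) : C :=
  val (g (Ordinal (ltn_pmod `|(n %% d%:Z)%Z| d0))).
apply: (@sub_finite_set _ _ (f @` [set: {ffun 'I_d -> s}])); last first.
  exact/finite_image/finite_finset.
move=> chi chiP; exists [ffun i : 'I_d => [` chi_root chi i%:Z chiP]%fset] => //.
apply/funext => n; rewrite /f ffunE /=.
have dn0 : d%:Z != 0 by rewrite eqz_nat -lt0n.
by rewrite -modz_nat gez0_abs ?modz_ge0// modz_mod chi_mod.
Qed.

(* Main.v *)
Require Import Defs.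
From mathcomp Require Import fingroup cyclic algC cyclotomic classfun character.
From mathcomp Require Import ring lra zify finmap.

(** By the Fourier expansion of the periodic Bernoulli functions, the entries
    are, up to the factor 2 [fourier_coef], limits of the partial sums of
    [\sum_r trig (2 pi r i j / N) / r ^ k], where [trig] is cos or sin. Such a
    partial sum is a product [conv_mx *m trig_mx], where [conv_mx] is the operator
    [f |-> (i |-> \sum_r r ^- k * f (r i))] on even (resp. odd) functions on Z/N.
    This space has a basis of characters mod d supported on the multiples of N/d,
    for d | N; ordered by d, it makes the operator triangular, with the partial
    sums of the L-functions on the diagonal. The square of [trig_mx] is diagonal
    up to scaling by orthogonality, and the sign of its determinant follows from
    Vandermonde's formula in the decreasing numbers cos (2 pi j / N).

    For the nonvanishing with k = 1, only characters with chi (-1) = -1 occur, and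
    these are not principal. If chi ^ 2 is not principal, then the sums of
    Lambda(m) chi(m) / m up to n are - log n + O(1) if L(1, chi) = 0 and O(1)
    otherwise, and 3 + 4 Re chi + Re chi ^ 2 >= 0 contradicts L(1, chi) = 0. If chi
    is real, the hyperbola method applied to the nonnegative function 1 * chi
    weighted by 1 / sqrt m gives L(1, chi) <> 0. *)

(** * Fourier expansion of the periodic Bernoulli functions *)

(** All matrix identities are exact for each truncation of the series, so the algebra stays finite
    and one limit, taken through the continuity of the determinant, comes last; [k = 1], where
    nothing converges absolutely, is treated there like the other [k]. The matrix has one index for
    each orbit of a -> -a on Z/N that can carry a function of the given parity. Orbits have one or
    two elements: the weights [orbit_size] correct for this, and contribute the 2^(N^-) that divides
    the power of 2 coming from the Fourier series. Neither the completeness of the characters nor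
    the convergence of their L-series is presupposed: the first follows from a count over both
    parities at once, the second from the invertibility of the trigonometric matrix, which makes
    each character a combination of sines or cosines. *)

Section BernoulliPoly.
Variable R : realType.
Implicit Types (k j : nat).

Lemma coef_bernoulli_poly k j :
  (bernoulli_poly R k)`_j = 'C(k, j)%:R * bernoulli_number R (k - j).
Proof.
rewrite coef_poly ltnS; case: leqP => // kj.
by rewrite bin_small// mul0r.
Qed.

Lemma deriv_bernoulli_poly k :
  (bernoulli_poly R k.+1)^`() = k.+1%:R *: bernoulli_poly R k.
Proof.
apply/polyP => j; rewrite coef_deriv coefZ !coef_bernoulli_poly subSS.
by rewrite -[LHS]mulr_natl !mulrA -!natrM mul_bin_diag.
Qed.

Lemma horner_bernoulli_poly0 k : (bernoulli_poly R k).[0] = bernoulli_number R k.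
Proof. by rewrite horner_coef0 coef_bernoulli_poly bin0 mul1r subn0. Qed.

(** Reversing the sum for the value at 1 turns all its terms but one into the recurrence for the
    Bernoulli numbers, whose right-hand side is 0 from degree 2 on. *)
Lemma horner_bernoulli_poly1 k :
  (bernoulli_poly R k.+2).[1] = (bernoulli_poly R k.+2).[0].
Proof.
rewrite horner_bernoulli_poly0.
have -> : (bernoulli_poly R k.+2).[1] =
    \sum_(j < k.+3) 'C(k.+2, j)%:R * bernoulli_number R (k.+2 - j).
  rewrite (horner_coef_wide _ (size_poly _ _)).
  by apply: eq_bigr => j _; rewrite expr1n mulr1 coef_bernoulli_poly.
rewrite (reindex_inj rev_ord_inj)/= big_ord_recr/= subnn bin0 mul1r.
rewrite [X in X + _](_ : _ = 0); first by rewrite add0r subn0.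
rewrite -[RHS](bernoulli_number_sum R k.+1); apply: eq_bigr => j _.
have jk : (j <= k.+2)%N by rewrite ltnW// ltn_ord.
by rewrite subSS bin_sub// subKn.
Qed.

Lemma horner_bernoulli_poly_1 (x : R) : (bernoulli_poly R 1).[x] = x - 2^-1.
Proof.
rewrite (horner_coef_wide _ (size_poly _ _)) !big_ord_recl big_ord0 addr0.
rewrite !coef_bernoulli_poly /bernoulli_number/= !big_ord_recl big_ord0/=.
rewrite /bump/= !bin0 !binn/=; by field.
Qed.

Lemma horner_bernoulli_poly_0 (x : R) : (bernoulli_poly R 0).[x] = 1.
Proof.
rewrite (horner_coef_wide _ (size_poly _ _)) !big_ord_recl big_ord0 addr0.
by rewrite !coef_bernoulli_poly /bernoulli_number/= bin0 expr0 !mulr1.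
Qed.

End BernoulliPoly.

Section MeanValue.
Variable R : realType.

Lemma le_lipschitz_derive (f df : R -> R) (a b K : R) :
  (forall x, a <= x <= b -> is_derive x 1 f (df x)) ->
  (forall x, a <= x <= b -> `|df x| <= K) ->
  forall x y, a <= x <= b -> a <= y <= b -> `|f x - f y| <= K * `|x - y|.
Proof.
move=> fdf dfK.
suff H x y : a <= x <= b -> a <= y <= b -> x < y -> `|f x - f y| <= K * `|x - y|.
  move=> x y xab yab; have [xy|yx|->] := ltgtP x y; first exact: H.
  - by rewrite distrC (distrC x); exact: H.
  - by rewrite !subrr !normr0 mulr0.
move=> /andP[ax xb] /andP[ay yb] xy.
have inab z : z \in `[x, y] -> a <= z <= b.
  by rewrite in_itv/= => /andP[xz zy]; rewrite (le_trans ax)//= (le_trans zy).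
have [z||c cxy] := @MVT R f df x y xy.
- by move=> zxy; apply: fdf; apply: inab; exact: subset_itv_oo_cc zxy.
- apply: derivable_within_continuous => z zxy.
  by have [] := fdf _ (inab _ zxy).
rewrite distrC => ->; rewrite normrM (distrC y x) ler_wpM2r//.
by apply: dfK; apply: inab; exact: subset_itv_oo_cc cxy.
Qed.

End MeanValue.

(** The flag [o] is a parity all along: [true] goes with sines, odd functions and odd characters,
    [false] with cosines and even ones. *)
Definition trig (R : realType) (o : bool) (y : R) : R :=
  if o then sin y else cos y.

(** For odd [k] the exponent is (k + 1) / 2, so one formula gives the factor in both determinants.
    At [k = 0] the value is -1, which makes the remainder below the Dirichlet kernel. *)
Definition fourier_coef (R : realType) (k : nat) : R :=
  (-1) ^+ (k./2).+1 * k`!%:R / (2 * pi) ^+ k.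

Section Fourier.
Variable R : realType.
Implicit Types (k M n : nat) (x : R).

(** These remainders form a family closed under differentiation: the one of index [k.+1] has
    derivative [k.+1] times the one of index [k]. Smallness thus propagates upwards by the mean
    value theorem, starting from the Dirichlet kernel. *)
Definition fourier_rem k M x : R := (bernoulli_poly R k).[x] -
  2 * fourier_coef R k *
    \sum_(1 <= n < M.+1) trig (odd k) (2 * pi * n%:R * x) / n%:R ^+ k.

Lemma trig_le1 o (y : R) : `|trig o y| <= 1.
Proof. by case: o; [exact: sin_max|exact: cos_max]. Qed.

Lemma fourier_coefS k : fourier_coef R k.+1 * (2 * pi) * (-1) ^+ odd k.+1 =
  - k.+1%:R * fourier_coef R k.
Proof.
have pi0 : (2 * pi : R) != 0 by rewrite mulf_neq0// gt_eqF// pi_gt0.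
rewrite /fourier_coef factS natrM (exprS (2 * pi)).
have -> : (k.+1./2).+1 = (odd k + (k./2).+1)%N by rewrite -uphalfE uphalf_half addnS.
rewrite exprD oddS; move: (2 * pi) pi0 => p p0.
by case: (odd k); rewrite /= ?expr0 ?expr1; field; rewrite p0 expf_neq0.
Qed.

Lemma is_derive_mull (a x : R) : is_derive x 1 ( *%R a) a.
Proof.
have : is_derive (x : R) 1 (a \*: (@id R)) (a *: 1) by apply: is_deriveZ.
by rewrite /GRing.scale/= mulr1.
Qed.

Lemma is_derive_trig o (a x : R) : is_derive x 1 (fun y => trig o (a * y))
  (- a * (-1) ^+ o * trig (~~ o) (a * x)).
Proof.
have da := is_derive_mull a x.
case: o; rewrite /trig/= ?expr0 ?expr1.
- have := @is_derive1_comp _ sin ( *%R a) x _ _ (is_derive_sin _) da.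
  by rewrite mulrN1 opprK mulrC.
- have := @is_derive1_comp _ cos ( *%R a) x _ _ (is_derive_cos _) da.
  by rewrite mulr1 mulNr mulrC -mulNr mulNr.
Qed.

Lemma fourier_remS k M x : fourier_rem k M.+1 x = fourier_rem k M x -
  2 * fourier_coef R k * (trig (odd k) (2 * pi * M.+1%:R * x) / M.+1%:R ^+ k).
Proof. by rewrite /fourier_rem big_nat_recr//= mulrDr; ring. Qed.

Lemma fourier_rem0 k x : fourier_rem k 0 x = (bernoulli_poly R k).[x].
Proof. by rewrite /fourier_rem big_geq// mulr0 subr0. Qed.

Lemma is_derive_fourier_rem k M x :
  is_derive x 1 (fourier_rem k.+1 M) (k.+1%:R * fourier_rem k M x).
Proof.
elim: M => [|M IH].
  have -> : fourier_rem k.+1 0 = horner (bernoulli_poly R k.+1).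
    by apply/funext => y; rewrite fourier_rem0.
  by apply: is_derive_eq; rewrite deriv_bernoulli_poly hornerZ fourier_rem0.
pose a : R := 2 * pi * M.+1%:R.
pose c : R := 2 * fourier_coef R k.+1 / M.+1%:R ^+ k.+1.
have -> : fourier_rem k.+1 M.+1 = fourier_rem k.+1 M - c \*: (fun y => trig (odd k.+1) (a * y)).
  apply/funext => y; transitivity (fourier_rem k.+1 M y - c * trig (odd k.+1) (a * y)) => //.
  by rewrite fourier_remS /c /a; congr (_ - _); rewrite mulrA mulrAC.
have dt := is_deriveB IH (is_deriveZ c (is_derive_trig (odd k.+1) a x)).
apply: is_derive_eq; rewrite fourier_remS [RHS]mulrBr; congr (_ - _).
have scaleE (u v : R) : u *: v = u * v by [].
rewrite scaleE oddS negbK.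
have -> : k.+1%:R * (2 * fourier_coef R k * (trig (odd k) (2 * pi * M.+1%:R * x) / M.+1%:R ^+ k))
  = - (2 * (- k.+1%:R * fourier_coef R k) * (trig (odd k) (2 * pi * M.+1%:R * x) / M.+1%:R ^+ k)) by ring.
rewrite -fourier_coefS /c /a exprS oddS; have q0 : M.+1%:R != 0 :> R by [].
move: (pi : R) (fourier_coef R k.+1) (trig _ _) q0 => p f t.
move: (_%:R : R) => q q0.
by field; rewrite q0 expf_neq0.
Qed.

Lemma fourier_rem_dirichlet M x :
  fourier_rem 0 M x * sin (pi * x) = sin ((2 * M%:R + 1) * (pi * x)).
Proof.
elim: M => [|M IH].
  by rewrite fourier_rem0 horner_bernoulli_poly_0 mulr0 add0r !mul1r.
rewrite fourier_remS mulrBl IH /fourier_coef /trig/=.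
set y := pi * x.
have -> : 2 * pi * M.+1%:R * x = (2 * M%:R + 1) * y + y by rewrite /y -natr1; ring.
have -> : (2 * M.+1%:R + 1) * y = (2 * M%:R + 1) * y + y + y by rewrite -natr1; ring.
rewrite !expr0 expr1 !divr1 !mulr1 mulrN1.
set z := _ * y; rewrite sinD (sinD z) cosD.
have := cos2Dsin2 y => E.
(* [ring] treats sines and cosines as variables, so the Pythagorean identity is put into the leading
   term beforehand. *)
have szE : sin z = sin z * (cos y ^+ 2 + sin y ^+ 2) by rewrite E mulr1.
by rewrite [X in X - _ = _]szE; ring.
Qed.

Lemma fourier_rem_half M : fourier_rem 1 M (2^-1) = 0.
Proof.
elim: M => [|M IH]; first by rewrite fourier_rem0 horner_bernoulli_poly_1 subrr.
rewrite fourier_remS IH.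
suff -> : trig (odd 1) (2 * pi * M.+1%:R * 2^-1) = 0 :> R by rewrite mul0r mulr0 subr0.
rewrite /trig/= (_ : _ / _ = 0 + pi *+ M.+1); last by rewrite -mulr_natr; move: (pi : R) => p; field.
by rewrite (alternatingn (@sinDpi R)) sin0 mulr0.
Qed.

Lemma fourier_rem_periodic k M : fourier_rem k.+2 M 1 = fourier_rem k.+2 M 0.
Proof.
elim: M => [|M IH]; first by rewrite !fourier_rem0 horner_bernoulli_poly1.
rewrite !fourier_remS IH mulr1 mulr0.
suff -> : trig (odd k.+2) (2 * pi * M.+1%:R) = trig (odd k.+2) (0 : R) by [].
have -> : 2 * pi * M.+1%:R = 0 + (pi *+ 2) *+ M.+1 :> R.
  by rewrite add0r mulr_natl -[RHS]mulr_natr.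
by rewrite /trig; case: ifP => _; rewrite periodicn//; [exact: sinD2pi|exact: cosD2pi].
Qed.

(** The sawtooth jumps at the integers, so uniformity holds only on [d, 1 - d]. Of the two equal
    halves of the bound, one comes from the mean value theorem started at 1/2, where the remainder
    vanishes, the other from the correction term of the auxiliary function. *)
Lemma le_fourier_rem1 (d x : R) M : 0 < d -> d <= x <= 1 - d ->
  `|fourier_rem 1 M x| <= 2 / sin (pi * d) ^+ 2 / (2 * M%:R + 1).
Proof.
move=> d0 xd.
have d1 : d <= 2^-1 by lra.
have dd : d <= d <= 1 - d by lra.
have pi0 := pi_gt0 R.
pose s := sin (pi * d).
have inpi y : d <= y <= 1 - d -> 0 < pi * y < pi.
  by move=> yd; rewrite pmulr_rgt0// gtr_pMr//; apply/andP; split; lra.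
have sgt0 y : d <= y <= 1 - d -> 0 < sin (pi * y).
  by move=> /inpi; exact: sin_gt0_pi.
have s0 : 0 < s by apply: sgt0; lra.
have s_le y : d <= y <= 1 - d -> s <= sin (pi * y).
  (* Reflection in 1/2 leaves sin (pi y) unchanged and reduces the claim to [d, 1/2], where the sine
     increases. *)
  wlog y12 : y / y <= 2^-1.
    move=> H yd; case: (leP y 2^-1) => [|y12]; first by move=> /H; exact.
    have -> : sin (pi * y) = sin (pi * (1 - y)).
      by rewrite mulrBr mulr1 sinB sinpi cospi mul0r sub0r mulN1r opprK.
    by apply: H; lra.
  move=> /andP[dy _].
  have h (z : R) : 0 <= z <= 2^-1 -> pi * z \in `[(- (pi / 2)), pi / 2].
    move=> /andP[z0 z1]; rewrite in_itv/= ler_pM2l// (le_trans z1)// andbT.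
    by rewrite (@le_trans _ _ 0) ?mulr_ge0 ?(ltW pi0)// oppr_le0 divr_ge0// ltW.
  rewrite -[leRHS]/(sin (pi * y)) /s leNgt ltr_sin ?h ?ltr_pM2l//; lra.
pose q : R := 2 * M%:R + 1.
have q1 : 1 <= q by rewrite /q lerDr mulr_ge0.
have q0 : 0 < q by lra.
(* [fourier_rem 0 M] is the Dirichlet kernel sin (q pi y) / sin (pi y): the added
   term cancels it in the derivative, up to O(1 / q). *)
pose U y := fourier_rem 1 M y + (q * pi)^-1 * (cos (q * pi * y) / sin (pi * y)).
pose dU y := - q^-1 * (cos (q * pi * y) * cos (pi * y)) / sin (pi * y) ^+ 2.
have UdU y : d <= y <= 1 - d -> is_derive y 1 U (dU y).
  move=> yd; have sy0 : sin (pi * y) != 0 by rewrite gt_eqF// sgt0.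
  have d1' := is_derive_fourier_rem 0 M y.
  have d2 := @is_derive1_comp _ cos ( *%R (q * pi)) y _ _ (is_derive_cos _) (is_derive_mull _ y).
  have d3 := @is_derive1_comp _ sin ( *%R pi) y _ _ (is_derive_sin _) (is_derive_mull _ y).
  have d4 := @is_deriveV _ (sin \o ( *%R pi)) y _ 1 sy0 d3.
  have d5 := is_deriveD d1' (is_deriveZ (q * pi)^-1 (is_deriveM d2 d4)).
  have -> : U = fourier_rem 1 M + (q * pi)^-1 \*:
      ((cos \o *%R (q * pi)) * (fun z => ((sin \o *%R pi) z)^-1)) by apply/funext.
  apply: is_derive_eq.
  have scaleE (u v : R) : u *: v = u * v by [].
  rewrite !scaleE mul1r /dU/= -[fourier_rem 0 M y](mulfK sy0) fourier_rem_dirichlet -/q.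
  rewrite (mulrA q).
  move: (sin (pi * y)) sy0 (sin (q * pi * y)) (cos (q * pi * y)) (cos (pi * y)).
  move=> S S0 A B C.
  move: (pi : R) pi0 => p p0.
  by field; rewrite S0 !gt_eqF.
have dUle y : d <= y <= 1 - d -> `|dU y| <= q^-1 / s ^+ 2.
  move=> yd; rewrite /dU !normrM normrN normfV (gtr0_norm q0) -mulrA.
  rewrite ler_wpM2l ?invr_ge0 ?(ltW q0)// -[leRHS]mul1r ler_pM// ?mulr_ge0//.
    by rewrite mulr_ile1 ?cos_max.
  rewrite normfV lef_pV2 ?posrE ?exprn_gt0 ?normr_gt0 ?gt_eqF ?exprn_gt0 ?sgt0//.
  by rewrite ger0_norm ?sqr_ge0// ler_pXn2r ?nnegrE ?s_le// ltW// sgt0.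
have h12 : d <= 2^-1 <= 1 - d by lra.
have := le_lipschitz_derive UdU dUle xd h12.
have -> : U 2^-1 = 0.
  rewrite /U fourier_rem_half add0r.
  have -> : q * pi * 2^-1 = pi / 2 + pi *+ M by rewrite /q -mulr_natr; move: (pi : R) => p; field.
  by rewrite (alternatingn (@cosDpi R)) cos_pihalf mulr0 mul0r mulr0.
rewrite subr0 => Ux.
have s1 : s <= 1 by rewrite sin_le1.
have -> : fourier_rem 1 M x = U x - (q * pi)^-1 * (cos (q * pi * x) / sin (pi * x)).
  by rewrite /U addrK.
have qs : 0 <= q^-1 / s ^+ 2 by rewrite divr_ge0 ?sqr_ge0// invr_ge0 ltW.
rewrite -/s -/q (_ : 2 / s ^+ 2 / q = q^-1 / s ^+ 2 + q^-1 / s ^+ 2); last by ring.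
apply: (le_trans (ler_normB _ _)); apply: lerD.
  by rewrite (le_trans Ux)// ler_piMr// ler_norml; apply/andP; split; lra.
rewrite normrM normfV (gtr0_norm (mulr_gt0 q0 pi0)) invfM -(mulrA q^-1).
rewrite ler_wpM2l ?invr_ge0 ?(ltW q0)//.
rewrite normrM mulrA normfV -[leRHS]mul1r ler_pM//.
  by rewrite mulr_ge0// invr_ge0 ltW.
  rewrite mulr_ile1 ?cos_max// ?invr_ge0 ?(ltW pi0)// invf_le1//.
  by rewrite (le_trans _ (pi_ge2 R))// ler1n.
rewrite ger0_norm ?(ltW (sgt0 _ _))//.
rewrite lef_pV2 ?posrE ?exprn_gt0 ?sgt0// (le_trans _ (s_le _ xd))//.
by rewrite expr2 ger_pMr.
Qed.

(** The tail telescopes by 1 / (n + 1)^2 <= 1 / n - 1 / (n + 1). It compares two truncations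
    uniformly in [x], without identifying their limit. *)
Lemma fourier_rem2_tail m M x : (0 < m)%N ->
  `|fourier_rem 2 (m + M) x - fourier_rem 2 m x| <=
    `|2 * fourier_coef R 2| * (m%:R^-1 - (m + M)%:R^-1).
Proof.
move=> m0; elim: M => [|M IH]; first by rewrite addn0 !subrr normr0 mulr0.
rewrite addnS fourier_remS addrAC; set n := (m + M)%N.
have n0 : 0 < n%:R :> R by rewrite ltr0n addn_gt0 m0.
apply: (le_trans (ler_normB _ _)).
rewrite (_ : m%:R^-1 - n.+1%:R^-1 = (m%:R^-1 - n%:R^-1) + (n%:R^-1 - n.+1%:R^-1)); last by ring.
rewrite [leRHS]mulrDr; apply: lerD => //; rewrite normrM ler_wpM2l// normrM normfV.
apply: (@le_trans _ _ (n.+1%:R ^+ 2)^-1).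
  by rewrite (ger0_norm (exprn_ge0 _ _))// ler_piMl ?invr_ge0 ?exprn_ge0// trig_le1.
have q0 : 0 < n.+1%:R :> R by [].
have -> : n%:R^-1 - n.+1%:R^-1 = (n%:R * n.+1%:R)^-1 :> R.
  rewrite -natr1 in q0 *; move: (n%:R : R) n0 q0 => q q0 q1.
  by field; rewrite !gt_eqF.
by rewrite lef_pV2 ?posrE ?mulr_gt0 ?exprn_gt0// expr2 ler_pM2r// ler_nat.
Qed.

Lemma fourier_rem1_bounded m :
  exists2 L, 0 < L & forall x, 0 <= x <= 1 -> `|fourier_rem 1 m x| <= L.
Proof.
elim: m => [|m [L L0 IH]].
  exists 1 => // x x01; rewrite fourier_rem0 horner_bernoulli_poly_1 ler_norml.
  by apply/andP; split; lra.
exists (L + `|2 * fourier_coef R 1| * m.+1%:R^-1).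
  by rewrite ltr_pwDl// mulr_ge0// invr_ge0.
move=> x x01; rewrite fourier_remS (le_trans (ler_normB _ _))// lerD ?IH//.
rewrite normrM ler_wpM2l// normrM normfV expr1 normr_nat ler_piMl ?invr_ge0//.
exact: trig_le1.
Qed.

Lemma exists_nat_ge (x : R) : exists n : nat, x <= n%:R.
Proof.
by exists (Num.bound `|x|); rewrite (le_trans (ler_norm _))// ltW// archi_boundP.
Qed.

Lemma clampP (d x : R) : 0 < d <= 4^-1 -> 0 <= x <= 1 ->
  let c := Num.max d (Num.min x (1 - d)) in
  [/\ d <= c <= 1 - d, 0 <= c <= 1 & `|x - c| <= d].
Proof.
move=> d0 x01 /=.
by case: (leP x (1 - d)) => x1; [case: (leP d x) => x2|case: (leP d (1 - d)) => x2];
  rewrite ler_norml; split; try (apply/andP; split); lra.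
Qed.

(** On [d, 1 - d] the derivative of the remainder is small. Near 0 and 1 it is not, and the
    remainder is compared there with a fixed truncation [m], whose Lipschitz constant is chosen
    before [d]. The contributions add up as 3/8 + 1/4 + 3/8 = 1. *)
Lemma fourier_rem2_osc (e : R) : 0 < e -> exists M0, forall M, (M0 <= M)%N ->
  forall x y : R, 0 <= x <= 1 -> 0 <= y <= 1 ->
    `|fourier_rem 2 M x - fourier_rem 2 M y| <= e.
Proof.
move=> e0; pose K := `|2 * fourier_coef R 2|.
have [m' Hm] := exists_nat_ge (8 * K / e).
pose m := m'.+1.
have m0 : 0 < m%:R :> R by [].
have Km : K / m%:R <= e / 8.
  rewrite ler_pdivrMr// mulrAC ler_pdivlMr// [X in _ <= X]mulrC -ler_pdivrMr// (mulrC K).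
  by rewrite (le_trans Hm)// ler_nat.
have [L L0 HL] := fourier_rem1_bounded m.
pose d := Num.min (4^-1) (e / (16 * L)).
have d0 : 0 < d by rewrite lt_min invr_gt0 ltr0n divr_gt0 ?mulr_gt0.
have d4 : d <= 4^-1 by rewrite ge_min lexx.
have Ld : 2 * L * d <= e / 8.
  rewrite -ler_pdivlMl ?mulr_gt0// ge_min; apply/orP; right.
  by rewrite le_eqVlt; apply/orP; left; apply/eqP; field; rewrite gt_eqF.
have s0 : 0 < sin (pi * d).
  have pi0 := pi_gt0 R.
  by apply: sin_gt0_pi; rewrite mulr_gt0//= gtr_pMr//; lra.
pose D : R := 2 / sin (pi * d) ^+ 2.
have D0 : 0 <= D by rewrite divr_ge0 ?sqr_ge0.
have [n Hn] := exists_nat_ge (8 * D / e).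
exists (maxn m n) => M; rewrite geq_max => /andP[mM nM].
have edge (x x' : R) : 0 <= x <= 1 -> 0 <= x' <= 1 -> `|x - x'| <= d ->
    `|fourier_rem 2 M x - fourier_rem 2 M x'| <= 3 * (e / 8).
  move=> x01 x'01 xx'.
  have tail (z : R) : `|fourier_rem 2 M z - fourier_rem 2 m z| <= e / 8.
    rewrite -(subnKC mM) (le_trans (fourier_rem2_tail _ _ _))// (le_trans _ Km)//.
    by rewrite ler_wpM2l// lerBlDr lerDl invr_ge0.
  have lip : `|fourier_rem 2 m x - fourier_rem 2 m x'| <= e / 8.
    have der (z : R) : 0 <= z <= 1 -> is_derive z 1 (fourier_rem 2 m) (2 * fourier_rem 1 m z).
      by move=> _; exact: is_derive_fourier_rem.
    have derle (z : R) : 0 <= z <= 1 -> `|2 * fourier_rem 1 m z| <= 2 * L.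
      by move=> /HL; rewrite normrM normr_nat ler_pM2l.
    rewrite (le_trans (le_lipschitz_derive der derle x01 x'01))//.
    by rewrite (le_trans _ Ld)// ler_wpM2l// mulr_ge0// ltW.
  have := tail x; have := tail x'; rewrite distrC.
  move: lip; rewrite !ler_norml => /andP[? ?] /andP[? ?] /andP[? ?].
  by apply/andP; split; lra.
have mid (x y : R) : d <= x <= 1 - d -> d <= y <= 1 - d ->
    `|fourier_rem 2 M x - fourier_rem 2 M y| <= e / 4.
  move=> xd yd.
  have der (z : R) : d <= z <= 1 - d -> is_derive z 1 (fourier_rem 2 M) (2 * fourier_rem 1 M z).
    by move=> _; exact: is_derive_fourier_rem.
  have derle (z : R) : d <= z <= 1 - d -> `|2 * fourier_rem 1 M z| <= e / 4.
    move=> /(le_fourier_rem1 M d0); rewrite -/D normrM normr_nat => H.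
    suff : D / (2 * M%:R + 1) <= e / 8 by lra.
    rewrite ler_pdivrMr ?ltr_wpDl ?mulr_ge0// mulrAC ler_pdivlMr//.
    rewrite (mulrC D) [leRHS]mulrC -ler_pdivrMr// (le_trans Hn)//.
    have : (n%:R : R) <= M%:R by rewrite ler_nat.
    have : (0 : R) <= M%:R by [].
    lra.
  rewrite (le_trans (le_lipschitz_derive der derle xd yd))//.
  rewrite ler_piMr ?divr_ge0 ?(ltW e0)// ler_norml; apply/andP; split; lra.
pose c x := Num.max d (Num.min x (1 - d)).
have cP (x : R) : 0 <= x <= 1 -> [/\ d <= c x <= 1 - d, 0 <= c x <= 1 & `|x - c x| <= d].
  by move=> x01; apply: clampP => //; rewrite d0.
move=> x y x01 y01; have [cx1 cx2 cx3] := cP _ x01; have [cy1 cy2 cy3] := cP _ y01.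
have := edge _ _ x01 cx2 cx3; have := edge _ _ y01 cy2 cy3; have := mid _ _ cx1 cy1.
rewrite !ler_norml => /andP[? ?] /andP[? ?] /andP[? ?].
by apply/andP; split; lra.
Qed.

(** Rolle's theorem for the next remainder, which takes equal values at 0 and 1. A zero fixes the
    additive constant that control of the oscillation leaves open. *)
Lemma fourier_rem_root k M : exists2 c : R, 0 <= c <= 1 & fourier_rem k.+1 M c = 0.
Proof.
have [//| | |c] := @MVT R (fourier_rem k.+2 M) (fun z => k.+2%:R * fourier_rem k.+1 M z) 0 1.
- by move=> x _; exact: is_derive_fourier_rem.
- apply: derivable_within_continuous => z _.
  by have [] := is_derive_fourier_rem k.+1 M z.
rewrite in_itv/= => /andP[c0 c1].
rewrite fourier_rem_periodic subrr subr0 mulr1 => /esym/eqP.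
rewrite mulf_eq0 pnatr_eq0/= => /eqP c00.
by exists c => //; rewrite !ltW.
Qed.

Lemma fourier_rem_unif k (e : R) : 0 < e -> exists M0, forall M, (M0 <= M)%N ->
  forall x, 0 <= x <= 1 -> `|fourier_rem k.+2 M x| <= e.
Proof.
elim: k e => [|k IH] e e0.
  have [M0 HM0] := fourier_rem2_osc e0; exists M0 => M /HM0 H x x01.
  by have [c c01 c0] := fourier_rem_root 1 M; have := H _ _ x01 c01; rewrite c0 subr0.
have [|M0 HM0] := IH (e / k.+3%:R); first by rewrite divr_gt0.
exists M0 => M /HM0 H x x01.
have [c c01 c0] := fourier_rem_root k.+2 M.
have der (z : R) : 0 <= z <= 1 -> is_derive z 1 (fourier_rem k.+3 M) (k.+3%:R * fourier_rem k.+2 M z).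
  by move=> _; exact: is_derive_fourier_rem.
have derle (z : R) : 0 <= z <= 1 -> `|k.+3%:R * fourier_rem k.+2 M z| <= e.
  by move=> /H; rewrite ler_pdivlMr// normrM normr_nat mulrC.
have := le_lipschitz_derive der derle x01 c01.
rewrite c0 subr0 => /le_trans; apply; rewrite ler_piMr ?(ltW e0)// ler_norml.
by apply/andP; split; lra.
Qed.

Lemma trig_periodicz o (y : R) (z : int) : trig o (y + 2 * pi * z%:~R) = trig o y.
Proof.
have H (n : nat) (w : R) : trig o (w + 2 * pi * n%:R) = trig o w :> R.
  rewrite mulr_natl [in X in w + X]mulr_natr /trig.
  by case: ifP => _; rewrite periodicn//; [exact: sinD2pi|exact: cosD2pi].
case: z => n; first exact: H.
by rewrite NegzE mulrNz mulrN -[in RHS](subrK (2 * pi * n.+1%:R) y) H.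
Qed.

Lemma periodic_bernoulli_cvg k x : (0 < k)%N ->
  (fun M => 2 * fourier_coef R k *
    \sum_(1 <= n < M) trig (odd k) (2 * pi * n%:R * x) / n%:R ^+ k) @ \oo
    --> periodic_bernoulli k x.
Proof.
move=> k0; rewrite -cvg_shiftS; pose t := x - (Num.floor x)%:~R.
have t01 : 0 <= t < 1.
  by rewrite /t subr_ge0 floor_le/= ltrBlDl; have := floorD1_gt x; rewrite intrD.
have trigE n : trig (odd k) (2 * pi * n%:R * x) = trig (odd k) (2 * pi * n%:R * t).
  rewrite -(trig_periodicz _ (2 * pi * n%:R * t) (n%:Z * Num.floor x)); congr trig.
  by rewrite /t intrM; ring.
rewrite /periodic_bernoulli -/t.
have E M : 2 * fourier_coef R k *
    \sum_(1 <= n < M.+1) trig (odd k) (2 * pi * n%:R * x) / n%:R ^+ k =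
    (bernoulli_poly R k).[t] - fourier_rem k M t.
  by rewrite /fourier_rem opprB addrC subrK; under eq_bigr do rewrite trigE.
(* At an integer with [k = 1] every sine vanishes, in agreement with the convention for the sawtooth
   at 0. *)
case: ifPn => [/andP[/eqP k1 /eqP t0]|kt].
  rewrite [X in X @ _](_ : _ = cst 0); first exact: cvg_cst.
  apply/funext => M; rewrite /= big1 ?mulr0// => n _.
  by rewrite trigE t0 mulr0 k1 /trig/= sin0 mul0r.
rewrite [X in X @ _](_ : _ = fun M => (bernoulli_poly R k).[t] - fourier_rem k M t); last exact/funext.
apply/cvgrPdist_le => e e0.
have [M0 HM0] : exists M0, forall M, (M0 <= M)%N -> `|fourier_rem k M t| <= e.
  clear E trigE; case: k k0 kt => [//|[|k]] _ kt.
    have t0 : 0 < t by rewrite eqxx/= in kt; rewrite lt_neqAle eq_sym kt; case/andP: t01.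
    (* For [k = 1] convergence is only pointwise: the threshold depends on the distance [d] of [t]
       from the integers. *)
    pose d := Num.min t (1 - t).
    have d0 : 0 < d by rewrite lt_min t0 subr_gt0; case/andP: t01.
    have td : d <= t <= 1 - d.
      by rewrite ge_min lexx/= lerBrDr -lerBrDl ge_min lexx orbT.
    pose D : R := 2 / sin (pi * d) ^+ 2.
    have D0 : 0 <= D by rewrite divr_ge0 ?sqr_ge0.
    have [n Hn] := exists_nat_ge (D / e).
    exists n => M nM; rewrite (le_trans (le_fourier_rem1 _ d0 td))// -/D.
    rewrite ler_pdivrMr ?ltr_wpDl ?mulr_ge0// mulrC -ler_pdivrMr// (le_trans Hn)//.
    have : (n%:R : R) <= M%:R by rewrite ler_nat.
    have : (0 : R) <= M%:R by [].
    lra.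
  have [M0 HM0] := fourier_rem_unif k e0; exists M0 => M /HM0; apply.
  by case/andP: t01 => -> /ltW ->.
exists M0 => // M /= M0M.
by rewrite opprB addrC subrK; exact: HM0.
Qed.

End Fourier.

(** * The trigonometric matrix *)

(** [bernoulli_dim] with the parity itself as argument; it is the dimension of the functions of
    parity [o] on Z/N. *)
Definition symdim (o : bool) (N : nat) : nat :=
  if o then Nminus N else (Nplus N).+1.

(* The size of {a, -a} in Z/N, for 0 <= a <= N^+. *)
Definition orbit_size (N a : nat) : nat := (0 < a <= Nminus N).+1.

Definition parity_fun (K : pzRingType) (o : bool) (N : nat) (f : int -> K) :=
  (forall n, f (n + N%:Z) = f n) /\ (forall n, f (- n) = (-1) ^+ o * f n).

Section Fold.
Variables (K : numFieldType) (o : bool) (N : nat).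
Hypothesis N0 : (0 < N)%N.

Lemma Nplus_Nminus : (Nplus N + Nminus N).+1 = N.
Proof. rewrite /Nplus /Nminus; have := odd_double_half N; have := odd_double_half N.-1; lia. Qed.

Lemma Nplus_cases : Nplus N = Nminus N \/ Nplus N = (Nminus N).+1.
Proof. by rewrite /Nplus /Nminus; lia. Qed.

(** As N = N^+ + N^- + 1, the residues beyond N^+ are the negatives of 1, ..., N^-. *)
Lemma sum_even_periodic (h : int -> K) : (forall n, h (n + N%:Z) = h n) ->
  (forall n, h (- n) = h n) ->
  \sum_(0 <= a < N) h a%:Z =
  \sum_(0 <= a < (Nplus N).+1) h a%:Z + \sum_(1 <= a < (Nminus N).+1) h a%:Z.
Proof.
move=> hN hE; have NN := Nplus_Nminus.
rewrite (big_cat_nat (n := (Nplus N).+1))//=; last by lia.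
congr (_ + _); move: (Nplus N) (Nminus N) NN => p q NN.
rewrite -NN -[p.+1]add1n big_addn subSn ?leq_addr// addKn.
rewrite big_nat_rev/=; apply: eq_big_nat => i /andP[i1 i2].
by rewrite -hE -[LHS]hN; congr h; lia.
Qed.

(** 0 and N/2 are the fixed points of a -> -a on Z/N, and an odd function vanishes there; hence the
    range 1..N^- in odd parity. *)
Lemma parity_fun_half (f : int -> K) : parity_fun true N f ->
  f 0 = 0 /\ forall m, N = m.*2 -> f m%:Z = 0.
Proof.
have H x : x = -1 * x -> x = 0 :> K.
  move=> /eqP; rewrite mulN1r -subr_eq0 opprK -mulr2n mulrn_eq0/=.
  by move=> /eqP.
move=> [fN fE]; split => [|m Nm]; apply: H; rewrite -[-1]expr1 -[1%N]/(true : nat) -fE ?oppr0//.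
by rewrite -[RHS]fN; congr f; lia.
Qed.

Lemma parity_funM (f g : int -> K) : parity_fun o N f -> parity_fun o N g ->
  (forall n, f (n + N%:Z) * g (n + N%:Z) = f n * g n) /\
  (forall n, f (- n) * g (- n) = f n * g n).
Proof.
move=> [fN fE] [gN gE]; split => n; rewrite ?fN ?gN// fE gE mulrACA -signr_addb.
by rewrite addbb expr0 mul1r.
Qed.

Lemma sum_parity_fun (f g : int -> K) : parity_fun o N f -> parity_fun o N g ->
  \sum_(0 <= a < N) f a%:Z * g a%:Z =
  \sum_(i < symdim o N) (orbit_size N (o + i))%:R *
     (f (o + i)%N%:Z * g (o + i)%N%:Z).
Proof.
move=> fP gP; have [hN hE] := parity_funM fP gP; have PM := Nplus_cases.
rewrite (sum_even_periodic hN hE) /symdim; move: fP; case: o => fP.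
- have [f0 fm] := parity_fun_half fP.
  rewrite big_nat_recl// f0 mul0r add0r.
  transitivity (\sum_(1 <= a < (Nminus N).+1) f a%:Z * g a%:Z *+ 2).
    rewrite big_split/=; congr (_ + _).
    rewrite -(big_add1 _ _ 0 (Nplus N).+1 xpredT (fun a => f a%:Z * g a%:Z)).
    have NN := Nplus_Nminus; case: PM => [->//|PM].
    rewrite PM big_nat_recr//= fm ?mul0r ?addr0//; lia.
  rewrite big_add1/= big_mkord; apply: eq_bigr => i _.
  by rewrite /orbit_size /= add1n/= ltn_ord mulr_natl.
- rewrite [in RHS](eq_bigr (fun i : 'I__ => f i%:Z * g i%:Z +
    if (0 < i <= Nminus N)%N then f i%:Z * g i%:Z else 0)); last first.
    move=> i _; rewrite /orbit_size add0n; case: ifP => _; rewrite ?mulr_natl ?mul1r ?addr0//.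
  rewrite big_split/= big_mkord; congr (_ + _).
  rewrite -big_mkcond/= -(big_mkord (fun i => 0 < i <= Nminus N)%N (fun i => f i%:Z * g i%:Z)).
  rewrite [RHS]big_mkcond [RHS](big_cat_nat (n := (Nminus N).+1))//=; last by rewrite ltnS; lia.
  rewrite [X in _ = _ + X]big1_seq ?addr0; last first.
    by move=> i /andP[_]; rewrite mem_index_iota => /andP[Hi _]; rewrite (leqNgt i) Hi andbF.
  rewrite [RHS]big_nat_recl//= add0r [LHS]big_add1/=; apply: eq_big_nat => i /andP[_ iN].
  by rewrite iN.
Qed.

End Fold.

Section Trig.
Variables (R : realType).
Implicit Types (o : bool) (N : nat).

Lemma trig_parity_fun o N (j : nat) : (0 < N)%N ->
  parity_fun o N (fun n : int => trig o (2 * pi * (n%:~R * j%:R / N%:R)) : R).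
Proof.
move=> N0; have N0' : N%:R != 0 :> R by rewrite pnatr_eq0 -lt0n.
split=> n.
- rewrite -(trig_periodicz o (2 * pi * (n%:~R * j%:R / N%:R)) j%:Z); congr trig.
  by rewrite intrD -!pmulrn; move: (pi : R) => p; field.
- rewrite mulrNz !mulNr mulrN; case: o; rewrite /trig ?sinN ?cosN ?expr1 ?expr0 ?mul1r//.
  by rewrite mulN1r.
Qed.

Lemma sum_cos_telescope (y : R) N :
  2 * sin y * \sum_(0 <= a < N) cos (2 * y * a%:R) = sin ((2 * N%:R - 1) * y) + sin y.
Proof.
elim: N => [|N IH]; first by rewrite big_geq// !mulr0 sub0r mulN1r sinN addNr.
rewrite big_nat_recr//= mulrDr IH.
have -> : (2 * N.+1%:R - 1) * y = 2 * y * N%:R + y by rewrite -natr1; ring.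
have -> : (2 * N%:R - 1) * y = 2 * y * N%:R - y by ring.
by rewrite sinB [sin (_ + y)]sinD; ring.
Qed.

Lemma sum_cos N (n : int) : (0 < N)%N ->
  \sum_(0 <= a < N) cos (2 * pi * (a%:R * n%:~R / N%:R)) =
  if (N %| n)%Z then N%:R else 0 :> R.
Proof.
move=> N0; have N0' : N%:R != 0 :> R by rewrite pnatr_eq0 -lt0n.
have NZ : N%:Z != 0 by rewrite eqz_nat -lt0n.
(* Reduction mod [N] puts the half angle in [0, pi), so its sine is nonzero unless [N] divides [n],
   and the telescoped sum can be divided by it. *)
have red a : cos (2 * pi * (a%:R * n%:~R / N%:R)) =
    cos (2 * (pi * (n %% N)%Z%:~R / N%:R) * a%:R) :> R.
  rewrite -[RHS](trig_periodicz false _ ((n %/ N)%Z * a%:Z)) /trig; congr cos.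
  rewrite {1}(divz_eq n N) intrD !intrM -!pmulrn.
  by move: (pi : R) => p; field.
under eq_bigr do rewrite red.
have := modz_ge0 n NZ; have := ltz_pmod n (_ : 0 < N%:Z) => /(_ N0).
rewrite (sameP dvdz_mod0P eqP); case: (n %% N)%Z => // r rN _.
have [->|r0] := eqVneq r 0%N.
  rewrite mulr0 mul0r mulr0; under eq_bigr do rewrite mul0r cos0.
  by rewrite sumr_const_nat subn0.
set y : R := _ / _.
have sy : sin y != 0.
  rewrite gt_eqF// sin_gt0_pi// /y divr_gt0 ?mulr_gt0 ?pi_gt0 ?ltr0n ?lt0n//=.
  by rewrite ltr_pdivrMr ?ltr0n// ltr_pM2l ?pi_gt0// ltr_nat.
apply: (mulfI (mulf_neq0 (_ : 2 != 0) sy)); rewrite ?pnatr_eq0//.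
rewrite sum_cos_telescope eqz_nat (negPf r0) mulr0.
have -> : (2 * N%:R - 1) * y = - y + 2 * pi * r%:Z%:~R.
  by rewrite /y -pmulrn; move: (pi : R) => p; field.
by have := trig_periodicz true (- y) r; rewrite /trig => ->; rewrite sinN addNr.
Qed.

Lemma trigM o (a b : R) :
  trig o a * trig o b = (cos (a - b) + (-1) ^+ o * cos (a + b)) / 2.
Proof. by rewrite cosB cosD; case: o; rewrite /trig ?expr0 ?expr1; field. Qed.

Lemma sum_trigM o N (i j : nat) : (0 < N)%N ->
  (i < symdim o N)%N -> (j < symdim o N)%N ->
  \sum_(0 <= a < N) trig o (2 * pi * (a%:Z%:~R * (o + i)%:R / N%:R)) *
     trig o (2 * pi * (a%:Z%:~R * (o + j)%:R / N%:R)) =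
  if i == j then N%:R / (orbit_size N (o + i))%:R else 0 :> R.
Proof.
move=> N0 iN jN.
have NN := Nplus_Nminus N0.
have PM := Nplus_cases N0.
under eq_bigr do rewrite trigM -mulrBr -mulrDr -mulrBl -mulrDl -mulrBr -mulrDr.
rewrite -mulr_suml big_split/= -mulr_sumr.
have natB : (o + i)%:R - (o + j)%:R = ((o + i)%:Z - (o + j)%:Z)%:~R :> R.
  by rewrite intrB -!pmulrn.
have natD : (o + i)%:R + (o + j)%:R = ((o + i)%:Z + (o + j)%:Z)%:~R :> R.
  by rewrite intrD -!pmulrn.
rewrite natB natD !sum_cos//; clear natB natD.
have -> : (N %| (o + i)%:Z - (o + j)%:Z)%Z = (i == j).
  apply/idP/eqP => [|->]; last by rewrite subrr dvdz0.
  apply: contraTeq => ij; rewrite dvdzE/= gtnNdvd//; first by lia.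
  by move: iN jN; rewrite /symdim; case: (o); lia.
(* Both indices are at most N/2, so their sum is divisible by [N] only if both are 0 or both are
   N/2, the fixed points of negation. There the second cosine sum doubles the first, which matches
   orbit size 1. *)
have -> : (N %| (o + i)%:Z + (o + j)%:Z)%Z = (i == j) && ~~ (0 < o + i <= Nminus N)%N.
  rewrite -PoszD dvdzE/=.
  have ijN : (o + i + (o + j) <= N)%N by move: iN jN; rewrite /symdim; case: (o); lia.
  have [m0|m0] := posnP (o + i + (o + j)); first by rewrite m0 dvdn0; symmetry; lia.
  have [mN|mN] := ltnP (o + i + (o + j)) N.
    rewrite gtnNdvd//; case: eqP => //= ij; apply/esym/negbTE; rewrite negbK.
    by move: iN; rewrite /symdim; case: (o) mN m0; rewrite -ij /=; lia.
  have -> : (o + i + (o + j) = N)%N by lia.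
  rewrite dvdnn; apply/esym/andP.
  by move: iN jN; rewrite /symdim; case: (o) mN m0 ijN => /=; split; lia.
case: eqP => /= _; last by rewrite mulr0 addr0 mul0r.
rewrite /orbit_size; case: (boolP (0 < _ <= _)%N) => H /=.
  by rewrite mulr0 addr0.
move: iN H; rewrite /symdim; clear jN; case: o => [|_ _]; first by rewrite /=; lia.
by rewrite expr0 mul1r; field.
Qed.

Definition trig_mx o N : 'M[R]_(symdim o N) :=
  \matrix_(i, j) trig o (2 * pi * ((o + i)%:R * (o + j)%:R / N%:R)).

Lemma trig_mx_sqr o N : (0 < N)%N ->
  trig_mx o N *m diag_mx (\row_i (orbit_size N (o + i))%:R) *m trig_mx o N =
  diag_mx (\row_i (N%:R / (orbit_size N (o + i))%:R)).
Proof.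
move=> N0; apply/matrixP => i j; rewrite mul_mx_diag !mxE.
transitivity (\sum_(l < symdim o N) (orbit_size N (o + l))%:R *
   (trig o (2 * pi * ((o + l)%N%:Z%:~R * (o + i)%:R / N%:R)) *
    trig o (2 * pi * ((o + l)%N%:Z%:~R * (o + j)%:R / N%:R)) : R)).
  apply: eq_bigr => l _; rewrite !mxE [X in X * _]mulrC -[LHS]mulrA; congr (_ * (_ * _)).
  by rewrite (mulrC (o + i)%:R).
rewrite -(sum_parity_fun N0 (trig_parity_fun o (o + i) N0) (trig_parity_fun o (o + j) N0)).
by rewrite sum_trigM// -mulrb val_eqE.
Qed.

(* The Chebyshev polynomials of the first kind for [o = false], and of the second
   kind for [o = true]. *)
Fixpoint trig_poly o j : {poly R} :=
  if j is j'.+1 then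
    if j' is j''.+1 then 'X * trig_poly o j' *+ 2 - trig_poly o j''
    else o.+1%:R *: 'X
  else 1.

Lemma trig_polySS o j :
  trig_poly o j.+2 = 'X * trig_poly o j.+1 *+ 2 - trig_poly o j.
Proof. by []. Qed.

Lemma trig_polyE o j (t : R) : trig o ((o + j)%:R * t) =
  (if o then sin t else 1) * (trig_poly o j).[cos t].
Proof.
suff [] : trig o ((o + j)%:R * t) = (if o then sin t else 1) * (trig_poly o j).[cos t]
  /\ trig o ((o + j.+1)%:R * t) =
     (if o then sin t else 1) * (trig_poly o j.+1).[cos t] by [].
elim: j => [|j [IH1 IH2]].
  rewrite /= hornerC hornerZ hornerX; case: (o); rewrite /trig.
    rewrite -[(true + 0)%N]/1%N -[(true + 1)%N]/2%N -[true.+1]/2%N mul1r mulr1.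
    by rewrite mulr_natl sin_mulr2n -mulr_natl; split=> //; ring.
  rewrite -[(false + 0)%N]/0%N -[(false + 1)%N]/1%N -[false.+1]/1%N.
  by rewrite mul0r cos0 !mul1r.
split=> //; rewrite trig_polySS hornerD hornerN hornerMn hornerM hornerX mulrBr -IH1.
have -> : (o + j.+2)%:R * t = (o + j.+1)%:R * t + t by rewrite !addnS -[in LHS]natr1 mulrDl mul1r.
have -> : (o + j)%:R * t = (o + j.+1)%:R * t - t by rewrite addnS -[in RHS]natr1 mulrDl mul1r addrK.
rewrite mulrnAr mulrCA -IH2; case: (o); rewrite /trig.
  by rewrite sinD sinB -mulr_natl; ring.
by rewrite cosB cosD -mulr_natl; ring.
Qed.

Lemma trig_poly_coef o j :
  (forall l, (j < l)%N -> (trig_poly o j)`_l = 0) /\ 0 < (trig_poly o j)`_j.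
Proof.
suff [] : ((forall l, (j < l)%N -> (trig_poly o j)`_l = 0) /\ 0 < (trig_poly o j)`_j)
  /\ ((forall l, (j.+1 < l)%N -> (trig_poly o j.+1)`_l = 0) /\ 0 < (trig_poly o j.+1)`_j.+1) by [].
elim: j => [|j [[IH1 IH2] [IH3 IH4]]].
  split; split=> [[|[|l]]|] //=; rewrite ?coef1 ?coefZ ?coefX ?mulr0 ?mulr1//.
split=> //; split=> [l jl|]; rewrite trig_polySS coefB coefMn coefXM.
  rewrite IH1 1?ltnW// 1?ltnW// subr0; case: l jl => [//|l] jl/=.
  by rewrite IH3// mul0rn.
by rewrite /= IH1// subr0 pmulrn_rgt0.
Qed.

(** cos (j x) and sin ((j + 1) x) / sin x are polynomials of degree j in cos x, so the last factor
    is upper triangular. *)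
Lemma trig_mx_factor o N (x := fun i : nat => 2 * pi * ((o + i)%:R / N%:R)) :
  trig_mx o N =
  diag_mx (\row_i (if o then sin (x i) else 1)) *m
  (Vandermonde (symdim o N) (\row_i cos (x i)))^T *m
  \matrix_(l, j) (trig_poly o j)`_l.
Proof.
apply/matrixP => i j; rewrite mul_diag_mx !mxE.
have -> : 2 * pi * ((o + i)%:R * (o + j)%:R / N%:R) = (o + j)%:R * x i :> R.
  by rewrite /x; ring.
rewrite trig_polyE (horner_coef_wide (n := symdim o N)).
  rewrite mulr_sumr; apply: eq_bigr => l _; rewrite !mxE -mulrA; congr (_ * _).
  by rewrite mulrC.
apply/leq_sizeP => l jl; apply: (trig_poly_coef o j).1.
by rewrite (leq_trans (ltn_ord j)).
Qed.

(** The sines and the leading coefficients are positive. The cosines decrease along [0, pi], so each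
    of the n (n - 1) / 2 factors of the Vandermonde determinant is negative. *)
Lemma det_trig_mx_sign o N : (0 < N)%N ->
  0 < (-1) ^+ ((symdim o N * (symdim o N).-1)./2) * \det (trig_mx o N).
Proof.
move=> N0; rewrite trig_mx_factor !det_mulmx det_diag det_tr det_Vandermonde.
set n := symdim o N; pose x (i : nat) : R := 2 * pi * ((o + i)%:R / N%:R).
have xpi i : (i < n)%N -> x i \in `[0, pi].
  move=> iN; rewrite in_itv/= /x; apply/andP; split.
    by rewrite !mulr_ge0// ?pi_ge0// invr_ge0.
  rewrite [2 * _]mulrC -mulrA ger_pMr ?pi_gt0// mulrA ler_pdivrMr ?ltr0n// mul1r.
  rewrite -natrM ler_nat; move: iN; rewrite /n /symdim /Nplus /Nminus; case: (o); lia.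
have x_lt i j : (i < j)%N -> x i < x j.
  move=> ij; rewrite ltr_pM2l ?mulr_gt0 ?pi_gt0// ltr_pM2r ?invr_gt0 ?ltr0n//.
  by rewrite ltr_nat ltn_add2l.
rewrite -[\det (\matrix_(_, _) _)]det_tr det_trig; last first.
  by apply/is_trig_mxP => i j ij; rewrite !mxE (trig_poly_coef o i).1.
rewrite mulrCA -!mulrA mulr_gt0//.
  apply: prodr_gt0 => i _; rewrite mxE -/(x i).
  case: ifP => // oT; apply: sin_gt0_pi; apply/andP; split.
    by rewrite /x oT !mulr_gt0 ?pi_gt0 ?invr_gt0 ?ltr0n.
  rewrite /x [2 * _]mulrC -mulrA gtr_pMr ?pi_gt0// mulrA ltr_pdivrMr ?ltr0n// mul1r.
  rewrite -natrM ltr_nat; have : (i < symdim o N)%N := ltn_ord i.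
  by move: (nat_of_ord i) => i'; rewrite /symdim /Nminus oT /=; lia.
rewrite mulrA mulr_gt0//; last first.
  by apply: prodr_gt0 => i _; rewrite !mxE (trig_poly_coef o i).2.
have -> : ((n * n.-1)./2 = \sum_(i < n) \sum_(j < n | i < j) 1)%N.
  rewrite (exchange_big_dep xpredT)//= -bin2 -bin2_sum big_mkord; apply: eq_bigr => j _.
  by rewrite -(big_ord_widen n (fun=> 1%N)) ?sum_nat_const ?card_ord ?muln1// ltnW.
rewrite expr_sum -big_split/=; apply: prodr_gt0 => i _.
rewrite expr_sum -big_split/=; apply: prodr_gt0 => j ij.
rewrite expr1 !mxE mulrN1 opprB subr_gt0 -/(x i) -/(x j) ltr_cos ?xpi//.
exact: x_lt.
Qed.

(** Orthogonality yields only the square of the determinant; the sign lemma selects the root. *)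
Lemma det_trig_mx o N : (0 < N)%N ->
  \det (trig_mx o N) = (-1) ^+ ((symdim o N * (symdim o N).-1)./2) *
    Num.sqrt N%:R ^+ symdim o N /
    \prod_(i < symdim o N) (orbit_size N (o + i))%:R.
Proof.
move=> N0; set W := \prod_(i < _) _; set s := _ ^+ (_)./2; set n := symdim o N.
have W0 : 0 < W by apply: prodr_gt0.
have := congr1 determinant (trig_mx_sqr o N0).
rewrite !det_mulmx !det_diag.
under [in LHS]eq_bigr do rewrite mxE.
under [in RHS]eq_bigr do rewrite mxE.
rewrite -/W big_split/= prodfV -/W prodr_const card_ord -/n => E.
have E2 : (s * \det (trig_mx o N) * W) ^+ 2 = (Num.sqrt N%:R ^+ n) ^+ 2.
  rewrite !exprMn -/n sqrr_sign mul1r -exprM mulnC exprM sqr_sqrtr// -(divfK (lt0r_neq0 W0) (N%:R ^+ n)).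
  by rewrite -E; ring.
have spos := det_trig_mx_sign o N0.
have E3 : s * \det (trig_mx o N) * W = Num.sqrt N%:R ^+ n.
  by apply: (pexpIrn (n := 2)) => //; rewrite nnegrE ?exprn_ge0 ?sqrtr_ge0// mulr_ge0 ?ltW.
by rewrite -mulrA -E3 mulfK ?gt_eqF// mulrA -expr2 sqrr_sign mul1r.
Qed.

End Trig.

(** * The convolution matrix *)

Section Periodic.
Variables (K : Type) (d : nat) (f : int -> K).
Hypothesis fD : forall n, f (n + d%:Z) = f n.

Lemma periodicz (q n : int) : f (n + q * d%:Z) = f n.
Proof.
have fDn (m : nat) x : f (x + (m * d)%N%:Z) = f x.
  elim: m => [|m IH]; first by rewrite mul0n addr0.
  by rewrite mulSn addnC PoszD addrA fD.
case: q => m; first by rewrite -PoszM fDn.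
by rewrite -(fDn m.+1) NegzE mulNr -PoszM subrK.
Qed.

Lemma periodic_modz (n : int) : f (n %% d%:Z)%Z = f n.
Proof. by rewrite [in RHS](divz_eq n d%:Z) addrC periodicz. Qed.

Lemma periodic_modn (n : nat) : f (n %% d)%N%:Z = f n%:Z.
Proof. by rewrite -modz_nat periodic_modz. Qed.

End Periodic.

Section Characters.
Variable C : numFieldType.
Implicit Types (d : nat) (chi psi : int -> C).

Lemma dirichlet_characterM d chi psi : dirichlet_character C d chi ->
  dirichlet_character C d psi -> dirichlet_character C d (chi \* psi).
Proof.
move=> [a1 a2 a3 a4] [b1 b2 b3 b4]; split=> /= [|m n|n|n].
- by rewrite a1 b1 mulr1.
- by rewrite a2 b2 mulrACA.
- by rewrite a3 b3.
- by rewrite mulf_eq0 negb_or a4 b4 andbb.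
Qed.

Lemma dirichlet_characterV d chi : dirichlet_character C d chi ->
  dirichlet_character C d (fun n => (chi n)^-1).
Proof.
move=> [a1 a2 a3 a4]; split=> /= [|m n|n|n].
- by rewrite a1 invr1.
- by rewrite a2 invfM.
- by rewrite a3.
- by rewrite invr_eq0 a4.
Qed.

Lemma dirichlet_characterN d chi (n : int) : dirichlet_character C d chi ->
  chi (- n) = chi (-1) * chi n.
Proof. by move=> [_ chiM _ _]; rewrite -chiM mulN1r. Qed.

(** Multiplication by [c] permutes the residues, so the sum S satisfies chi(c) S = S. Being
    nonprincipal is expressed by the witness [c], which will be -1 for odd characters. *)
Lemma sum_dirichlet_character0 d chi (c : int) : (0 < d)%N ->
  dirichlet_character C d chi -> chi c != 0 -> chi c != 1 ->
  \sum_(0 <= a < d) chi a%:Z = 0.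
Proof.
move=> d0 [chi1 chiM chiD chiN0] c0 c1.
have [c' c'E] : exists c' : nat, chi c = chi c'%:Z.
  have dz : d%:Z != 0 by rewrite eqz_nat -lt0n.
  by rewrite -(periodic_modz chiD); have := modz_ge0 c dz; case: (c %% _)%Z => // m; exists m.
rewrite c'E in c0 c1 => {c c'E}; rewrite big_mkord.
have cop : coprimez d%:Z c'%:Z by rewrite coprimez_sym -chiN0.
pose h (a : 'I_d) : 'I_d := Ordinal (ltn_pmod (c' * a) d0).
have hI : injective h.
  move=> a b /(congr1 val)/= E.
  have : (d%:Z %| c'%:Z * (a%:Z - b%:Z))%Z by rewrite mulrBr -!PoszM -eqz_mod_dvd !modz_nat E.
  rewrite Gauss_dvdzr// -eqz_mod_dvd !modz_nat !modn_small// => /eqP[].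
  exact: val_inj.
set S := \sum_(_ < d) _.
have : chi c'%:Z * S = S.
  rewrite mulr_sumr [RHS](reindex_inj hI); apply: eq_bigr => a _.
  by rewrite /h/= (periodic_modn chiD) PoszM chiM.
by move/eqP; rewrite -subr_eq0 -{2}[S]mul1r -mulrBl mulf_eq0 subr_eq0 (negPf c1) => /eqP.
Qed.

Lemma sum_dirichlet_characterV d chi : (0 < d)%N ->
  dirichlet_character C d chi ->
  \sum_(0 <= a < d) chi a%:Z * (chi a%:Z)^-1 = (totient d)%:R.
Proof.
move=> d0 [_ _ _ chiN0]; rewrite totient_count_coprime natr_sum.
apply: eq_bigr => a _; rewrite coprime_sym -[coprime a d]/(coprimez a%:Z d%:Z) -chiN0.
by case: eqVneq => [->|?]; rewrite ?mul0r// divff.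
Qed.

(** Values are inverted rather than conjugated, which makes sense in any [numFieldType]; since the
    inverse of 0 is 0, non-units drop out by themselves. *)
Lemma dirichlet_character_orth d chi psi : (0 < d)%N ->
  dirichlet_character C d chi -> dirichlet_character C d psi ->
  \sum_(0 <= a < d) (psi a%:Z)^-1 * chi a%:Z = (totient d)%:R *+ (psi == chi).
Proof.
move=> d0 chiP psiP; case: eqVneq => [->|/eqP ne].
  by under eq_bigr do rewrite mulrC; exact: sum_dirichlet_characterV.
have [n chin] : exists n, psi n <> chi n.
  by apply: contrapT => H; apply: ne; apply/funext => n; apply: contrapT => H'; apply: H; exists n.
have P := dirichlet_characterM (dirichlet_characterV psiP) chiP.
have psin : psi n != 0.
  apply/negP => psi0; have chi0 : chi n == 0.
    by case: chiP psiP => [_ _ _ A] [_ _ _ B]; apply/negPn; rewrite A -B negbK.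
  by apply: chin; rewrite (eqP psi0) (eqP chi0).
have chin0 : chi n != 0.
  by case: chiP psiP => [_ _ _ A] [_ _ _ B]; rewrite A -B.
apply: (sum_dirichlet_character0 d0 P (c := n)) => /=.
  by rewrite mulf_neq0// invr_eq0.
by rewrite mulrC; apply/eqP => /(canRL (mulfVK psin)); rewrite mul1r => /esym.
Qed.

End Characters.

Section Lift.
Variables (C : numFieldType) (N : nat).
Hypothesis N0 : (0 < N)%N.
Implicit Types (d : nat) (chi psi : int -> C) (o : bool).

Lemma divn_dvd_gt0 d : (d %| N)%N -> (0 < N %/ d)%N.
Proof. by move=> dN; rewrite divn_gt0 ?(dvdn_gt0 N0 dN)// dvdn_leq. Qed.

(** This is not the inflation of [chi] to modulus [N]: it is carried by the multiples b (N/d), where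
    its value is chi(b). For d | N it is nonzero exactly where gcd(a, N) = N/d, so different [d]
    have disjoint supports. *)
Definition char_lift d chi (a : int) : C :=
  if ((N %/ d)%N%:Z %| a)%Z then chi (a %/ (N %/ d)%N%:Z)%Z else 0.

Lemma char_lift_mull d chi (b : int) : (d %| N)%N ->
  char_lift d chi (b * (N %/ d)%N%:Z) = chi b.
Proof.
move=> dN; rewrite /char_lift dvdz_mull ?dvdzz// mulzK//.
by rewrite eqz_nat -lt0n divn_dvd_gt0.
Qed.

Lemma char_liftP d chi (a : int) : (d %| N)%N -> dirichlet_character C d chi ->
  char_lift d chi a != 0 ->
  exists2 b : int, a = b * (N %/ d)%N%:Z & coprimez b d%:Z.
Proof.
move=> dN [_ _ _ chiN0]; rewrite /char_lift; case: ifP => [/dvdzP[b ->]|_]; last by rewrite eqxx.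
rewrite mulzK; last by rewrite eqz_nat -lt0n divn_dvd_gt0.
by move=> chib; exists b => //; rewrite -chiN0.
Qed.

Lemma parity_char_lift o d chi : (d %| N)%N -> dirichlet_character C d chi ->
  chi (-1) = (-1) ^+ o -> parity_fun o N (char_lift d chi).
Proof.
move=> dN chiP chiN1; have [_ chiM chiD _] := chiP; have d0 := dvdn_gt0 N0 dN.
have e0 : (N %/ d)%N%:Z != 0 by rewrite eqz_nat -lt0n divn_dvd_gt0.
have NE : N%:Z = d%:Z * (N %/ d)%N%:Z by rewrite -PoszM mulnC divnK.
split => a; rewrite /char_lift.
  rewrite rpredDr; last by rewrite NE dvdz_mull.
  by case: ifP => // _; rewrite NE addrC divzMDl// addrC chiD.
rewrite rpredN; case: ifP => [/dvdzP[b ->]|_]; last by rewrite mulr0.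
by rewrite -mulNr !mulzK// (dirichlet_characterN _ chiP) chiN1.
Qed.

Lemma char_lift_eq d d' chi psi (a : int) : (d %| N)%N -> (d' %| N)%N ->
  dirichlet_character C d chi -> dirichlet_character C d' psi ->
  char_lift d chi a != 0 -> char_lift d' psi a != 0 -> d = d'.
Proof.
have H e c f : (e %| N)%N -> dirichlet_character C e c -> char_lift e c f != 0 ->
    gcdz f N%:Z = (N %/ e)%N%:Z.
  move=> eN eP /(char_liftP eN eP)[b -> cop].
  rewrite -{2}(divnK eN) mulnC PoszM -mulz_gcdl.
  by move: cop; rewrite /coprimez => /eqP ->; rewrite mul1r.
move=> dN d'N chiP psiP /(H _ _ _ dN chiP) E1 /(H _ _ _ d'N psiP); rewrite E1 => -[E].
apply/eqP; rewrite -(eqn_pmul2l (divn_dvd_gt0 dN)) divnK// E divnK//.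
Qed.

(** Multiplying [a] by [r] replaces gcd(a, N) = N/d' by a multiple of it, namely N/d. This is the
    origin of the triangular shape. *)
Lemma char_lift_dvd d d' chi psi (r a : int) : (d %| N)%N -> (d' %| N)%N ->
  dirichlet_character C d chi -> dirichlet_character C d' psi ->
  char_lift d' psi a != 0 -> char_lift d chi (r * a) != 0 -> (d %| d')%N.
Proof.
move=> dN d'N chiP psiP /(char_liftP d'N psiP)[b -> _].
move=> /(char_liftP dN chiP)[c E cop].
have : ((N %/ d')%N%:Z %| gcdz c d%:Z * `|(N %/ d)%N%:Z|%N)%Z.
  rewrite mulz_gcdl dvdz_gcd -E mulrA dvdz_mull//= -PoszM mulnC divnK//.
  by rewrite dvdzE/= dvdn_div.
move: cop; rewrite /coprimez => /eqP ->; rewrite mul1r dvdzE/= => /dvdnP[q Eq].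
apply/dvdnP; exists q; apply/eqP; rewrite -(eqn_pmul2r (divn_dvd_gt0 d'N)).
by rewrite mulnC divnK// mulnAC -Eq divnK.
Qed.

(** [psi] serves to put [a] among the multiples of N/d. Elsewhere the identity can fail, as [r * a]
    may be such a multiple without [a] being one; hence a triangular matrix rather than a diagonal
    one. *)
Lemma char_liftM d chi psi (r a : int) : (d %| N)%N ->
  dirichlet_character C d chi -> dirichlet_character C d psi ->
  char_lift d psi a != 0 ->
  char_lift d chi (r * a) = chi r * char_lift d chi a.
Proof.
move=> dN [_ chiM _ _] psiP /(char_liftP dN psiP)[b -> _].
by rewrite mulrA !char_lift_mull.
Qed.

Lemma sum_multiples (V : nmodType) (m e : nat) (F : nat -> V) : (0 < e)%N ->
  (forall a, ~~ (e %| a)%N -> F a = 0) ->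
  \sum_(0 <= a < m * e) F a = \sum_(0 <= b < m) F (b * e)%N.
Proof.
move=> e0 F0; elim: m => [|m IH]; first by rewrite mul0n !big_geq.
rewrite big_nat_recr//= -IH (big_cat_nat (n := (m * e)%N))//=; last by rewrite leq_mul2r leqnSn orbT.
congr (_ + _); rewrite mulSn -{1}[(m * e)%N]add0n big_addn addnK.
rewrite (@big_ltn _ _ _ 0)//= add0n big_nat_cond big1 ?addr0// => i /andP[/andP[i0 ie] _].
by rewrite F0// dvdn_addl ?dvdn_mull// gtnNdvd.
Qed.

Lemma sum_char_lift d chi psi : (d %| N)%N ->
  dirichlet_character C d chi -> dirichlet_character C d psi ->
  \sum_(0 <= a < N) (char_lift d psi a%:Z)^-1 * char_lift d chi a%:Z =
  (totient d)%:R *+ (psi == chi).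
Proof.
move=> dN chiP psiP; have d0 := dvdn_gt0 N0 dN.
rewrite -dirichlet_character_orth// -{1}(divnK dN) mulnC sum_multiples.
- by apply: eq_bigr => b _; rewrite PoszM !char_lift_mull.
- by rewrite divn_gt0// dvdn_leq.
- by move=> a ea; rewrite /char_lift dvdzE/= (negPf ea) mulr0.
Qed.

End Lift.

Section Interpolation.
Variables (C : numFieldType) (o : bool) (N : nat).
Hypothesis N0 : (0 < N)%N.

(** The projection of a point mass at [a] to parity [o]. Pairing with it returns f(a) for any [f] of
    that parity, which expresses values at arbitrary residues through the indices of the matrix. *)
Definition parity_delta (a b : int) : C :=
  ((a == b %[mod N])%Z%:R + (-1) ^+ o * (a == - b %[mod N])%Z%:R) / 2.

Lemma parity_deltaP a : parity_fun o N (parity_delta a).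
Proof.
have P (b : int) : ((b + N%:Z) %% N = b %% N)%Z by rewrite modzDr.
split=> b; rewrite /parity_delta.
  rewrite P opprD -[- N%:Z]mulN1r.
  by rewrite (periodicz (f := fun z => (z %% N)%Z) P).
rewrite opprK mulrA mulrDr mulrA -signr_addb addbb expr0 mul1r; congr (_ / _).
by rewrite addrC.
Qed.

Lemma sum_delta (f : int -> C) (a : int) : (forall n, f (n + N%:Z) = f n) ->
  \sum_(0 <= b < N) (a == b%:Z %[mod N])%Z%:R * f b%:Z = f a.
Proof.
move=> fN; have NZ : N%:Z != 0 by rewrite eqz_nat -lt0n.
rewrite -(periodic_modz fN a); have := modz_ge0 a NZ; have := ltz_pmod a (_ : 0 < N%:Z) => /(_ N0).
case: (a %% N)%Z => // r rN _.
rewrite big_mkord (bigD1 (Ordinal rN))//= big1 ?addr0 => [|b br].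
  by rewrite modz_nat modn_small// eqxx mul1r.
rewrite modz_nat modn_small// eqz_nat -[r]/(val (Ordinal rN)) eq_sym.
by rewrite val_eqE (negPf br) mul0r.
Qed.

Lemma sum_parity_delta (f : int -> C) (a : int) : parity_fun o N f ->
  \sum_(l < symdim o N) (orbit_size N (o + l))%:R *
    (parity_delta a (o + l)%N%:Z * f (o + l)%N%:Z) = f a.
Proof.
move=> fP; have [fN fE] := fP; rewrite -(sum_parity_fun N0 (parity_deltaP a) fP).
have E b : parity_delta a b * f b = ((a == b %[mod N])%Z%:R * f b +
   (-1) ^+ o * ((- a == b %[mod N])%Z%:R * f b)) / 2.
  have -> : (- a == b %[mod N])%Z = (a == - b %[mod N])%Z.
    by rewrite !eqz_mod_dvd opprK -[LHS]rpredN opprB opprK addrC.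
  rewrite /parity_delta; ring.
under eq_bigr do rewrite E.
rewrite -mulr_suml big_split/= -mulr_sumr !sum_delta// fE mulrA -signr_addb addbb.
by rewrite expr0 mul1r; field.
Qed.

Definition conv_mx (u : nat -> C) (m : nat) : 'M[C]_(symdim o N) :=
  \matrix_(i, l) \sum_(1 <= r < m) u r * ((orbit_size N (o + l))%:R *
    parity_delta (r%:Z * (o + i)%N%:Z) (o + l)%N%:Z).

Lemma conv_mx_mul (u : nat -> C) (m n : nat) (f : 'I_n -> int -> C) :
  (forall j, parity_fun o N (f j)) ->
  conv_mx u m *m (\matrix_(i, j) f j (o + i)%N%:Z) =
  \matrix_(i, j) \sum_(1 <= r < m) u r * f j (r%:Z * (o + i)%N%:Z).
Proof.
move=> fP; apply/matrixP => i j; rewrite !mxE.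
under eq_bigr do rewrite !mxE mulr_suml.
rewrite exchange_big/=; apply: eq_bigr => r _.
rewrite -(sum_parity_delta _ (fP j)) mulr_sumr; apply: eq_bigr => l _.
by rewrite !mulrA.
Qed.

End Interpolation.

Section Triangular.
Variables (C : numFieldType) (o : bool) (N : nat).
Hypothesis N0 : (0 < N)%N.

Definition is_char_pair (p : nat * (int -> C)) :=
  [/\ (p.1 %| N)%N, dirichlet_character C p.1 p.2 & p.2 (-1) = (-1) ^+ o].

Variable J : seq (nat * (int -> C)).
Hypothesis uniqJ : uniq J.
Hypothesis JP : forall p, p \in J -> is_char_pair p.

Let pr (q : 'I_(size J)) := nth (0%N, fun=> 0) J q.
Let fl (q : 'I_(size J)) := char_lift N (pr q).1 (pr q).2.
Let dl (q : 'I_(size J)) : C := (totient (pr q).1)%:R.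

Let prP q : is_char_pair (pr q). Proof. by apply: JP; rewrite mem_nth. Qed.

Let pr_inj p q : pr p = pr q -> p = q.
Proof. by move=> /eqP; rewrite nth_uniq// => /eqP /val_inj. Qed.

Let flP q : parity_fun o N (fl q).
Proof. by have [? ? ?] := prP q; exact: parity_char_lift. Qed.

Let dl0 q : dl q != 0.
Proof.
have [dN _ _] := prP q; rewrite pnatr_eq0 -lt0n totient_gt0.
exact: dvdn_gt0 dN.
Qed.

Let flVP q : parity_fun o N (fun a => (fl q a)^-1).
Proof.
by have [fN fE] := flP q; split=> n; rewrite ?fN// fE invfM invr_sign.
Qed.

Definition lift_mx : 'M[C]_(symdim o N, size J) :=
  \matrix_(i, q) fl q (o + i)%N%:Z.

(** Orthogonality of characters, written as a left inverse of [lift_mx]; the totient is the number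
    of nonzero values of a lifted character in one period. *)
Definition dual_lift_mx : 'M[C]_(size J, symdim o N) :=
  \matrix_(p, i) ((dl p)^-1 * ((orbit_size N (o + i))%:R * (fl p (o + i)%N%:Z)^-1)).

Lemma dual_lift_mxM (n : nat) (f : 'I_n -> int -> C) :
  (forall j, parity_fun o N (f j)) ->
  dual_lift_mx *m (\matrix_(i, j) f j (o + i)%N%:Z) =
  \matrix_(p, j) ((dl p)^-1 * \sum_(0 <= a < N) (fl p a%:Z)^-1 * f j a%:Z).
Proof.
move=> fP; apply/matrixP => p j; rewrite !mxE.
rewrite (sum_parity_fun N0 (flVP p) (fP j)) mulr_sumr; apply: eq_bigr => i _.
by rewrite !mxE !mulrA.
Qed.

Lemma dual_liftK : dual_lift_mx *m lift_mx = 1%:M.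
Proof.
rewrite dual_lift_mxM//; apply/matrixP => p q; rewrite !mxE.
have [dN chiP _] := prP q; have [dN' chiP' _] := prP p.
have [E|ne] := eqVneq (pr p).1 (pr q).1.
  rewrite /fl E in chiP' *; rewrite sum_char_lift//.
  have -> : ((pr p).2 == (pr q).2) = (p == q).
    apply/eqP/eqP => [E2|-> //]; apply: pr_inj.
    by rewrite [LHS]surjective_pairing [RHS]surjective_pairing E E2.
  by case: eqVneq => [->|_]; rewrite ?mulr0// mulVf.
rewrite (_ : (p == q) = false); last first.
  by apply/negP => /eqP pq; rewrite pq eqxx in ne.
rewrite big1 ?mulr0// => a _; apply/eqP; rewrite mulf_eq0 invr_eq0.
apply/negPn; rewrite negb_or; apply/negP => /andP[H1 H2].
by move/eqP: ne; apply; exact: (char_lift_eq N0 dN' dN chiP' chiP H1 H2).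
Qed.

(** One half of the count of characters, for a list [J] that is still arbitrary: a matrix with a
    left inverse has no more columns than rows. *)
Lemma size_char_pairs_le : (size J <= symdim o N)%N.
Proof. exact: mulmx1_min dual_liftK. Qed.

Lemma det_similar n m (P : 'M[C]_(n, m)) (Q : 'M[C]_(m, n)) (A : 'M[C]_n) :
  m = n -> Q *m P = 1%:M -> \det (Q *m (A *m P)) = \det A.
Proof.
move=> mn; case: n / mn P Q A => P Q A QP.
by rewrite !det_mulmx mulrCA -det_mulmx QP det1 mulr1.
Qed.

Lemma det_conv_mx (u : nat -> C) m : size J = symdim o N ->
  sorted (relpre fst leq) J ->
  \det (conv_mx o N u m) = \prod_(p <- J) \sum_(1 <= r < m) u r * p.2 r%:Z.
Proof.
move=> sJ srtJ; rewrite -(det_similar _ sJ dual_liftK) conv_mx_mul//.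
set g := fun (q : 'I_(size J)) (x : int) => \sum_(1 <= r < m) u r * fl q (r%:Z * x).
have gP q : parity_fun o N (g q).
  have [fN fE] := flP q; split=> n; rewrite /g; last first.
    by rewrite mulr_sumr; apply: eq_bigr => r _; rewrite mulrN fE mulrCA.
  by apply: eq_bigr => r _; rewrite mulrDr (periodicz fN).
rewrite -[X in \det (_ *m X)]/(\matrix_(i, q) g q (o + i)%N%:Z) dual_lift_mxM//.
have E (p q : 'I_(size J)) : (p <= q)%N ->
    (dl p)^-1 * \sum_(0 <= a < N) (fl p a%:Z)^-1 * g q a%:Z =
    (\sum_(1 <= r < m) u r * (pr q).2 r%:Z) *+ (p == q).
  move=> pq.
  have [dN chiP _] := prP q; have [dN' chiP' _] := prP p.
  have dpq : ((pr p).1 <= (pr q).1)%N.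
    have tr : transitive (relpre (@fst nat (int -> C)) leq) by move=> a b c; exact: leq_trans.
    have rf : reflexive (relpre (@fst nat (int -> C)) leq) by move=> a; exact: leqnn.
    by apply: (sorted_leq_nth tr rf _ srtJ) => //; rewrite inE.
  (* Where [fl p] is nonzero, [fl q] at r a is chi_q(r) times [fl q] at [a]: by multiplicativity if
     the moduli agree; otherwise d_p < d_q, and both values vanish because a nonzero one would give
     d_q | d_p. *)
  have H a : (fl p a)^-1 * g q a =
      (\sum_(1 <= r < m) u r * (pr q).2 r%:Z) * ((fl p a)^-1 * fl q a).
    have [->|fp0] := eqVneq (fl p a) 0; first by rewrite invr0 !mul0r mulr0.
    rewrite mulr_sumr mulr_suml; apply: eq_bigr => r _.
    suff -> : fl q (r%:Z * a) = (pr q).2 r%:Z * fl q a by ring.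
    have [Ed|ne] := eqVneq (pr p).1 (pr q).1.
      by rewrite /fl Ed in fp0 chiP' *; rewrite (char_liftM _ _ _ _ chiP').
    have Z z : fl q (z * a) = 0.
      apply/eqP/negPn/negP => fq0; move/negP: ne; apply.
      have := char_lift_dvd N0 dN dN' chiP chiP' fp0 fq0.
      move=> /(dvdn_leq (dvdn_gt0 N0 dN')) qp.
      by rewrite eqn_leq dpq.
    by rewrite Z -[a]mul1r Z mulr0.
  under eq_bigr do rewrite H.
  rewrite -mulr_sumr mulrCA; have := dual_liftK.
  rewrite dual_lift_mxM// => /matrixP/(_ p q); rewrite !mxE => ->.
  by rewrite mulr_natr.
rewrite det_trig; last first.
  by apply/is_trig_mxP => p q pq; rewrite mxE E ?(ltnW pq)// -val_eqE ltn_eqF.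
rewrite (big_nth (0%N, fun=> 0)) big_mkord; apply: eq_bigr => q _.
by rewrite mxE E// eqxx.
Qed.

End Triangular.

(** * The number of characters *)

(* MathComp's characters take values in algC: their values, roots of unity, are
   moved to the field C by matching primitive roots. *)
Section TransferRoots.
Variables (F C : fieldType) (e : nat) (z : F) (w : C).
Hypotheses (zP : e.-primitive_root z) (wP : e.-primitive_root w).

Definition transfer_root (x : F) : C :=
  w ^+ find (fun i => x == z ^+ i) (iota 0 e).

Lemma transfer_rootX i : transfer_root (z ^+ i) = w ^+ i.
Proof.
have e0 := prim_order_gt0 zP.
have h : has (fun j => z ^+ i == z ^+ j) (iota 0 e).
  apply/hasP; exists (i %% e)%N; first by rewrite mem_iota ltn_pmod.
  by rewrite (prim_expr_mod zP).
apply/eqP; rewrite /transfer_root (eq_prim_root_expr wP) -(eq_prim_root_expr zP).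
have := nth_find 0%N h; rewrite nth_iota; first by rewrite add0n eq_sym.
by move: h; rewrite has_find size_iota.
Qed.

Lemma transfer_rootM x y : x ^+ e = 1 -> y ^+ e = 1 ->
  transfer_root (x * y) = transfer_root x * transfer_root y.
Proof.
move=> /(prim_rootP zP)[i ->] /(prim_rootP zP)[j ->].
by rewrite -exprD !transfer_rootX exprD.
Qed.

Lemma transfer_root1 : transfer_root 1 = 1.
Proof. by rewrite -(expr0 z) transfer_rootX expr0. Qed.

Lemma transfer_root_inj x y : x ^+ e = 1 -> y ^+ e = 1 ->
  transfer_root x = transfer_root y -> x = y.
Proof.
move=> /(prim_rootP zP)[i ->] /(prim_rootP zP)[j ->].
rewrite !transfer_rootX => /eqP; rewrite (eq_prim_root_expr wP).
by rewrite -(eq_prim_root_expr zP) => /eqP.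
Qed.

Lemma transfer_root_neq0 x : transfer_root x != 0.
Proof.
rewrite expf_neq0//; apply/negP => /eqP w0; have := prim_expr_order wP.
by rewrite w0 expr0n eqn0Ngt (prim_order_gt0 wP) => /esym/eqP; rewrite oner_eq0.
Qed.

End TransferRoots.

Section CountCharacters.
Variable C : numFieldType.
Hypothesis prim_exists : forall n, (0 < n)%N -> exists z : C, n.-primitive_root z.

Section Units.
Variable d : nat.
Hypothesis d1 : (1 < d)%N.

Local Notation G := (units_Zp_group d).

Variables (z : algC) (w : C).
Hypotheses (zP : #|G|.-primitive_root z) (wP : #|G|.-primitive_root w).

Definition unit_char (i : Iirr G) (n : int) : C :=
  if insub (n%:~R : 'Z_d) is Some u then
    transfer_root #|G| z w ('chi_i (u : {unit 'Z_d})) else 0.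

Lemma unit_char_root (i : Iirr G) (u : {unit 'Z_d}) : 'chi_i u ^+ #|G| = 1.
Proof.
have uG : u \in G by rewrite inE.
have lin : 'chi_i \is a linear_char by apply: (char_abelianP _ (units_Zp_abelian d)).
have /dvdnP[q ->] := order_dvdG uG.
by rewrite mulnC exprM lin_char_unity_root// expr1n.
Qed.

Lemma intr_unitZ (n : int) : ((n%:~R : 'Z_d) \is a GRing.unit) = coprimez n d%:Z.
Proof.
have d0 : d%:Z != 0 by rewrite eqz_nat -lt0n ltnW.
have dZ : (d%:R : 'Z_d) = 0 := pchar_Zp d1.
have H : (n%:~R : 'Z_d) = ((n %% d%:Z)%Z)%:~R.
  by rewrite {1}(divz_eq n d%:Z) intrD intrM -[d%:Z%:~R]/(d%:R : 'Z_d) dZ mulr0 add0r.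
have H2 : coprimez n d%:Z = coprimez (n %% d%:Z)%Z d%:Z.
  by rewrite /coprimez gcdz_modl.
rewrite H H2; have := modz_ge0 n d0; case: (n %% _)%Z => // r _.
by rewrite -pmulrn unitZpE// coprimezE/= coprime_sym.
Qed.

Lemma unit_charP (i : Iirr G) : dirichlet_character C d (unit_char i).
Proof.
have lin : 'chi_i \is a linear_char by apply: (char_abelianP _ (units_Zp_abelian d)).
have dZ : (d%:R : 'Z_d) = 0 := pchar_Zp d1.
split.
- rewrite /unit_char; case: insubP => [u _ u1|]; last by rewrite unitr1.
  have -> : u = 1%g by apply: val_inj; rewrite u1.
  by rewrite lin_char1// transfer_root1.
- move=> m n; rewrite /unit_char.
  case: insubP => [umn mnU mnE|mnU]; case: insubP => [um mU mE|mU];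
    case: insubP => [un nU nE|nU]; rewrite ?mul0r ?mulr0//.
  + rewrite -transfer_rootM ?unit_char_root// -lin_charM ?inE//.
    by congr (transfer_root _ _ _ ('chi_i _)); apply: val_inj; rewrite /= mnE mE nE intrM.
  + by move: mnU; rewrite intrM unitrM (negPf nU) andbF.
  + by move: mnU; rewrite intrM unitrM (negPf mU).
  + by move: mnU; rewrite intrM unitrM (negPf mU).
  + by move: mnU; rewrite intrM unitrM mU nU.
- by move=> n; rewrite /unit_char intrD -[d%:Z%:~R]/(d%:R : 'Z_d) dZ addr0.
- move=> n; rewrite -intr_unitZ /unit_char; case: insubP => [u -> _|/negPf ->].
    by rewrite transfer_root_neq0.
  by rewrite eqxx.
Qed.

Lemma unit_char_inj : injective unit_char.
Proof.
move=> i j E; apply: irr_inj; apply/cfunP => u.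
apply: (transfer_root_inj zP wP); rewrite ?unit_char_root//.
have := congr1 (@^~ (val u : nat)%:Z) E; rewrite /unit_char.
have -> : ((val u : nat)%:Z%:~R : 'Z_d) = val u.
  by rewrite -pmulrn; move: (val u) => x; apply: natr_Zp.
by rewrite valK.
Qed.

End Units.

(** The other half of the count: an abelian group has as many irreducible characters as elements,
    and these transfer injectively. *)
Lemma card_dirichlet_character d : (0 < d)%N ->
  (totient d <= #|` fset_set (dirichlet_character C d)|)%N.
Proof.
move=> d0; have fin := @finite_dirichlet_character C d d0.
(* ['Z_d] models Z/d only for d > 1, so modulus 1 is treated by hand. *)
have [d1|d1] := ltnP 1 d; last first.
  have -> : d = 1%N by lia.
  rewrite (_ : totient 1 = 1%N)// lt0n cardfs_eq0; apply/negP => /eqP E.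
  have : (fun=> 1) \in fset_set (dirichlet_character C 1).
    rewrite in_fset_set; last exact: finite_dirichlet_character.
    by apply/mem_set; exact: (proj2 (dirichlet_character1 _)).
  by rewrite E in_fset0.
have [z zP] := C_prim_root_exists (cardG_gt0 (units_Zp_group d)).
have [w wP] := prim_exists (cardG_gt0 (units_Zp_group d)).
have -> : totient d = #|Iirr (units_Zp_group d)|.
  by rewrite card_Iirr_abelian ?units_Zp_abelian// card_units_Zp.
rewrite cardE -(size_map (@unit_char d z w)); apply: uniq_leq_size.
  by rewrite map_inj_uniq ?enum_uniq//; exact: unit_char_inj.
move=> chi /mapP[i _ ->]; by rewrite in_fset_set//; apply/mem_set; exact: unit_charP.
Qed.

Definition sym_characters (o : bool) (d : nat) : set (int -> C) :=
  if o then odd_characters C d else even_characters C d.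

Lemma sym_charactersP o d chi : sym_characters o d chi <->
  dirichlet_character C d chi /\ chi (-1) = (-1) ^+ o.
Proof. by case: o; rewrite /sym_characters/= ?expr1 ?expr0. Qed.

Lemma finite_sym_characters o d : (0 < d)%N -> finite_set (sym_characters o d).
Proof.
move=> d0; apply: sub_finite_set (@finite_dirichlet_character C d d0).
by move=> chi /sym_charactersP[].
Qed.

Lemma card_sym_characters d : (0 < d)%N ->
  (totient d <= #|` fset_set (sym_characters true d)| +
                #|` fset_set (sym_characters false d)|)%N.
Proof.
move=> d0; apply: (leq_trans (card_dirichlet_character d0)).
apply: leq_trans (leq_card_fsetU _ _); rewrite -fset_setU; try exact: finite_sym_characters.
apply: fsubset_leq_card; rewrite -fset_set_sub.
- move=> chi chiP; have [chi1 chiM _ _] := chiP.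
  have : chi (-1) ^+ 2 == 1 by rewrite expr2 -chiM mulrNN mulr1 chi1.
  rewrite sqrf_eq1 => /orP[]/eqP E; [right|left]; apply/sym_charactersP; split=> //.
- exact: finite_dirichlet_character.
- by rewrite finite_setU; split; exact: finite_sym_characters.
Qed.

(** Sorting by modulus is what makes the convolution matrix triangular in this basis. *)
Definition char_pairs (o : bool) (N : nat) : seq (nat * (int -> C)) :=
  sort (relpre fst leq)
    [seq (d, chi) | d <- divisors N, chi <- (fset_set (sym_characters o d) : seq _)].

Section CharPairs.
Variables (N : nat).
Hypothesis N0 : (0 < N)%N.

Lemma divisors_gt0 d : d \in divisors N -> (0 < d)%N.
Proof. by rewrite -dvdn_divisors// => /(dvdn_gt0 N0). Qed.

Lemma char_pairs_uniq o : uniq (char_pairs o N).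
Proof.
rewrite sort_uniq; apply: allpairs_uniq_dep; first exact: divisors_uniq.
  by move=> d _; exact: fset_uniq.
by move=> [a b] [a' b'] _ _ /= [-> ->].
Qed.

Lemma char_pairsP o p : p \in char_pairs o N -> is_char_pair o N p.
Proof.
rewrite mem_sort => /allpairsPdep[d [chi [dN chiP ->]]].
have d0 := divisors_gt0 dN.
move: chiP; rewrite in_fset_set; last exact: finite_sym_characters.
move=> /set_mem /sym_charactersP[chiP chi1]; split=> //=.
by rewrite dvdn_divisors.
Qed.

Lemma sum_totient_divisors : (\sum_(d <- divisors N) totient d = N)%N.
Proof.
rewrite -[RHS]sum_totient_dvd -(big_mkord (fun d => d %| N)%N totient) -[RHS]big_filter.
apply: perm_big; apply: uniq_perm.
- exact: divisors_uniq.
- by rewrite filter_uniq// iota_uniq.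
- move=> d; rewrite mem_filter mem_index_iota -dvdn_divisors//=.
  by case dN: (d %| N)%N => //=; rewrite ltnS dvdn_leq.
Qed.

(** Each parity obeys its upper bound, while both the totients of the divisors and the two
    dimensions add up to [N]; so both bounds are equalities. The even and odd characters of a single
    modulus need not be counted separately. *)
Lemma size_char_pairs o : size (char_pairs o N) = symdim o N.
Proof.
have le o' : (size (char_pairs o' N) <= symdim o' N)%N.
  by apply: size_char_pairs_le => //; [exact: char_pairs_uniq|exact: char_pairsP].
have : (symdim true N + symdim false N <= size (char_pairs true N) + size (char_pairs false N))%N.
  rewrite /symdim addnS addnC Nplus_Nminus// -{1}sum_totient_divisors !size_sort.
  rewrite !size_allpairs_dep !sumnE !big_map -big_split/= big_seq_cond [leqRHS]big_seq_cond.
  apply: leq_sum => d /andP[dN _]; exact: card_sym_characters (divisors_gt0 dN).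
by have := le true; have := le false; case: o; lia.
Qed.

Lemma det_conv_mx_char o (u : nat -> C) m :
  \det (conv_mx o N u m) = \prod_(d <- divisors N)
    \big[*%R/1]_(chi \in sym_characters o d) \sum_(1 <= r < m) u r * chi r%:Z.
Proof.
rewrite (det_conv_mx N0 (@char_pairs_uniq o) (@char_pairsP o)) ?size_char_pairs//; last first.
  by apply: sort_sorted => p q; exact: leq_total.
rewrite (perm_big _ (permEl (perm_sort _ _)))/= big_allpairs_dep/=.
rewrite big_seq_cond [RHS]big_seq_cond; apply: eq_bigr => d /andP[dN _].
by rewrite fsbig_finite//=; exact: finite_sym_characters (divisors_gt0 dN).
Qed.

End CharPairs.

End CountCharacters.

(** * The determinant formula *)

Definition ccvg (K : numFieldType) (u : nat -> K) (l : K) : Prop :=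
  (u : nat -> K^o) @ \oo --> (l : K^o).

Section Ccvg.
Variable K : numFieldType.
Implicit Types (u v : nat -> K) (l m : K).

Lemma ccvg_cst l : ccvg (fun=> l) l.
Proof. exact: cvg_cst. Qed.

Lemma ccvgM u v l m : ccvg u l -> ccvg v m -> ccvg (fun n => u n * v n) (l * m).
Proof. by move=> ul vm; exact: (cvgM ul vm). Qed.

Lemma ccvgD u v l m : ccvg u l -> ccvg v m -> ccvg (fun n => u n + v n) (l + m).
Proof. by move=> ul vm; exact: (@cvgD K K^o _ _ _ u v l m ul vm). Qed.

Lemma ccvg_sum (I : Type) (s : seq I) (F : I -> nat -> K) (l : I -> K) :
  (forall i, ccvg (F i) (l i)) ->
  ccvg (fun n => \sum_(i <- s) F i n) (\sum_(i <- s) l i).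
Proof.
move=> Fl; elim: s => [|i s IH].
  by rewrite big_nil; under eq_fun do rewrite big_nil; exact: ccvg_cst.
by rewrite big_cons; under eq_fun do rewrite big_cons; exact: ccvgD.
Qed.

Lemma ccvg_prod (I : eqType) (s : seq I) (F : I -> nat -> K) (l : I -> K) :
  (forall i, i \in s -> ccvg (F i) (l i)) ->
  ccvg (fun n => \prod_(i <- s) F i n) (\prod_(i <- s) l i).
Proof.
elim: s => [|i s IH] Fl.
  by rewrite big_nil; under eq_fun do rewrite big_nil; exact: ccvg_cst.
rewrite big_cons; under eq_fun do rewrite big_cons.
apply: ccvgM; first by apply: Fl; rewrite mem_head.
by apply: IH => j js; apply: Fl; rewrite in_cons js orbT.
Qed.

Lemma ccvg_det n (A : nat -> 'M[K]_n) (B : 'M[K]_n) :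
  (forall i j, ccvg (fun t : nat => A t i j) (B i j)) ->
  ccvg (fun t : nat => \det (A t)) (\det B).
Proof.
move=> AB; rewrite /determinant; apply: ccvg_sum => s.
apply: ccvgM; first exact: ccvg_cst.
by apply: ccvg_prod => i _; exact: AB.
Qed.

Lemma ccvg_unique u l m : ccvg u l -> ccvg u m -> l = m.
Proof. by move=> ul um; apply: (cvg_unique (@norm_hausdorff K K^o) ul um). Qed.

End Ccvg.

Section RealComplex.
Variable R : realType.
Local Notation C := R[i].

Lemma ccvg_real (u : nat -> R) (l : R) : u @ \oo --> l ->
  ccvg (fun n => (u n)%:C : C) l%:C.
Proof.
move=> ul; apply/cvgrPdist_lt => e e0.
have eE : e = (complex.Re e)%:C by rewrite RRe_real// gtr0_real.
have e0' : 0 < complex.Re e by rewrite eE ltcR in e0.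
move/cvgrPdist_lt : ul => /(_ _ e0'); apply: filterS => n.
by rewrite -rmorphB/= normc_def/= expr0n/= addr0 sqrtr_sqr eE ltcR.
Qed.

Lemma complex_prim_root n : (0 < n)%N -> exists z : C, n.-primitive_root z.
Proof.
move=> n0; pose t : R := 2 * pi / n%:R.
exists (cos t +i* sin t)%C.
have wX k : (cos t +i* sin t)%C ^+ k = (cos (k%:R * t) +i* sin (k%:R * t))%C :> C.
  elim: k => [|k IH]; first by rewrite expr0 mul0r cos0 sin0.
  rewrite exprS IH -[k.+1%:R]natr1 mulrDl mul1r cosD sinD.
  by apply/eqP; rewrite eq_complex/=; apply/andP; split; apply/eqP; ring.
apply/andP; split=> //; apply/forallP => i; apply/eqP.
have nR : n%:R != 0 :> R by rewrite pnatr_eq0 -lt0n.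
rewrite unity_rootE wX; case: (eqVneq i.+1 n) => [->|ni].
  have -> : n%:R * t = 0 + pi *+ 2.
    by rewrite /t add0r -mulr_natl; move: (pi : R) => p; field.
  by rewrite cosD2pi sinD2pi cos0 sin0 eqxx.
apply/negP; rewrite eq_complex/= => /andP[/eqP c1 _].
have iN : (i.+1 < n)%N by rewrite ltn_neqAle ni ltn_ord.
(* cos (2 y) = 1 would force sin y = 0, impossible for a half angle strictly between 0 and pi. *)
pose y := pi * i.+1%:R / n%:R : R.
have sy : 0 < sin y.
  apply: sin_gt0_pi; rewrite /y divr_gt0 ?mulr_gt0 ?pi_gt0 ?ltr0n//=.
  by rewrite ltr_pdivrMr ?ltr0n// ltr_pM2l ?pi_gt0// ltr_nat.
have yE : i.+1%:R * t = y *+ 2 by rewrite /t /y -mulr_natl; ring.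
move: c1; rewrite yE cos_mulr2n cos2sin2 => H.
have : sin y ^+ 2 = 0 by move: H; rewrite -mulr_natl; lra.
by move/eqP; rewrite sqrf_eq0 gt_eqF.
Qed.

Section Formula.
Variables (k N : nat).
Hypotheses (k0 : (0 < k)%N) (N0 : (0 < N)%N).
Let o := odd k.
Let n := symdim o N.

Definition partial_L (chi : int -> C) (m : nat) : C :=
  \sum_(1 <= r < m) chi r%:Z / r%:R ^+ k.

Definition partial_trig (x : R) (m : nat) : R :=
  \sum_(1 <= r < m) trig o (2 * pi * r%:R * x) / r%:R ^+ k.

Lemma fourier_coef_neq0 : fourier_coef R k != 0.
Proof.
have pi0 : pi != 0 :> R by rewrite gt_eqF// pi_gt0.
rewrite /fourier_coef mulf_neq0 ?invr_eq0 ?expf_neq0 ?mulf_neq0 ?signr_eq0//.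
Qed.

Lemma partial_trig_cvg (x : R) :
  partial_trig x @ \oo --> periodic_bernoulli k x / (2 * fourier_coef R k).
Proof.
have c0 : 2 * fourier_coef R k != 0 by rewrite mulf_neq0// fourier_coef_neq0.
have -> : partial_trig x = fun m =>
    (2 * fourier_coef R k * partial_trig x m) / (2 * fourier_coef R k).
  by apply/funext => m; rewrite mulrC mulKf.
by apply: cvgMr_tmp; exact: periodic_bernoulli_cvg.
Qed.

Let tf (j : 'I_n) (x : int) : C :=
  (trig o (2 * pi * (x%:~R * (o + j)%:R / N%:R)))%:C.

Let tfP j : parity_fun o N (tf j).
Proof.
have [fN fE] := trig_parity_fun R o (o + j) N0.
by split=> x; rewrite /tf ?fN// fE rmorphM rmorph_sign.
Qed.

Let map_trig_mx : map_mx (real_complex R) (trig_mx R o N) =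
  \matrix_(i, j) tf j (o + i)%N%:Z.
Proof.
by apply/matrixP => i j; rewrite !mxE /tf -pmulrn mulrA.
Qed.

Lemma det_trig_mx_neq0 : \det (trig_mx R o N) != 0.
Proof.
have := det_trig_mx_sign R o N0; apply: contraTneq => ->.
by rewrite mulr0 ltxx.
Qed.

(** The columns of an invertible trigonometric matrix span all vectors on the index range, and
    agreement there extends to all integers by parity and periodicity. *)
Lemma parity_fun_trig (f : int -> C) : parity_fun o N f ->
  exists y : 'I_n -> C, forall x, f x = \sum_(j < n) y j * tf j x.
Proof.
move=> fP; pose A := map_mx (real_complex R) (trig_mx R o N).
have Au : A \in unitmx.
  by rewrite unitmxE unitfE det_map_mx fmorph_eq0 det_trig_mx_neq0.
pose c : 'cV[C]_n := \col_i f (o + i)%N%:Z.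
pose y := invmx A *m c.
exists (fun j => y j 0) => x.
pose g (x : int) := \sum_(j < n) y j 0 * tf j x.
have gP : parity_fun o N g.
  split=> z; rewrite /g; first by apply: eq_bigr => j _; rewrite (tfP j).1.
  by rewrite mulr_sumr; apply: eq_bigr => j _; rewrite (tfP j).2 mulrCA.
rewrite -(sum_parity_delta N0 x fP) -[RHS](sum_parity_delta N0 x gP).
apply: eq_bigr => l _; congr (_ * (_ * _)).
have /matrixP/(_ l 0) : A *m y = c by rewrite mulKVmx.
rewrite !mxE => <-; apply: eq_bigr => j _.
by rewrite mulrC /A map_trig_mx !mxE.
Qed.

Lemma char_pair_parity d (chi : int -> C) : is_char_pair o N (d, chi) -> parity_fun o N chi.
Proof.
move=> [/= /dvdnP[q ->] chiP chi1]; have [_ _ chiD _] := chiP; split=> x.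
  by rewrite PoszM (periodicz chiD).
by rewrite (dirichlet_characterN _ chiP) chi1.
Qed.

(** A finite combination of Fourier series of periodic Bernoulli functions; this includes the
    conditional convergence at [k = 1]. *)
Lemma partial_L_cvg d (chi : int -> C) : is_char_pair o N (d, chi) ->
  ccvg (partial_L chi) (dirichlet_L k chi).
Proof.
move=> /char_pair_parity/parity_fun_trig[y yE].
pose l := \sum_(j < n) y j *
  (periodic_bernoulli k ((o + j)%:R / N%:R) / (2 * fourier_coef R k))%:C.
have cv : ccvg (partial_L chi) l.
  have -> : partial_L chi = fun m => \sum_(j < n) y j * (partial_trig ((o + j)%:R / N%:R) m)%:C.
    apply/funext => m; rewrite /partial_L.
    under eq_bigr do rewrite yE mulr_suml.
    rewrite exchange_big/=; apply: eq_bigr => j _.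
    rewrite /partial_trig rmorph_sum mulr_sumr; apply: eq_bigr => r _.
    rewrite -mulrA rmorphM fmorphV rmorphXn rmorph_nat; congr (_ * (_%:C * _)).
    by rewrite -pmulrn -!mulrA.
  apply: ccvg_sum => j; apply: ccvgM; first exact: ccvg_cst.
  by apply: ccvg_real; exact: partial_trig_cvg.
suff -> : dirichlet_L k chi = l by [].
rewrite /dirichlet_L; apply: (@cvg_lim C^o); first exact: norm_hausdorff.
exact: cv.
Qed.

Let Bm (m : nat) : 'M[R]_n := \matrix_(i, j)
  (2 * fourier_coef R k * partial_trig (((o + i) * (o + j))%N%:R / N%:R) m).

Lemma bernoulli_mx_limit : ccvg (fun m => \det (map_mx (real_complex R) (Bm m)))
  (\det (bernoulli_mx R k N))%:C.
Proof.
rewrite -det_map_mx; apply: ccvg_det => i j; rewrite !mxE.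
under eq_fun do rewrite !mxE.
by apply: ccvg_real; exact: periodic_bernoulli_cvg.
Qed.

(** Exact for every truncation [m]: the sum over [r] sits in the convolution matrix alone, and the
    trigonometric matrix is independent of [m]. *)
Lemma det_Bm m : \det (map_mx (real_complex R) (Bm m)) =
  (2 * fourier_coef R k)%:C ^+ n * (\det (trig_mx R o N))%:C *
  \prod_(p <- char_pairs C o N) partial_L p.2 m.
Proof.
have -> : map_mx (real_complex R) (Bm m) = (2 * fourier_coef R k)%:C *:
   (conv_mx o N (fun r => (r%:R ^+ k)^-1) m *m map_mx (real_complex R) (trig_mx R o N)).
  rewrite map_trig_mx conv_mx_mul//; apply/matrixP => i j; rewrite !mxE rmorphM; congr (_ * _).
  rewrite /partial_trig rmorph_sum; apply: eq_bigr => r _.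
  rewrite [RHS]mulrC rmorphM fmorphV rmorphXn rmorph_nat; congr (_%:C * _); congr trig.
  by rewrite intrM -!pmulrn natrM !mulrA.
rewrite detZ det_mulmx det_map_mx (det_conv_mx_char complex_prim_root N0).
rewrite -mulrA; congr (_ * _); rewrite mulrC; congr (_ * _).
rewrite (perm_big _ (permEl (perm_sort _ _)))/= big_allpairs_dep/=.
rewrite big_seq_cond [RHS]big_seq_cond; apply: eq_bigr => d /andP[dN _].
rewrite fsbig_finite/=; last exact: finite_sym_characters (divisors_gt0 N0 dN).
by apply: eq_bigr => chi _; apply: eq_bigr => r _; rewrite mulrC.
Qed.

Lemma det_bernoulli_mx_pairs : (\det (bernoulli_mx R k N))%:C =
  (2 ^+ n * \det (trig_mx R o N))%:C *
  \prod_(p <- char_pairs C o N) ((fourier_coef R k)%:C * dirichlet_L k p.2).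
Proof.
apply: (ccvg_unique bernoulli_mx_limit).
under eq_fun do rewrite det_Bm.
rewrite big_split/= big_const_seq count_predT iter_mulr_1.
rewrite (size_char_pairs complex_prim_root N0) -/n mulrA.
have -> : (2 ^+ n * \det (trig_mx R o N))%:C * (fourier_coef R k)%:C ^+ n =
    (2 * fourier_coef R k)%:C ^+ n * (\det (trig_mx R o N))%:C.
  have cM (x y : R) : (x * y)%:C = x%:C * y%:C :> C by rewrite rmorphM.
  by rewrite (cM (2 ^+ n)) (cM 2) rmorphXn exprMn mulrAC.
apply: ccvgM; first exact: ccvg_cst.
apply: ccvg_prod => -[d chi] /(char_pairsP N0); exact: partial_L_cvg.
Qed.

Lemma det_bernoulli_mx : (\det (bernoulli_mx R k N))%:C =
  (2 ^+ n * \det (trig_mx R o N))%:C *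
  \prod_(d <- divisors N) \big[*%R/1]_(chi \in sym_characters o d)
     ((fourier_coef R k)%:C * dirichlet_L k chi).
Proof.
rewrite det_bernoulli_mx_pairs; congr (_ * _).
rewrite (perm_big _ (permEl (perm_sort _ _)))/= big_allpairs_dep/=.
rewrite big_seq_cond [RHS]big_seq_cond; apply: eq_bigr => d /andP[dN _].
by rewrite fsbig_finite//=; exact: finite_sym_characters (divisors_gt0 N0 dN).
Qed.

Lemma det_bernoulli_mx_neq0 :
  (forall d (chi : int -> C), is_char_pair o N (d, chi) -> dirichlet_L k chi != 0) ->
  \det (bernoulli_mx R k N) != 0.
Proof.
move=> L0; suff : (\det (bernoulli_mx R k N))%:C != 0 :> C by rewrite fmorph_eq0.
rewrite det_bernoulli_mx_pairs.
rewrite mulf_neq0// ?fmorph_eq0.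
  by rewrite mulf_neq0 ?expf_neq0// det_trig_mx_neq0.
rewrite prodf_seq_neq0; apply/allP => -[d chi] /(char_pairsP N0) P /=.
by rewrite mulf_neq0 ?fmorph_eq0 ?fourier_coef_neq0//; exact: L0 P.
Qed.

End Formula.

(** The orbits with two elements are those of 1, ..., N^-, and both index ranges contain all of
    these. *)
Lemma prod_orbit_size o N : (0 < N)%N ->
  \prod_(i < symdim o N) (orbit_size N (o + i))%:R = 2 ^+ Nminus N :> R.
Proof.
move=> N0; have PM := Nplus_cases N0.
have -> : Nminus N = (\sum_(i < symdim o N) (0 < o + i <= Nminus N))%N.
  rewrite /symdim; case: o.
    rewrite (eq_bigr (fun=> 1%N)) ?sum_nat_const ?card_ord ?muln1// => i _.
    by rewrite add1n ltn_ord.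
  rewrite -(big_mkord xpredT (fun i => nat_of_bool (0 < false + i <= Nminus N)%N)).
  rewrite (big_cat_nat (n := (Nminus N).+1))//=; last by case: PM => ->.
  rewrite [X in (_ + X)%N]big1_seq ?addn0; last first.
    by move=> i /andP[_]; rewrite mem_index_iota add0n => /andP[Hi _]; rewrite (leqNgt i) Hi andbF.
  rewrite big_nat_recl//= add0n [LHS](_ : _ = \sum_(0 <= i < Nminus N) 1)%N; last first.
    by rewrite sum_nat_const_nat subn0 muln1.
  by apply: eq_big_nat => i /andP[_ iN]; rewrite add0n /= iN.
rewrite expr_sum; apply: eq_bigr => i _.
by rewrite /orbit_size; case: (0 < _ <= _)%N; rewrite ?expr1 ?expr0.
Qed.

Lemma powR_half (x : R) n : 0 <= x -> x `^ (n%:R / 2) = Num.sqrt x ^+ n.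
Proof.
by move=> x0; rewrite mulrC powRrM powR12_sqrt// powR_mulrn// sqrtr_ge0.
Qed.

End RealComplex.

(** * The functions of Moebius and von Mangoldt *)

Section Divisors.

Lemma perm_divisors_pfactor p a m : prime p -> ~~ (p %| m)%N -> (0 < m)%N ->
  perm_eq (divisors (p ^ a * m)) [seq (p ^ j * d)%N | j <- iota 0 a.+1, d <- divisors m].
Proof.
move=> pp pm m0; have p0 := prime_gt0 pp.
have n0 : (0 < p ^ a * m)%N by rewrite muln_gt0 expn_gt0 p0.
have lg j d : d \in divisors m -> logn p (p ^ j * d) = j.
  rewrite -dvdn_divisors// => dm; have d0 := dvdn_gt0 m0 dm.
  rewrite lognM ?expn_gt0 ?p0// pfactorK// (lognE p d).
  by rewrite (negPf (contra (fun H => dvdn_trans H dm) pm)) !andbF addn0.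
apply: uniq_perm; first exact: divisors_uniq.
  apply: allpairs_uniq; rewrite ?iota_uniq ?divisors_uniq//.
  move=> x y /allpairsPdep[j [d [_ dm ->]]] /allpairsPdep[j' [d' [_ dm' ->]]] /= E.
  have jj := congr1 (logn p) E; rewrite !lg// in jj; rewrite jj in E *.
  by congr pair; apply/eqP; rewrite -(eqn_pmul2l (m := (p ^ j')%N)) ?expn_gt0 ?p0//; apply/eqP; exact: E.
move=> d; rewrite -dvdn_divisors//; apply/idP/allpairsPdep => [dn|[j [e [ja em ->]]]].
  have d0 := dvdn_gt0 n0 dn; have [e pe dE] := pfactor_coprime pp d0.
  exists (logn p d), e; rewrite mulnC; split=> //.
    rewrite mem_iota/= add0n ltnS.
    have := dvdn_leq_log p n0 dn; rewrite lg// -dvdn_divisors//.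
  rewrite -dvdn_divisors//.
  have : (e %| p ^ a * m)%N by apply: dvdn_trans dn; rewrite dE dvdn_mulr.
  by rewrite Gauss_dvdr// coprime_sym coprimeXl.
rewrite mem_iota/= add0n ltnS in ja; rewrite -dvdn_divisors// in em.
by rewrite dvdn_mul// dvdn_exp2l.
Qed.

Lemma sum_divisors_pfactor (V : nmodType) p a m (f : nat -> V) :
  prime p -> ~~ (p %| m)%N -> (0 < m)%N ->
  \sum_(d <- divisors (p ^ a * m)) f d =
  \sum_(j < a.+1) \sum_(d <- divisors m) f (p ^ j * d)%N.
Proof.
move=> pp pm m0; rewrite (perm_big _ (perm_divisors_pfactor a pp pm m0)) big_allpairs_dep.
by rewrite -[iota 0 a.+1]/(index_iota 0 a.+1) big_mkord.
Qed.

Lemma pfactor_ind (P : nat -> Prop) : P 1%N ->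
  (forall p a m, prime p -> ~~ (p %| m)%N -> (0 < m)%N -> P m -> P (p ^ a.+1 * m)%N) ->
  forall n, (0 < n)%N -> P n.
Proof.
move=> P1 IH n; elim/ltn_ind: n => n IHn n0.
have [n1|n1] := leqP n 1; first by have -> : n = 1%N by lia.
have pp := pdiv_prime n1; have [m pm nE] := pfactor_coprime pp n0.
have lg : (0 < logn (pdiv n) n)%N by rewrite logn_gt0 mem_primes pp n0 pdiv_dvd.
have m0 : (0 < m)%N by move: n0; rewrite nE muln_gt0 => /andP[].
rewrite nE mulnC -(prednK lg); apply: IH => //.
  by rewrite -prime_coprime.
apply: IHn => //; rewrite [in X in (_ < X)%N]nE -[X in (X < _)%N]muln1 ltn_pmul2l//.
by rewrite -(exp1n (logn (pdiv n) n)) ltn_exp2r// prime_gt1.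
Qed.

Lemma divisors1 : divisors 1 = [:: 1%N]. Proof. by []. Qed.

Lemma sum_divisors_nat (V : nmodType) (m n : nat) (f : nat -> V) :
  (0 < m <= n)%N ->
  \sum_(d <- divisors m) f d = \sum_(1 <= d < n.+1 | (d %| m)%N) f d.
Proof.
move=> /andP[m0 mn]; rewrite -[RHS]big_filter; apply: perm_big; apply: uniq_perm.
- exact: divisors_uniq.
- by rewrite filter_uniq// iota_uniq.
- move=> d; rewrite mem_filter mem_index_iota -dvdn_divisors//.
  case dm: (d %| m)%N => //=; rewrite ltnS (dvdn_gt0 m0 dm)/=.
  by rewrite (leq_trans (dvdn_leq m0 dm)).
Qed.

Lemma sum_dvd_nat (V : nmodType) (d n : nat) (f : nat -> V) : (0 < d)%N ->
  \sum_(1 <= m < n.+1 | (d %| m)%N) f m = \sum_(1 <= k < (n %/ d).+1) f (k * d)%N.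
Proof.
move=> d0; elim: n => [|n IH]; first by rewrite div0n !big_geq.
rewrite big_mkcond big_nat_recr//= -big_mkcond IH divnS//.
case: ifP => dn; last by rewrite addr0.
rewrite add1n [RHS]big_nat_recr//=; congr (_ + f _).
by have := divnS n d0; rewrite dn add1n => <-; rewrite divnK.
Qed.

Lemma sum_hyperbola (V : nmodType) (n : nat) (f : nat -> nat -> V) :
  \sum_(1 <= d < n.+1) \sum_(1 <= k < (n %/ d).+1) f d k =
  \sum_(1 <= m < n.+1) \sum_(d <- divisors m) f d (m %/ d)%N.
Proof.
have -> : \sum_(1 <= m < n.+1) \sum_(d <- divisors m) f d (m %/ d)%N =
    \sum_(1 <= m < n.+1) \sum_(1 <= d < n.+1 | (d %| m)%N) f d (m %/ d)%N.
  by apply: eq_big_nat => m mn; apply: sum_divisors_nat.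
rewrite [RHS](exchange_big_dep_nat xpredT)//=; apply: eq_big_nat => d /andP[d0 _].
by rewrite sum_dvd_nat//; apply: eq_bigr => k _; rewrite mulnK.
Qed.

End Divisors.

Section ArithmeticFunctions.
Variable R : realType.

Definition moebius (n : nat) : R :=
  \prod_(p <- primes n) (if logn p n == 1%N then -1 else 0).

Definition mangoldt (n : nat) : R :=
  if size (primes n) == 1%N then ln (pdiv n)%:R else 0.

Lemma perm_primes_pfactor p j d : prime p -> ~~ (p %| d)%N -> (0 < d)%N -> (0 < j)%N ->
  perm_eq (primes (p ^ j * d)) (p :: primes d).
Proof.
move=> pp pd d0 j0; apply: uniq_perm; rewrite ?primes_uniq//=.
  by rewrite mem_primes (negPf pd) !andbF primes_uniq.
move=> q; rewrite inE !mem_primes muln_gt0 expn_gt0 prime_gt0// d0/=.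
case pq: (prime q) => /=; last by apply/esym/negbTE; rewrite orbF; apply: contraFneq pq => ->.
by rewrite Euclid_dvdM// Euclid_dvdX// j0 andbT dvdn_prime2.
Qed.

Lemma moebius1 : moebius 1 = 1. Proof. by rewrite /moebius big_nil. Qed.

Lemma moebius_pfactor p j d : prime p -> ~~ (p %| d)%N -> (0 < d)%N -> (0 < j)%N ->
  moebius (p ^ j * d) = (if j == 1%N then -1 else 0) * moebius d.
Proof.
move=> pp pd d0 j0; rewrite /moebius (perm_big _ (perm_primes_pfactor pp pd d0 j0))/=.
have p0 := prime_gt0 pp.
rewrite big_cons lognM ?expn_gt0 ?p0// pfactorK// (lognE p d) (negPf pd) !andbF addn0.
congr (_ * _); rewrite big_seq_cond [RHS]big_seq_cond; apply: eq_bigr => q /andP[qd _].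
rewrite lognM ?expn_gt0 ?p0// lognX (logn_prime q pp) (_ : (q == p) = false) ?muln0 ?add0n//.
by apply/eqP => qp; move: qd; rewrite qp mem_primes (negPf pd) !andbF.
Qed.

Lemma moebius_le1 n : `|moebius n| <= 1.
Proof.
rewrite /moebius normr_prod; apply: prodr_ile1 => p _.
by case: ifP => _; rewrite ?normrN1 ?normr0 ?lexx ler01.
Qed.

Lemma divisor_pfactor p m d : (0 < m)%N -> ~~ (p %| m)%N -> d \in divisors m ->
  (0 < d)%N /\ ~~ (p %| d)%N.
Proof.
move=> m0 pm; rewrite -dvdn_divisors// => dm; split; first exact: dvdn_gt0 dm.
by apply: contra pm => pd; exact: dvdn_trans dm.
Qed.

Lemma pfactor_neq1 p a m : prime p -> (p ^ a.+1 * m == 1)%N = false.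
Proof.
move=> pp; apply/negbTE/eqP => E; have : (p %| 1)%N by rewrite -E expnS -mulnA dvdn_mulr.
by rewrite dvdn1 => /eqP p1; rewrite p1 in pp.
Qed.

(** Exponents of [p] beyond 1 are killed by the Moebius function, and 0 and 1 enter with opposite
    signs. A constant [f] then cancels, while a logarithm leaves the constant log p. *)
Lemma sum_moebius_pfactor p a m (f : nat -> R) : prime p -> ~~ (p %| m)%N -> (0 < m)%N ->
  \sum_(d <- divisors (p ^ a.+1 * m)) moebius d * f d =
  \sum_(d <- divisors m) moebius d * (f d - f (p * d)%N).
Proof.
move=> pp pm m0; rewrite sum_divisors_pfactor// !big_ord_recl.
rewrite [X in _ + (_ + X)]big1 ?addr0 => [|i _]; last first.
  rewrite big_seq_cond big1// => d /andP[/(divisor_pfactor m0 pm)[d0 pd] _].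
  by rewrite moebius_pfactor//= !mul0r.
rewrite -big_split/= big_seq_cond [RHS]big_seq_cond.
apply: eq_bigr => d /andP[/(divisor_pfactor m0 pm)[d0 pd] _].
by rewrite expn0 mul1n -[bump 0 0]/1%N moebius_pfactor//= expn1; ring.
Qed.

Lemma sum_moebius n : (0 < n)%N -> \sum_(d <- divisors n) moebius d = (n == 1%N)%:R.
Proof.
move: n; apply: pfactor_ind => [|p a m pp pm m0 _].
  by rewrite divisors1 big_seq1 moebius1.
have := sum_moebius_pfactor a (fun=> 1) pp pm m0.
under eq_bigr do rewrite mulr1.
move=> ->; rewrite pfactor_neq1// big1// => d _; by rewrite subrr mulr0.
Qed.

Lemma mangoldt1 : mangoldt 1 = 0. Proof. by []. Qed.

Lemma mangoldt_ge0 n : 0 <= mangoldt n.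
Proof. by rewrite /mangoldt; case: ifP => // _; rewrite ln_ge0// ler1n pdiv_gt0. Qed.

Lemma mangoldt_pfactor p j d : prime p -> ~~ (p %| d)%N -> (0 < d)%N -> (0 < j)%N ->
  mangoldt (p ^ j * d) = if d == 1%N then ln p%:R else 0.
Proof.
move=> pp pd d0 j0; rewrite /mangoldt (perm_size (perm_primes_pfactor pp pd d0 j0))/=.
have -> : ((size (primes d)).+1 == 1)%N = (d == 1)%N.
  rewrite eqSS size_eq0; apply/eqP/eqP => [|->//] dE.
  by case: d d0 dE {pd} => [//|[//|d]] _ /eqP; rewrite primes_eq0.
case: eqP => // ->; rewrite muln1 /pdiv primesX// primes_prime//.
Qed.

Lemma sum_mangoldt n : (0 < n)%N -> \sum_(d <- divisors n) mangoldt d = ln n%:R.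
Proof.
move: n; apply: pfactor_ind => [|p a m pp pm m0 IH].
  by rewrite divisors1 big_seq1 mangoldt1 ln1.
rewrite sum_divisors_pfactor// big_ord_recl/=.
under eq_bigr do rewrite expn0 mul1n.
rewrite IH (eq_bigr (fun=> ln p%:R)) => [|j _]; last first.
  rewrite -[bump 0 j]/j.+1.
  rewrite (bigD1_seq 1%N) ?divisors_uniq -?dvdn_divisors//= mangoldt_pfactor//; last first.
    by rewrite dvdn1; apply/eqP => p1; rewrite p1 in pp.
  rewrite big_seq_cond big1 ?addr0// => d /andP[/(divisor_pfactor m0 pm)[d0 pd] d1].
  by rewrite mangoldt_pfactor// (negPf d1).
have p0 : 0 < p%:R :> R by rewrite ltr0n prime_gt0.
rewrite sumr_const card_ord natrM natrX lnM ?posrE ?exprn_gt0 ?ltr0n//; last exact: prime_gt0.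
by rewrite lnXn// addrC.
Qed.

(** For n > 1 the constant [x] drops out of all differences. Later it is the logarithm of the
    summation bound, so that the term at n = 1 supplies the growing log. *)
Lemma sum_moebius_ln n (x : R) : (0 < n)%N ->
  \sum_(d <- divisors n) moebius d * (x - ln d%:R) = mangoldt n + (n == 1%N)%:R * x.
Proof.
move: n; apply: pfactor_ind => [|p a m pp pm m0 _].
  by rewrite divisors1 big_seq1 moebius1 mangoldt1 ln1 subr0 !mul1r add0r.
rewrite (sum_moebius_pfactor a (fun d => x - ln d%:R))// pfactor_neq1// mul0r addr0.
rewrite mangoldt_pfactor//.
have p0 : 0 < p%:R :> R by rewrite ltr0n prime_gt0.
transitivity ((\sum_(d <- divisors m) moebius d) * ln p%:R).
  rewrite mulr_suml big_seq_cond [RHS]big_seq_cond.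
  apply: eq_bigr => d /andP[/(divisor_pfactor m0 pm)[d0 pd] _].
  have -> : ln (p * d)%N%:R = ln p%:R + ln d%:R :> R.
    by rewrite natrM lnM// posrE ltr0n.
  by move: (ln p%:R) (ln d%:R) (moebius d) => u v w; ring.
by rewrite sum_moebius//; case: eqP; rewrite ?mul1r ?mul0r.
Qed.

Section SumCharDivisors.
Variable g : nat -> R.
Hypothesis g1 : g 1%N = 1.
Hypothesis gM : forall m n, g (m * n)%N = g m * g n.
Hypothesis g3 : forall n, g n = 0 \/ g n = 1 \/ g n = -1.

Definition divisor_sum (n : nat) : R := \sum_(d <- divisors n) g d.

Lemma divisor_sum_pfactor p a m : prime p -> ~~ (p %| m)%N -> (0 < m)%N ->
  divisor_sum (p ^ a * m) = (\sum_(j < a.+1) g p ^+ j) * divisor_sum m.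
Proof.
move=> pp pm m0; rewrite /divisor_sum sum_divisors_pfactor// mulr_suml.
apply: eq_bigr => j _; rewrite mulr_sumr; apply: eq_bigr => d _.
rewrite gM; congr (_ * _); elim: (nat_of_ord j) => [|i IH]; first by rewrite expn0 g1 expr0.
by rewrite expnS gM IH exprS.
Qed.

(** For the values 0 and 1 the sum is 1 and a + 1; for -1 it is 1 or 0 by the parity of [a]. So the
    divisor sums of [g] are nonnegative, and at least 1 on squares, where all exponents are even. *)
Lemma sum_powers_ge p a : (~~ odd a)%:R <= \sum_(j < a.+1) g p ^+ j.
Proof.
case: (g3 p) => [->|[->|->]].
- rewrite big_ord_recl expr0 big1 ?addr0 => [|i _]; last by rewrite expr0n.
  by case: (odd a).
- under eq_bigr do rewrite expr1n.
  by rewrite sumr_const card_ord (@le_trans _ _ 1)// ?ler1n//; case: (odd a).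
- have -> // : \sum_(j < a.+1) (-1) ^+ j = (~~ odd a)%:R :> R.
  elim: a => [|a IH]; first by rewrite big_ord_recl big_ord0 addr0.
  rewrite big_ord_recr/= IH -signr_odd /=; case: (odd a); rewrite /= ?expr0 ?expr1 ?add0r ?subrr//.
Qed.

Lemma divisor_sum_ge0 n : (0 < n)%N -> 0 <= divisor_sum n.
Proof.
move: n; apply: pfactor_ind => [|p a m pp pm m0 IH].
  by rewrite /divisor_sum divisors1 big_seq1 g1.
by rewrite divisor_sum_pfactor// mulr_ge0// (le_trans _ (sum_powers_ge _ _)).
Qed.

Lemma divisor_sum_sqr_ge1 n : (0 < n)%N -> 1 <= divisor_sum (n ^ 2).
Proof.
move: n; apply: pfactor_ind => [|p a m pp pm m0 IH].
  by rewrite /divisor_sum divisors1 big_seq1 g1.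
rewrite expnMn -expnM divisor_sum_pfactor ?expn_gt0 ?m0 ?Euclid_dvdX//; last first.
  by rewrite negb_and pm.
rewrite -[1]mul1r ler_pM//.
by rewrite (le_trans _ (sum_powers_ge _ _))// oddM andbF.
Qed.

End SumCharDivisors.

(** * Chebyshev's bound and the sum of Lambda(m) / m, from the factorization of n! *)

Definition sum_ln (n : nat) : R := \sum_(1 <= m < n.+1) ln m%:R.
Definition chebyshev_psi (n : nat) : R := \sum_(1 <= m < n.+1) mangoldt m.

Lemma sum_mangoldt_div n :
  \sum_(1 <= m < n.+1) mangoldt m * (n %/ m)%:R = sum_ln n.
Proof.
have := sum_hyperbola n (fun d _ => mangoldt d).
under eq_bigr do rewrite sumr_const_nat subn1/= -mulr_natr.
move=> ->; apply: eq_big_nat => m /andP[m0 _]; exact: sum_mangoldt.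
Qed.

Lemma ln_natD1 n : (0 < n)%N -> n%:R * (ln n.+1%:R - ln n%:R) <= 1 :> R.
Proof.
move=> n0; have nR : 0 < n%:R :> R by rewrite ltr0n.
rewrite -ln_div ?posrE ?ltr0n// mulrC -ler_pdivlMr// div1r.
have -> : n.+1%:R / n%:R = 1 + n%:R^-1 :> R by rewrite -natr1 mulrDl divff ?gt_eqF// div1r.
by apply: le_ln1Dx; rewrite (lt_le_trans (ltrN10 _))// invr_ge0.
Qed.

Lemma sum_ln_ge n : n%:R * ln n%:R - n%:R <= sum_ln n.
Proof.
elim: n => [|n IH]; first by rewrite /sum_ln big_geq// mul0r subr0.
rewrite /sum_ln big_nat_recr//= -/(sum_ln n).
have [->|n0] := posnP n.
  by rewrite /sum_ln big_geq// ln1 mulr0 !addr0 sub0r oppr_le0.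
have := ln_natD1 n0; move: (ln n.+1%:R) (ln n%:R) (sum_ln n) IH => L l S.
rewrite -[n.+1%:R]natr1; lra.
Qed.

Lemma sum_ln_le n : sum_ln n <= n%:R * ln n%:R.
Proof.
rewrite /sum_ln mulr_natl -[n in _ *+ n](subn0 n) -subSS -sumr_const_nat.
by apply: ler_sum_nat => m /andP[m0 mn]; rewrite ler_ln ?posrE ?ltr0n ?ler_nat// (leq_trans m0).
Qed.

Lemma ln2_bounds : 2^-1 <= ln (2 : R) <= 1.
Proof.
have h : ln (2^-1 : R) = - ln 2 by rewrite lnV// posrE.
have : ln (1 + (- 2^-1)) <= - 2^-1 :> R by apply: le_ln1Dx; lra.
have -> : 1 + - 2^-1 = 2^-1 :> R by lra.
rewrite h => h1; have : ln (1 + 1) <= 1 :> R by apply: le_ln1Dx; lra.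
move=> h2; apply/andP; split; lra.
Qed.

(** The left-hand side is the logarithm of the central binomial coefficient, which grows by a factor
    of at most 4 at each step, and log 4 <= 2. *)
Lemma sum_ln_double n : sum_ln n.*2 - 2 * sum_ln n <= 2 * n%:R.
Proof.
elim: n => [|n IH]; first by rewrite /sum_ln !big_geq// !mulr0 subr0.
have SS j : sum_ln j.+1 = sum_ln j + ln j.+1%:R by rewrite /sum_ln big_nat_recr.
rewrite doubleS !SS.
have l1 : ln n.*2.+1%:R <= ln 2 + ln n.+1%:R :> R.
  by rewrite -lnM ?posrE// ler_ln ?posrE// -natrM ler_nat; lia.
have l2 : ln n.*2.+2%:R = ln 2 + ln n.+1%:R :> R.
  by rewrite -lnM ?posrE// -natrM; congr (ln _%:R); lia.
have /andP[_ l3] := ln2_bounds.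
rewrite l2 -[n.+1%:R in X in _ <= X]natr1; lra.
Qed.

(** In the logarithm of the central binomial coefficient, Lambda(m) has the coefficient floor(2n/m)
    - 2 floor(n/m), which is nonnegative, and at least 1 for n < m <= 2n. *)
Lemma chebyshev_psi_double n : chebyshev_psi n.*2 <= chebyshev_psi n + 2 * n%:R.
Proof.
have E : sum_ln n = \sum_(1 <= m < n.*2.+1) mangoldt m * (n %/ m)%:R.
  rewrite [RHS](big_cat_nat (n := n.+1))//=; last by rewrite ltnS -addnn leq_addr.
  rewrite [X in _ = _ + X]big_nat_cond [X in _ = _ + X]big1 ?addr0 ?sum_mangoldt_div//.
  by move=> m /andP[/andP[nm _] _]; rewrite divn_small// mulr0.
have D := sum_ln_double n; rewrite E -sum_mangoldt_div in D.
rewrite -lerBlDl (le_trans _ D)//.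
have -> : chebyshev_psi n.*2 - chebyshev_psi n =
    \sum_(1 <= m < n.*2.+1) (if (n < m)%N then mangoldt m else 0).
  rewrite /chebyshev_psi [X in X - _](big_cat_nat (n := n.+1))//=; last by rewrite ltnS -addnn leq_addr.
  rewrite [RHS](big_cat_nat (n := n.+1))//=; last by rewrite ltnS -addnn leq_addr.
  rewrite addrAC subrr add0r [X in _ = X + _]big_nat_cond [X in _ = X + _]big1 ?add0r.
    by apply: eq_big_nat => m /andP[nm _]; rewrite nm.
  by move=> m /andP[/andP[_ nm] _]; rewrite ltnNge -ltnS nm.
rewrite mulr_sumr -sumrB; apply: ler_sum_nat => m /andP[m0 mn].
rewrite mulrCA -mulrBr; case: ltnP => nm.
  rewrite (divn_small nm) mulr0 subr0 ler_peMr ?mangoldt_ge0// ler1n divn_gt0//.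
rewrite mulr_ge0 ?mangoldt_ge0// subr_ge0 -natrM ler_nat -muln2 leq_divRL//.
by rewrite -mulnA [leqRHS]mulnC leq_mul2l leq_trunc_div.
Qed.

Lemma chebyshev_psi_le n : chebyshev_psi n <= 4 * n%:R.
Proof.
elim/ltn_ind: n => n IH; case: (leqP n 1) => n1.
  rewrite /chebyshev_psi; case: n n1 {IH} => [|[|//]] _; first by rewrite big_geq// mulr0.
  by rewrite big_nat1 mangoldt1.
(* With h the upper half of [n]: psi(n) <= psi(2h) <= psi(h) + 2h <= 6h <= 4n, the last because n >=
   2. *)
have hn : (uphalf n < n)%N by lia.
have n2 : (n <= (uphalf n).*2)%N by lia.
have := IH _ hn; have := chebyshev_psi_double (uphalf n).
have : chebyshev_psi n <= chebyshev_psi (uphalf n).*2.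
  rewrite /chebyshev_psi [leRHS](big_cat_nat (n := n.+1))//= lerDl.
  by apply: sumr_ge0 => m _; exact: mangoldt_ge0.
have : (6 * uphalf n)%:R <= (4 * n)%:R :> R by rewrite ler_nat; lia.
rewrite !natrM; lra.
Qed.

(** n / m <= floor(n/m) + 1 bounds [n] times the sum by log n! + psi(n). *)
Lemma sum_mangoldt_over n : (0 < n)%N ->
  \sum_(1 <= m < n.+1) mangoldt m / m%:R <= ln n%:R + 4.
Proof.
move=> n0; have nR : 0 < n%:R :> R by rewrite ltr0n.
rewrite -(ler_pM2l nR) mulrDr (mulrC _ 4).
apply: le_trans (lerD (sum_ln_le n) (chebyshev_psi_le n)).
rewrite -sum_mangoldt_div /chebyshev_psi -big_split/= mulr_sumr.
apply: ler_sum_nat => m /andP[m0 _]; rewrite -[X in _ + X]mulr1 -mulrDr mulrCA.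
rewrite ler_wpM2l ?mangoldt_ge0// ler_pdivrMr ?ltr0n// natr1 -natrM ler_nat.
exact: ltnW (ltn_ceil _ _).
Qed.

End ArithmeticFunctions.

(** * Nonvanishing of L(1, chi) *)

Section Cabs.
Variable R : realType.
Local Notation C := R[i].

(** The norm of R[i] has its values in R[i]; a real-valued modulus keeps the estimates in [R]. *)
Definition cabs (z : C) : R := Normc.normc z.

Lemma cabsE z : `|z| = (cabs z)%:C.
Proof. by case: z. Qed.

Lemma cabs_ge0 z : 0 <= cabs z.
Proof. by case: z => a b; exact: sqrtr_ge0. Qed.

Lemma cabsM (z w : C) : cabs (z * w) = cabs z * cabs w.
Proof. exact: Normc.normcM. Qed.

Lemma cabsD (z w : C) : cabs (z + w) <= cabs z + cabs w.
Proof. by rewrite -lecR rmorphD/= -!cabsE ler_normD. Qed.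

Lemma cabsN (z : C) : cabs (- z) = cabs z.
Proof. by apply: (@complexI R); rewrite -!cabsE normrN. Qed.

Lemma cabsB (z w : C) : cabs (z - w) <= cabs z + cabs w.
Proof. by rewrite -(cabsN w) cabsD. Qed.

Lemma cabs_distC (z w : C) : cabs (z - w) = cabs (w - z).
Proof. by rewrite -cabsN opprB. Qed.

Lemma cabs_real (x : R) : cabs x%:C = `|x|.
Proof. by rewrite /cabs /= expr0n/= addr0 sqrtr_sqr. Qed.

Lemma cabs0 : cabs 0 = 0. Proof. exact: Normc.normc0. Qed.
Lemma cabs1 : cabs 1 = 1. Proof. exact: Normc.normc1. Qed.

Lemma cabs_eq0 (z : C) : cabs z = 0 -> z = 0.
Proof. exact: Normc.eq0_normc. Qed.

Lemma cabs_sum (I : Type) (s : seq I) (P : pred I) (F : I -> C) :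
  cabs (\sum_(i <- s | P i) F i) <= \sum_(i <- s | P i) cabs (F i).
Proof.
elim/big_ind2 : _ => [|x y z w xy zw|//]; first by rewrite cabs0.
by rewrite (le_trans (cabsD _ _))// lerD.
Qed.

Lemma le_Re_cabs (z : C) : `|complex.Re z| <= cabs z.
Proof. by rewrite -lecR -cabsE normc_ge_Re. Qed.

Lemma le_Im_cabs (z : C) : `|complex.Im z| <= cabs z.
Proof.
rewrite -[complex.Im z]opprK -ReiNIm normrN (le_trans (le_Re_cabs _))//.
by rewrite cabsM /cabs/= expr0n expr1n add0r sqrtr1 mulr1.
Qed.

Lemma cabs_le_ReIm (z : C) : cabs z <= `|complex.Re z| + `|complex.Im z|.
Proof.
rewrite {1}[z]complexE (le_trans (cabsD _ _))// cabsM !cabs_real.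
by rewrite /cabs/= expr0n expr1n add0r sqrtr1 mul1r.
Qed.

Lemma ccvg_cabsP (u : nat -> C) (l : C) : ccvg u l <->
  forall e : R, 0 < e -> exists M, forall n, (M <= n)%N -> cabs (u n - l) < e.
Proof.
split=> [/cvgrPdist_lt H e e0|H].
  have /H[M _ HM] : 0 < e%:C by rewrite ltcR.
  by exists M => n /HM/=; rewrite cabsE ltcR cabs_distC.
apply/cvgrPdist_lt => e e0.
have eE : e = (complex.Re e)%:C by rewrite RRe_real// gtr0_real.
have e0' : 0 < complex.Re e by rewrite eE ltcR in e0.
have [M HM] := H _ e0'; exists M => // n /= /HM.
by rewrite cabs_distC eE cabsE ltcR.
Qed.

End Cabs.

Section Cauchy.
Variable R : realType.

(** The intervals of radius [w a] around [u a] meet pairwise, so the supremum of their left ends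
    lies in all of them; the limit comes with its rate. *)
Lemma real_limit_exists (u w : nat -> R) :
  (forall a b, (a <= b)%N -> `|u b - u a| <= w a) ->
  exists l, forall a, `|u a - l| <= w a.
Proof.
move=> H.
have H2 a b : u a - w a <= u b + w b.
  have [ab|/ltnW ba] := leqP a b.
    have := H _ _ ab; have := le_trans (normr_ge0 _) (H _ _ (leqnn b)).
    rewrite ler_norml => ? /andP[? ?]; lra.
  have := H _ _ ba; have := le_trans (normr_ge0 _) (H _ _ (leqnn a)).
  rewrite ler_norml => ? /andP[? ?]; lra.
pose A := range (fun a => u a - w a).
have supA : has_sup A.
  split; first by exists (u 0%N - w 0%N), 0%N.
  by exists (u 0%N + w 0%N) => _ [a _ <-]; exact: H2.
exists (sup A) => a.
have l1 : u a - w a <= sup A by apply: ub_le_sup; [exact: supA.2|exists a].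
have l2 : sup A <= u a + w a.
  by apply: ge_sup; [exact: supA.1|move=> _ [b _ <-]; exact: H2].
rewrite ler_norml; apply/andP; split; lra.
Qed.

Lemma complex_limit_exists (u : nat -> R[i]) (w : nat -> R) :
  (forall a b, (a <= b)%N -> cabs (u b - u a) <= w a) ->
  exists l, forall a, cabs (u a - l) <= 2 * w a.
Proof.
move=> H.
have ReB (x y : R[i]) : complex.Re (x - y) = complex.Re x - complex.Re y by case: x y => [? ?] [].
have ImB (x y : R[i]) : complex.Im (x - y) = complex.Im x - complex.Im y by case: x y => [? ?] [].
have [|l1 Hl1] := @real_limit_exists (fun n => complex.Re (u n)) w.
  by move=> a b ab; rewrite /= -ReB (le_trans (le_Re_cabs _))// H.
have [|l2 Hl2] := @real_limit_exists (fun n => complex.Im (u n)) w.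
  by move=> a b ab; rewrite /= -ImB (le_trans (le_Im_cabs _))// H.
exists (l1 +i* l2)%C => a; rewrite (le_trans (cabs_le_ReIm _))// ReB ImB/= mulr_natl.
by rewrite mulr2n lerD ?Hl1 ?Hl2.
Qed.

(** Summation by parts: the decrements of the weights and the last weight add up to [w p]. *)
Lemma abel_bound (c : nat -> R[i]) (w : nat -> R) (D : R) (p : nat) :
  (forall q, cabs (\sum_(p <= r < q) c r) <= D) ->
  (forall r, (p <= r)%N -> 0 <= w r) ->
  (forall r, (p <= r)%N -> w r.+1 <= w r) ->
  forall q, cabs (\sum_(p <= r < q) c r * (w r)%:C) <= D * w p.
Proof.
move=> cD w0 wS q.
have D0 : 0 <= D by rewrite (le_trans (cabs_ge0 _) (cD p)).
have [qp|pq] := leqP q p; first by rewrite big_geq// cabs0 mulr_ge0// w0.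
pose A q := \sum_(p <= r < q) c r.
have E j : (p <= j)%N -> \sum_(p <= r < j) c r * (w r)%:C =
    A j * (w j)%:C + \sum_(p <= r < j) A r.+1 * (w r - w r.+1)%:C.
  elim: j => [|j IH].
    by rewrite leqn0 => /eqP p0; rewrite /A p0 !big_geq// mul0r addr0.
  rewrite leq_eqVlt => /predU1P[pj|pj].
    by rewrite /A -pj !big_geq// mul0r addr0.
  rewrite !big_nat_recr//= IH// rmorphB/=.
  have -> : A j.+1 = A j + c j by rewrite /A big_nat_recr.
  by ring.
rewrite E ?(ltnW pq)// (le_trans (cabsD _ _))//.
apply: (@le_trans _ _ (D * w q + \sum_(p <= r < q) D * (w r - w r.+1))).
  rewrite lerD//.
    by rewrite cabsM cabs_real ger0_norm ?w0 ?(ltnW pq)// ler_wpM2r ?w0 ?(ltnW pq)//; exact: cD.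
  rewrite (le_trans (cabs_sum _ _ _))//; apply: ler_sum_nat => r /andP[pr _].
  by rewrite cabsM cabs_real ger0_norm ?subr_ge0 ?wS// ler_wpM2r ?subr_ge0 ?wS//; exact: cD.
rewrite -mulr_sumr -mulrDr ler_wpM2l//.
under eq_bigr do rewrite -opprB.
by rewrite sumrN telescope_sumr ?(ltnW pq)// opprB addrC subrK.
Qed.

End Cauchy.

Section DirichletCharacter.
Variables (R : realType) (d : nat) (chi : int -> R[i]).
Hypothesis d0 : (0 < d)%N.
Hypothesis chiP : dirichlet_character R[i] d chi.

Lemma dirichlet_character_cabs n : chi n != 0 -> cabs (chi n) = 1.
Proof.
have [chi1 chiM chiD chiN0] := chiP; move=> cn0.
have d0' : d%:Z != 0 by rewrite eqz_nat -lt0n.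
have chiX (m : nat) x : chi (x ^+ m) = chi x ^+ m.
  by elim: m => [|m IH]; rewrite ?expr0// !exprS chiM IH.
have : chi n ^+ totient d = 1.
  rewrite -(periodic_modz chiD n); have : coprimez (n %% d%:Z)%Z d%:Z.
    by rewrite -chiN0 (periodic_modz chiD).
  have := modz_ge0 n d0'; case: (n %% _)%Z => // r _.
  rewrite coprimezE /= => /Euler_exp_totient E.
  rewrite -chiX -[RHS]chi1 -(periodic_modz chiD (_ ^+ _)) -[in RHS](periodic_modz chiD 1).
  by rewrite -[Posz r]natz -natrX natz !modz_nat E.
move/(congr1 (@cabs R)); rewrite cabs1 => E.
have cX m : cabs (chi n ^+ m) = cabs (chi n) ^+ m.
  by elim: m => [|m IH]; rewrite ?expr0 ?cabs1// !exprS cabsM IH.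
apply/eqP; rewrite -(@pexpr_eq1 _ _ (totient d)) ?totient_gt0 ?cabs_ge0// -cX E//.
Qed.

Lemma dirichlet_character_cabs_le1 n : cabs (chi n) <= 1.
Proof.
have [->|c0] := eqVneq (chi n) 0; first by rewrite cabs0.
by rewrite dirichlet_character_cabs.
Qed.

Hypothesis chi_sum0 : \sum_(0 <= a < d) chi a%:Z = 0.

(** Full periods cancel, so an initial sum is at most [d]; any other sum is a difference of two of
    these. *)
Lemma sum_nonprincipal_bounded p q : cabs (\sum_(p <= r < q) chi r%:Z) <= (2 * d)%:R.
Proof.
have [_ _ chiD _] := chiP.
pose F n := \sum_(0 <= r < n) chi r%:Z.
have FD n : F (d + n)%N = F n.
  rewrite /F (big_cat_nat (n := d))//= ?leq_addr// chi_sum0 add0r.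
  rewrite -{1}[d]add0n big_addn addKn; apply: eq_bigr => r _.
  by rewrite PoszD chiD.
have Fq j n : F (j * d + n)%N = F n.
  by elim: j => [|j IH]; rewrite ?mul0n// mulSn -addnA FD IH.
have Fle n : cabs (F n) <= d%:R.
  rewrite (divn_eq n d) Fq (le_trans (cabs_sum _ _ _))//.
  apply: (@le_trans _ _ (\sum_(0 <= r < n %% d) 1)).
    by apply: ler_sum => r _; exact: dirichlet_character_cabs_le1.
  by rewrite sumr_const_nat subn0 ler_nat ltnW// ltn_pmod.
have [qp|/ltnW pq] := leqP q p; first by rewrite big_geq// cabs0.
have -> : \sum_(p <= r < q) chi r%:Z = F q - F p.
  by rewrite /F [X in _ = X - _](big_cat_nat (n := p))//= addrAC subrr add0r.
rewrite (le_trans (cabsB _ _))// mul2n -addnn natrD lerD//.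
Qed.

Definition char_harmonic (n : nat) : R[i] := \sum_(1 <= r < n.+1) chi r%:Z / r%:R.

Lemma char_harmonic_tail a b : (a <= b)%N ->
  cabs (char_harmonic b - char_harmonic a) <= (2 * d)%:R / a.+1%:R.
Proof.
move=> ab.
have -> : char_harmonic b - char_harmonic a = \sum_(a.+1 <= r < b.+1) chi r%:Z * (r%:R^-1 : R)%:C.
  rewrite /char_harmonic [X in X - _](big_cat_nat (n := a.+1))//= addrAC subrr add0r.
  by apply: eq_bigr => r _; rewrite fmorphV rmorph_nat.
apply: (abel_bound (w := fun r => r%:R^-1)) => [q|r _|r ar].
- exact: sum_nonprincipal_bounded.
- by rewrite invr_ge0.
- by rewrite lef_pV2 ?posrE ?ltr0n ?ler_nat// (leq_trans _ ar).
Qed.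

Lemma char_harmonic_limit : exists L, forall a,
  cabs (char_harmonic a - L) <= (4 * d)%:R / a.+1%:R.
Proof.
have [L HL] := @complex_limit_exists R char_harmonic (fun a => (2 * d)%:R / a.+1%:R) char_harmonic_tail.
by exists L => a; rewrite (le_trans (HL a))// mulrA -natrM mulnA.
Qed.

Lemma char_harmonic_dirichlet_L L (D : R) :
  (forall a, cabs (char_harmonic a - L) <= D / a.+1%:R) -> dirichlet_L 1 chi = L.
Proof.
move=> HL; apply: (@cvg_lim R[i]^o); first exact: norm_hausdorff.
rewrite -[X in X @ _ --> _]/(fun m => _) -(cvg_shiftS _ _).
apply/ccvg_cabsP => e e0; have [M HM] := exists_nat_ge (D / e).
exists M => n Mn; rewrite -[X in cabs (X - _)]/(char_harmonic n).
rewrite (le_lt_trans (HL n))// ltr_pdivrMr// mulrC -ltr_pdivrMr// (le_lt_trans HM)//.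
by rewrite ltr_nat ltnS.
Qed.

End DirichletCharacter.

(** * Sums of chi(m) Lambda(m) / m, and characters whose square is nonprincipal *)

Section LargeSums.
Variables (R : realType) (d : nat) (chi : int -> R[i]).
Hypothesis d0 : (0 < d)%N.
Hypothesis chiP : dirichlet_character R[i] d chi.

(** Complete multiplicativity splits chi(ek) / (ek), so a twisted convolution with 1 becomes a
    weighted sum of partial sums of L(1, chi). [G] will be the Moebius function times a logarithm if
    L = 0, and Lambda otherwise. *)
Lemma sum_character_hyperbola (G : nat -> R) n :
  \sum_(1 <= e < n.+1) chi e%:Z * (G e / e%:R)%:C * char_harmonic chi (n %/ e) =
  \sum_(1 <= m < n.+1) chi m%:Z * ((\sum_(e <- divisors m) G e) / m%:R)%:C.
Proof.
have [_ chiM _ _] := chiP.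
pose f (e k : nat) := chi (e * k)%N%:Z * (G e / (e * k)%N%:R)%:C.
have := sum_hyperbola n f => E.
transitivity (\sum_(1 <= e < n.+1) \sum_(1 <= k < (n %/ e).+1) f e k).
  apply: eq_bigr => e _; rewrite /char_harmonic mulr_sumr; apply: eq_bigr => k _.
  rewrite /f PoszM chiM natrM invfM !rmorphM/= !fmorphV !rmorph_nat.
  by rewrite -!mulrA; congr (_ * _); rewrite !mulrA; ring.
rewrite E; apply: eq_big_nat => m /andP[m0 _].
rewrite mulr_suml rmorph_sum mulr_sumr big_seq_cond [RHS]big_seq_cond.
apply: eq_bigr => e /andP[em _]; rewrite -dvdn_divisors// in em.
by rewrite /f mulnC divnK.
Qed.

Lemma inv_divnS n e : (0 < n)%N -> (0 < e)%N -> (n %/ e).+1%:R^-1 <= e%:R / n%:R :> R.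
Proof.
move=> n0 e0; rewrite -[leLHS]div1r ler_pdivrMr ?ltr0n// mulrAC ler_pdivlMr ?ltr0n//.
by rewrite mul1r -natrM ler_nat mulnC ltnW// ltn_ceil.
Qed.

Variables (L : R[i]) (D : R).
Hypothesis HL : forall a, cabs (char_harmonic chi a - L) <= D / a.+1%:R.

Let D0 : 0 <= D.
Proof. by have := le_trans (cabs_ge0 _) (HL 0); rewrite divr1. Qed.

Definition mangoldt_char_sum n : R[i] :=
  \sum_(1 <= m < n.+1) chi m%:Z * (mangoldt R m / m%:R)%:C.

(** As L = 0, the partial sum up to n/e is at most D e / n, and the total is at most (D / n) (n log
    n - log n!) <= D. *)
Lemma mangoldt_char_sum_zero n : L = 0 -> (0 < n)%N ->
  cabs ((ln n%:R)%:C + mangoldt_char_sum n) <= D.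
Proof.
move=> L0 n0; have [chi1 _ _ _] := chiP.
have nR : 0 < n%:R :> R by rewrite ltr0n.
have -> : (ln n%:R)%:C + mangoldt_char_sum n =
    \sum_(1 <= e < n.+1) chi e%:Z * ((moebius R e * (ln n%:R - ln e%:R)) / e%:R)%:C
      * char_harmonic chi (n %/ e).
  rewrite (sum_character_hyperbola (fun e => moebius R e * (ln n%:R - ln e%:R))).
  have -> : (ln n%:R)%:C = \sum_(1 <= m < n.+1) chi m%:Z * ((m == 1%N)%:R * ln n%:R / m%:R : R)%:C.
    rewrite big_ltn// big1_seq ?addr0 => [|m]; first by rewrite chi1 eqxx divr1 !mul1r.
    by rewrite mem_index_iota => /andP[_ /andP[m2 _]]; rewrite gtn_eqF// !mul0r mulr0.
  rewrite addrC /mangoldt_char_sum -big_split/=; apply: eq_big_nat => m /andP[m0 _].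
  by rewrite sum_moebius_ln// mulrDl rmorphD mulrDr.
rewrite (le_trans (cabs_sum _ _ _))//.
apply: (@le_trans _ _ (\sum_(1 <= e < n.+1) D / n%:R * (ln n%:R - ln e%:R))).
  apply: ler_sum_nat => e /andP[e0 en].
  have eR : 0 < e%:R :> R by rewrite ltr0n.
  have l0 : 0 <= ln n%:R - ln e%:R :> R by rewrite subr_ge0 ler_ln ?posrE// ler_nat -ltnS.
  rewrite !cabsM cabs_real !normrM normfV (gtr0_norm eR) (ger0_norm l0).
  have h1 : cabs (char_harmonic chi (n %/ e)) <= D * (e%:R / n%:R).
    have := HL (n %/ e); rewrite L0 subr0 => /le_trans; apply.
    by rewrite ler_wpM2l// inv_divnS.
  have -> : D / n%:R * (ln n%:R - ln e%:R) =
      1 * (1 * (ln n%:R - ln e%:R) / e%:R) * (D * (e%:R / n%:R)).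
    by move: (ln n%:R) (ln e%:R) => u v; field; rewrite !gt_eqF.
  rewrite ler_pM ?mulr_ge0 ?cabs_ge0 ?invr_ge0 ?(ltW eR)//.
  rewrite ler_pM ?mulr_ge0 ?cabs_ge0 ?invr_ge0 ?(ltW eR) ?(dirichlet_character_cabs_le1 d0 chiP)//.
  by rewrite ler_wpM2r ?invr_ge0 ?(ltW eR)// ler_wpM2r// moebius_le1.
rewrite -mulr_sumr sumrB sumr_const_nat subn1/= -/(sum_ln R n) -[X in _ * (X - _)]mulr_natl.
rewrite mulrAC ler_pdivrMr// ler_wpM2l//.
by have := sum_ln_ge R n; lra.
Qed.

(** The decrease needs log m >= 1; from 4 on this follows from log 2 >= 1/2. *)
Lemma ln_over_decr m : (4 <= m)%N -> ln m.+1%:R / m.+1%:R <= ln m%:R / m%:R :> R.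
Proof.
move=> m4; have m0 : (0 < m)%N by lia.
have mR : 0 < m%:R :> R by rewrite ltr0n.
rewrite ler_pdivrMr ?ltr0n// mulrAC ler_pdivlMr//.
have h := ln_natD1 R m0.
have l4 : 1 <= ln m%:R :> R.
  have /andP[l2 _] := ln2_bounds R.
  apply: (@le_trans _ _ (ln 2 + ln 2)); first lra.
  by rewrite -lnM ?posrE// ler_ln ?posrE ?mulr_gt0// -natrM ler_nat.
move: h l4; move: (ln m.+1%:R) (ln m%:R) => u v; rewrite -natr1; lra.
Qed.

Hypothesis chi_sum0 : \sum_(0 <= a < d) chi a%:Z = 0.

Lemma sum_ln_char_bounded : exists K, forall n, (4 <= n)%N ->
  cabs (\sum_(1 <= m < n.+1) chi m%:Z * (ln m%:R / m%:R)%:C) <= K.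
Proof.
exists (cabs (\sum_(1 <= m < 4) chi m%:Z * (ln m%:R / m%:R)%:C) +
  (2 * d)%:R * (ln 4%:R / 4%:R)) => n n4.
rewrite (big_cat_nat (n := 4))//=; last by rewrite ltnW.
rewrite (le_trans (cabsD _ _))// lerD//.
apply: (abel_bound (w := fun m => ln m%:R / m%:R)) => [q|r r4|r r4].
- exact: sum_nonprincipal_bounded.
- by rewrite divr_ge0// ln_ge0// ler1n (leq_trans _ r4).
- exact: ln_over_decr.
Qed.

(** Lambda convolved with 1 is the logarithm, whose twisted sum is bounded by Abel summation.
    Replacing each partial sum of the series by [L] costs at most (D / n) psi(n) <= 4 D, and [L] is
    then divided out. *)
Lemma mangoldt_char_sum_bounded : L != 0 -> exists K, forall n, (4 <= n)%N ->
  cabs (mangoldt_char_sum n) <= K.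
Proof.
move=> L0; have [K1 HK1] := sum_ln_char_bounded.
have L0' : 0 < cabs L.
  by rewrite lt_neqAle cabs_ge0 andbT eq_sym; apply: contra L0 => /eqP/cabs_eq0 ->.
exists ((K1 + 4 * D) / cabs L) => n n4; have n0 : (0 < n)%N by lia.
have nR : 0 < n%:R :> R by rewrite ltr0n.
rewrite ler_pdivlMr// -cabsM.
have E : mangoldt_char_sum n * L = \sum_(1 <= m < n.+1) chi m%:Z * (ln m%:R / m%:R)%:C -
    \sum_(1 <= e < n.+1) chi e%:Z * (mangoldt R e / e%:R)%:C * (char_harmonic chi (n %/ e) - L).
  apply/eqP; rewrite eq_sym subr_eq; apply/eqP.
  under [X in _ = _ + X]eq_bigr do rewrite mulrBr.
  rewrite [X in _ = _ + X]sumrB sum_character_hyperbola -mulr_suml addrC subrK.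
  by apply: eq_big_nat => m /andP[m0 _]; rewrite sum_mangoldt.
rewrite E (le_trans (cabsB _ _))// lerD ?HK1// (le_trans (cabs_sum _ _ _))//.
apply: (@le_trans _ _ (\sum_(1 <= e < n.+1) D / n%:R * mangoldt R e)).
  apply: ler_sum_nat => e /andP[e0 en]; have eR : 0 < e%:R :> R by rewrite ltr0n.
  have l0 : 0 <= mangoldt R e / e%:R by rewrite divr_ge0 ?mangoldt_ge0.
  rewrite !cabsM cabs_real (ger0_norm l0).
  have h1 : cabs (char_harmonic chi (n %/ e) - L) <= D * (e%:R / n%:R).
    by apply: (le_trans (HL _)); rewrite ler_wpM2l// inv_divnS.
  have -> : D / n%:R * mangoldt R e = 1 * (mangoldt R e / e%:R) * (D * (e%:R / n%:R)).
    by move: (mangoldt R e) => u; field; rewrite !gt_eqF.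
  rewrite ler_pM ?mulr_ge0 ?cabs_ge0 ?invr_ge0 ?mangoldt_ge0 ?(ltW eR)//.
  by rewrite ler_wpM2r// (dirichlet_character_cabs_le1 d0 chiP).
rewrite -mulr_sumr -/(chebyshev_psi R n) mulrAC ler_pdivrMr// (mulrC 4) -mulrA ler_wpM2l//.
exact: chebyshev_psi_le.
Qed.

End LargeSums.

Section ComplexCase.
Variables (R : realType) (d : nat) (chi : int -> R[i]).
Hypothesis d0 : (0 < d)%N.
Hypothesis chiP : dirichlet_character R[i] d chi.
Hypothesis chi_sum0 : \sum_(0 <= a < d) chi a%:Z = 0.
Hypothesis chi2_sum0 : \sum_(0 <= a < d) (chi \* chi) a%:Z = 0.

(** On the unit circle, 3 + 4 cos t + cos 2t = 2 (1 + cos t)^2. *)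
Lemma three_four_one n : 0 <= 3 + 4 * complex.Re (chi n) + complex.Re ((chi \* chi) n).
Proof.
have [c0|c0] := eqVneq (chi n) 0.
  have -> : (chi \* chi) n = 0 by rewrite /= c0 mul0r.
  by rewrite c0 -[complex.Re 0]/(0 : R) mulr0 !addr0.
have := dirichlet_character_cabs d0 chiP c0; rewrite /=; case: (chi n) => a b /= E.
have E2 : a ^+ 2 + b ^+ 2 = 1.
  by rewrite -[LHS]sqr_sqrtr ?addr_ge0 ?sqr_ge0// E expr1n.
have -> : 3 + 4 * a + (a * a - b * b) = 2 * (1 + a) ^+ 2 + (1 - (a ^+ 2 + b ^+ 2)) by ring.
by rewrite E2 subrr addr0 mulr_ge0// sqr_ge0.
Qed.

Lemma Re_mangoldt_char_sum (psi : int -> R[i]) n :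
  complex.Re (mangoldt_char_sum psi n) =
  \sum_(1 <= m < n.+1) complex.Re (psi m%:Z) * (mangoldt R m / m%:R).
Proof.
rewrite /mangoldt_char_sum; elim: n => [|n IH]; first by rewrite !big_geq.
have ReD (x y : R[i]) : complex.Re (x + y) = complex.Re x + complex.Re y by case: x y => [? ?] [].
rewrite big_nat_recr// [RHS]big_nat_recr//= ReD IH; congr (_ + _).
by case: (psi _) => a b /=; rewrite mulr0 subr0.
Qed.

Lemma complex_dirichlet_L_neq0 : dirichlet_L 1 chi != 0.
Proof.
have [L HL] := char_harmonic_limit d0 chiP chi_sum0.
have chi2P := dirichlet_characterM chiP chiP.
have [L2 HL2] := char_harmonic_limit d0 chi2P chi2_sum0.
rewrite (char_harmonic_dirichlet_L HL); apply/negP => /eqP L0.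
(* Only an upper bound is sought, so a vanishing L(1, chi^2), which contributes - log n + O(1), does
   no harm. *)
have [K HK] : exists K, forall n, (4 <= n)%N -> complex.Re (mangoldt_char_sum (chi \* chi) n) <= K.
  have [L20|L20] := eqVneq L2 0.
    exists (4 * d)%:R => n n4; have n0 : (0 < n)%N by lia.
    have := mangoldt_char_sum_zero d0 chi2P HL2 L20 n0.
    move=> /(le_trans (le_Re_cabs _)); rewrite ler_norml => /andP[_].
    have -> (x : R) (z : R[i]) : complex.Re (x%:C + z) = x + complex.Re z by case: z.
    have : 0 <= ln n%:R :> R by rewrite ln_ge0// ler1n.
    lra.
  have [K HK] := mangoldt_char_sum_bounded d0 chi2P HL2 chi2_sum0 L20.
  by exists K => n n4; rewrite (le_trans (ler_norm _))// (le_trans (le_Re_cabs _))// HK.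
(* Positivity will give log n <= 3 * 4 + 4 * (4 d) + K, from the three sums weighted by 3, 4 and 1;
   the extra 1 makes this false. *)
have [n0 Hn0] := exists_nat_ge (expR (12 + 4 * (4 * d)%:R + K + 1) : R).
pose n := maxn n0 4.
have n4 : (4 <= n)%N by rewrite leq_maxr.
have n1 : (0 < n)%N by lia.
have lnn : 12 + 4 * (4 * d)%:R + K + 1 <= ln n%:R :> R.
  rewrite -[leLHS]expRK ler_ln ?posrE ?expR_gt0 ?ltr0n//.
  by rewrite (le_trans Hn0)// ler_nat leq_maxl.
have h0 := sum_mangoldt_over R n1.
have h2 := HK _ n4.
have h1 : complex.Re (mangoldt_char_sum chi n) <= (4 * d)%:R - ln n%:R.
  have := mangoldt_char_sum_zero d0 chiP HL L0 n1.
  move=> /(le_trans (le_Re_cabs _)); rewrite ler_norml => /andP[_].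
  have -> (x : R) (z : R[i]) : complex.Re (x%:C + z) = x + complex.Re z by case: z.
  lra.
have : 0 <= 3 * (\sum_(1 <= m < n.+1) mangoldt R m / m%:R) +
    4 * complex.Re (mangoldt_char_sum chi n) + complex.Re (mangoldt_char_sum (chi \* chi) n).
  rewrite !Re_mangoldt_char_sum !mulr_sumr -!big_split/=; apply: sumr_ge0 => m _.
  have -> (a b x : R) : 3 * x + 4 * (a * x) + b * x = (3 + 4 * a + b) * x by ring.
  by rewrite mulr_ge0 ?three_four_one// divr_ge0// mangoldt_ge0.
lra.
Qed.

End ComplexCase.

(** * Real characters, by the hyperbola method with weights 1 / sqrt m *)

Section InverseSquareRoots.
Variable R : realType.

Definition sum_inv_sqrt (n : nat) : R := \sum_(1 <= k < n.+1) (Num.sqrt k%:R)^-1.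

Lemma sum_inv_sqrtS n : sum_inv_sqrt n.+1 = sum_inv_sqrt n + (Num.sqrt n.+1%:R)^-1.
Proof. by rewrite /sum_inv_sqrt big_nat_recr. Qed.

Lemma sqrt_natS n : Num.sqrt n.+1%:R ^+ 2 = Num.sqrt n%:R ^+ 2 + 1 :> R.
Proof. by rewrite !sqr_sqrtr// natr1. Qed.

Lemma sqrt_nat_gt0 n : (0 < n)%N -> 0 < Num.sqrt n%:R :> R.
Proof. by move=> n0; rewrite sqrtr_gt0 ltr0n. Qed.

Lemma inv_sqrt_le n : (Num.sqrt n.+1%:R)^-1 <= 2 * (Num.sqrt n.+1%:R - Num.sqrt n%:R) :> R.
Proof.
have t0 := sqrt_nat_gt0 (ltn0Sn n); rewrite -div1r ler_pdivrMr//.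
have := sqrt_natS n; have := sqrtr_ge0 (n%:R : R).
move: (Num.sqrt n%:R) (Num.sqrt n.+1%:R) t0 => s t t0 s0 E.
have := sqr_ge0 (t - s); lra.
Qed.

Lemma inv_sqrt_ge n : (0 < n)%N ->
  2 * (Num.sqrt n.+1%:R - Num.sqrt n%:R) <= (Num.sqrt n%:R)^-1 :> R.
Proof.
move=> /sqrt_nat_gt0 s0; rewrite -[leRHS]div1r ler_pdivlMr//.
have := sqrt_natS n; move: (Num.sqrt n%:R) (Num.sqrt n.+1%:R) s0 => s t s0 E.
have := sqr_ge0 (t - s); lra.
Qed.

Lemma sum_inv_sqrt_diff_le p q : (p <= q)%N ->
  sum_inv_sqrt q - 2 * Num.sqrt q%:R <= sum_inv_sqrt p - 2 * Num.sqrt p%:R.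
Proof.
elim: q => [|q IH]; first by rewrite leqn0 => /eqP ->.
rewrite leq_eqVlt => /predU1P[-> //|/IH]; rewrite sum_inv_sqrtS.
have := inv_sqrt_le q; lra.
Qed.

Lemma sum_inv_sqrt_diff_ge p q : (p <= q)%N ->
  sum_inv_sqrt p - 2 * Num.sqrt p.+1%:R <= sum_inv_sqrt q - 2 * Num.sqrt q.+1%:R.
Proof.
elim: q => [|q IH]; first by rewrite leqn0 => /eqP ->.
rewrite leq_eqVlt => /predU1P[-> //|/IH]; rewrite sum_inv_sqrtS.
have := inv_sqrt_ge (ltn0Sn q); lra.
Qed.

Lemma sum_inv_sqrt_le n : sum_inv_sqrt n <= 2 * Num.sqrt n%:R.
Proof.
have := sum_inv_sqrt_diff_le (leq0n n); rewrite {2}/sum_inv_sqrt big_geq// sqrtr0; lra.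
Qed.

(** The sum decreases after subtraction of 2 sqrt n and increases after that of 2 sqrt (n + 1),
    which traps the constant. *)
Lemma sum_inv_sqrt_asymp : exists c, forall n,
  `|sum_inv_sqrt n - 2 * Num.sqrt n%:R - c| <= 2 * (Num.sqrt n.+1%:R - Num.sqrt n%:R).
Proof.
apply: (real_limit_exists (u := fun n => sum_inv_sqrt n - 2 * Num.sqrt n%:R)) => p q pq.
have h1 := sum_inv_sqrt_diff_le pq; have h2 := sum_inv_sqrt_diff_ge pq.
have h3 : Num.sqrt q%:R <= Num.sqrt q.+1%:R :> R by rewrite ler_sqrt// ler_nat.
by rewrite ler_norml; apply/andP; split; lra.
Qed.

(** With y = floor(M^2 / e), the asymptotic error and the rounding of M^2 / e to y cost at most 1 /
    sqrt y each, and M^2 / e <= y + 1 <= 4 y bounds this by 2 sqrt e / M. *)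
Lemma sum_inv_sqrt_div : exists c, forall M e, (0 < e <= M ^ 2)%N ->
  `|sum_inv_sqrt (M ^ 2 %/ e) - 2 * (M%:R / Num.sqrt e%:R) - c| <=
    4 * (Num.sqrt e%:R / M%:R).
Proof.
have S4 z : (0 < z)%N -> (z.+1 <= z * 2 ^ 2)%N by lia.
have [c Hc] := sum_inv_sqrt_asymp; exists c => M e /andP[e0 eM].
have M0 : (0 < M)%N by rewrite lt0n; apply: contraTneq eM => ->; rewrite -ltnNge.
have MR : 0 < M%:R :> R by rewrite ltr0n.
have eR : 0 < e%:R :> R by rewrite ltr0n.
set y := (M ^ 2 %/ e)%N; have y0 : (0 < y)%N by rewrite divn_gt0.
have yR : 0 < y%:R :> R by rewrite ltr0n.
pose t : R := (M ^ 2)%:R / e%:R.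
have tE : Num.sqrt t = M%:R / Num.sqrt e%:R.
  by rewrite /t sqrtrM// natrX sqrtr_sqr sqrtrV// ger0_norm.
have yt : y%:R <= t by rewrite /t ler_pdivlMr// -natrM ler_nat leq_trunc_div.
have ty : t <= y.+1%:R by rewrite /t ler_pdivrMr// -natrM ler_nat ltnW// ltn_ceil.
have s0 := sqrt_nat_gt0 y0.
have t0 : 0 < t by rewrite (lt_le_trans _ yt)// ltr0n.
have st : Num.sqrt y%:R <= Num.sqrt t by rewrite ler_sqrt// ltW.
have ts : Num.sqrt t <= Num.sqrt y.+1%:R by rewrite ler_sqrt.
have h := Hc y; have h2 := inv_sqrt_ge y0.
rewrite -tE -[Num.sqrt e%:R / M%:R]invrK invf_div -tE.
have h3 : (Num.sqrt y%:R)^-1 <= 2 * (Num.sqrt t)^-1 :> R.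
  rewrite -[2]invrK -invfM lef_pV2 ?posrE ?mulr_gt0 ?sqrtr_gt0 ?invr_gt0//.
  rewrite mulrC ler_pdivrMr// -[X in _ <= _ * X](ger0_norm (x := 2))// -sqrtr_sqr.
  rewrite -sqrtrM// ler_sqrt ?mulr_gt0 ?exprn_gt0 ?ltr0n// (le_trans ty)//.
  by rewrite -natrX -natrM ler_nat S4.
move: h; rewrite !ler_norml => /andP[? ?]; apply/andP; split; lra.
Qed.

End InverseSquareRoots.

Section RealCase.
Variables (R : realType) (d : nat) (chi : int -> R[i]).
Hypothesis d0 : (0 < d)%N.
Hypothesis chiP : dirichlet_character R[i] d chi.
Hypothesis chi_sum0 : \sum_(0 <= a < d) chi a%:Z = 0.
Hypothesis chi_real : forall n, chi n != 0 -> chi n * chi n = 1.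

Let g (n : nat) : R := complex.Re (chi n%:Z).

Let gP n : chi n%:Z = (g n)%:C /\ (g n = 0 \/ g n = 1 \/ g n = -1).
Proof.
rewrite /g; have [->|c0] := eqVneq (chi n%:Z) 0; first by split=> //; left.
have /eqP := chi_real c0; rewrite -expr2 sqrf_eq1 => /orP[]/eqP ->.
  by split=> //; right; left.
by split; [rewrite rmorphN|right; right].
Qed.

Let chiE n : chi n%:Z = (g n)%:C. Proof. by have [] := gP n. Qed.

Let g_le1 n : `|g n| <= 1.
Proof. by have [_ [->|[->|->]]] := gP n; rewrite ?normr0 ?normrN ?normr1. Qed.

Let g_one : g 1%N = 1.
Proof. by have [chi1 _ _ _] := chiP; rewrite /g chi1. Qed.

Let g_mul m n : g (m * n)%N = g m * g n.
Proof.
have [_ chiM _ _] := chiP; apply: (@complexI R).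
by rewrite -chiE PoszM chiM !chiE rmorphM.
Qed.

Let D : R := (2 * d)%:R.

Let abel_g (w : nat -> R) p : (forall r, (p <= r)%N -> 0 <= w r) ->
  (forall r, (p <= r)%N -> w r.+1 <= w r) ->
  forall q, `|\sum_(p <= r < q) g r * w r| <= D * w p.
Proof.
move=> w0 wS q; rewrite -cabs_real rmorph_sum.
under eq_bigr do rewrite rmorphM/= -chiE.
apply: (abel_bound (c := fun r => chi r%:Z)) => // q'.
exact: sum_nonprincipal_bounded.
Qed.

Let inv_sqrt_decr r : (0 < r)%N -> (Num.sqrt r.+1%:R)^-1 <= (Num.sqrt r%:R)^-1 :> R.
Proof.
by move=> r0; rewrite lef_pV2 ?posrE ?sqrt_nat_gt0// ler_sqrt// ler_nat.
Qed.

Let S (M : nat) : R := \sum_(1 <= m < (M ^ 2).+1) divisor_sum g m / Num.sqrt m%:R.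

(** The squares alone contribute at least the harmonic sum, and the other terms are nonnegative. *)
Let S_ge M : ln M.+1%:R <= S M.
Proof.
have g3 n : g n = 0 \/ g n = 1 \/ g n = -1 by have [] := gP n.
elim: M => [|M IH]; first by rewrite ln1 /S big_geq.
rewrite /S big_nat_recr ?expn_gt0//=.
have h1 : S M <= \sum_(1 <= m < M.+1 ^ 2) divisor_sum g m / Num.sqrt m%:R.
  have le : ((M ^ 2).+1 <= M.+1 ^ 2)%N by rewrite ltn_exp2r.
  rewrite [leRHS](big_cat_nat (n := (M ^ 2).+1))//= lerDl big_nat_cond.
  apply: sumr_ge0 => m /andP[/andP[m0 _] _].
  by rewrite divr_ge0 ?sqrtr_ge0// divisor_sum_ge0// (leq_trans _ m0).
have h2 : M.+1%:R^-1 <= divisor_sum g (M.+1 ^ 2) / Num.sqrt (M.+1 ^ 2)%:R.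
  rewrite natrX sqrtr_sqr ger0_norm// -[leLHS]mul1r ler_wpM2r ?invr_ge0//.
  exact: divisor_sum_sqr_ge1.
have h3 : ln M.+2%:R - ln M.+1%:R <= M.+1%:R^-1 :> R.
  by rewrite -[leRHS]mulr1 ler_pdivlMl// ln_natD1.
by apply: le_trans (lerD (le_trans IH h1) h2); rewrite -lerBlDl.
Qed.

(** The pairs with e k <= M^2 are cut at e = M. Up to there the sum over [k] has a known asymptotic;
    beyond, k <= M, and the sum over [e] is made innermost to exploit the cancellation in [g]. *)
Let S_split M : S M = \sum_(1 <= e < M.+1) (g e / Num.sqrt e%:R) * sum_inv_sqrt R (M ^ 2 %/ e) +
  \sum_(1 <= k < M.+1) (Num.sqrt k%:R)^-1 *
     \sum_(M.+1 <= e < (M ^ 2 %/ k).+1) g e * (Num.sqrt e%:R)^-1.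
Proof.
pose f e k := g e / Num.sqrt (e * k)%:R.
have fE e k : f e k = g e / Num.sqrt e%:R * (Num.sqrt k%:R)^-1.
  by rewrite /f natrM sqrtrM// invfM mulrA.
have -> : S M = \sum_(1 <= e < (M ^ 2).+1) \sum_(1 <= k < (M ^ 2 %/ e).+1) f e k.
  rewrite sum_hyperbola; apply: eq_big_nat => m /andP[m0 _].
  rewrite /divisor_sum mulr_suml big_seq_cond [RHS]big_seq_cond.
  apply: eq_bigr => e /andP[em _]; rewrite -dvdn_divisors// in em.
  by rewrite /f mulnC divnK.
have MM : (M <= M ^ 2)%N by rewrite -mulnn; case: (M) => // m; rewrite leq_pmulr.
rewrite (big_cat_nat (n := M.+1))//=; congr (_ + _).
  apply: eq_bigr => e _; rewrite /sum_inv_sqrt mulr_sumr.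
  by apply: eq_bigr => k _; rewrite fE.
transitivity (\sum_(M.+1 <= e < (M ^ 2).+1) \sum_(1 <= k < M.+1 | (e * k <= M ^ 2)%N) f e k).
  apply: eq_big_nat => e /andP[Me _]; have e0 : (0 < e)%N by apply: leq_trans Me.
  have le : ((M ^ 2 %/ e).+1 <= M.+1)%N.
    by rewrite ltnS -(leq_pmul2r e0) (leq_trans (leq_trunc_div _ _))// -mulnn leq_mul2l ltnW ?orbT.
  rewrite (big_nat_widen _ _ _ _ _ le); apply: eq_bigl => k /=.
  by rewrite ltnS leq_divRL// mulnC.
rewrite (exchange_big_dep_nat xpredT)//=; apply: eq_big_nat => k /andP[k0 _].
have le : ((M ^ 2 %/ k).+1 <= (M ^ 2).+1)%N by rewrite ltnS leq_div.
rewrite (big_nat_widen _ _ _ _ _ le) mulr_sumr; apply: eq_big => [e|e _] /=.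
  by rewrite ltnS leq_divRL.
by rewrite fE mulrC.
Qed.

Lemma real_dirichlet_L_neq0 : dirichlet_L 1 chi != 0.
Proof.
have [L HL] := char_harmonic_limit d0 chiP chi_sum0.
rewrite (char_harmonic_dirichlet_L HL); apply/negP => /eqP L0.
have gharm n : `|\sum_(1 <= r < n.+1) g r / r%:R| <= (4 * d)%:R / n.+1%:R.
  have := HL n; rewrite L0 subr0; congr (_ <= _).
  rewrite -cabs_real rmorph_sum /char_harmonic; congr cabs; apply: eq_bigr => r _.
  by rewrite rmorphM/= fmorphV rmorph_nat -chiE.
have [c Hc] := sum_inv_sqrt_div R.
(* In this order: the main term 2 M times a partial sum of L(1, chi) = 0; the constant [c] times an
   Abel sum; [M] errors of at most 4 / M; the part e > M. *)
pose B := 2 * (4 * d)%:R + `|c| * D + 4 + 2 * D.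
have D0 : 0 <= D by [].
have SB M : (0 < M)%N -> S M <= B.
  move=> M0; have MR : 0 < M%:R :> R by rewrite ltr0n.
  rewrite S_split; apply: lerD.
    have -> : \sum_(1 <= e < M.+1) (g e / Num.sqrt e%:R) * sum_inv_sqrt R (M ^ 2 %/ e) =
        2 * M%:R * (\sum_(1 <= e < M.+1) g e / e%:R) +
        c * (\sum_(1 <= e < M.+1) g e * (Num.sqrt e%:R)^-1) +
        \sum_(1 <= e < M.+1) (g e / Num.sqrt e%:R) *
          (sum_inv_sqrt R (M ^ 2 %/ e) - 2 * (M%:R / Num.sqrt e%:R) - c).
      rewrite !mulr_sumr -!big_split/=; apply: eq_big_nat => e /andP[e0 _].
      have s0 := sqrt_nat_gt0 R e0.
      rewrite -[in g e / e%:R](sqr_sqrtr (ler0n R e)).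
      by move: (Num.sqrt e%:R) s0 => s s0; field; rewrite gt_eqF.
    apply: lerD; first apply: lerD.
    - rewrite (le_trans (ler_norm _))// normrM ger0_norm ?mulr_ge0//.
      apply: (@le_trans _ _ (2 * M%:R * ((4 * d)%:R / M.+1%:R))).
        by rewrite ler_wpM2l ?mulr_ge0.
      rewrite -mulrA ler_pM2l// mulrCA ler_piMr// ler_pdivrMr// mul1r ler_nat//.
    - rewrite (le_trans (ler_norm _))// normrM ler_wpM2l//.
      have := @abel_g (fun e => (Num.sqrt e%:R)^-1) 1%N _ _ M.+1.
      by rewrite sqrtr1 invr1 mulr1; apply => r r0; rewrite ?invr_ge0 ?sqrtr_ge0 ?inv_sqrt_decr.
    - rewrite (le_trans (ler_norm _))// (le_trans (ler_norm_sum _ _ _))//.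
      apply: (@le_trans _ _ (\sum_(1 <= e < M.+1) 4 / M%:R)).
        apply: ler_sum_nat => e /andP[e0 eM]; have s0 := sqrt_nat_gt0 R e0.
        have eM2 : (0 < e <= M ^ 2)%N by rewrite e0/= (leq_trans (_ : e <= M)%N)// -mulnn leq_pmulr.
        have := Hc _ _ eM2 => h.
        rewrite !normrM normfV (gtr0_norm s0).
        have -> : 4 / M%:R = 1 / Num.sqrt e%:R * (4 * (Num.sqrt e%:R / M%:R)) :> R.
          by move: (Num.sqrt e%:R) s0 => s s0; field; rewrite !gt_eqF.
        by rewrite ler_pM ?mulr_ge0 ?invr_ge0 ?sqrtr_ge0// ler_wpM2r ?invr_ge0 ?sqrtr_ge0.
      by rewrite sumr_const_nat subn1/= -[leLHS]mulr_natr divfK// gt_eqF.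
  rewrite (le_trans (ler_norm _))// (le_trans (ler_norm_sum _ _ _))//.
  have s1 := sqrt_nat_gt0 R (ltn0Sn M).
  apply: (@le_trans _ _ (\sum_(1 <= k < M.+1) (Num.sqrt k%:R)^-1 * (D / Num.sqrt M.+1%:R))).
    apply: ler_sum => k _; rewrite normrM ger0_norm ?invr_ge0 ?sqrtr_ge0// ler_wpM2l ?invr_ge0 ?sqrtr_ge0//.
    apply: abel_g => r Mr; rewrite ?invr_ge0 ?sqrtr_ge0//.
    by apply: inv_sqrt_decr; apply: leq_trans Mr.
  rewrite -mulr_suml -/(sum_inv_sqrt R M) mulrA ler_pdivrMr// mulrC -mulrA mulrCA ler_wpM2l//.
  rewrite (le_trans (sum_inv_sqrt_le _ _))// ler_pM2l// ler_sqrt// ler_nat//.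
have [M HM] := exists_nat_ge (expR (B + 1)).
have M0 : (0 < M)%N.
  by have := lt_le_trans (expR_gt0 _) HM; rewrite ltr0n.
have := SB _ M0; have := S_ge M.
have : B + 1 <= ln M.+1%:R.
  rewrite -[leLHS]expRK ler_ln ?posrE ?expR_gt0 ?ltr0n//.
  by rewrite (le_trans HM)// ler_nat.
lra.
Qed.

End RealCase.

Section Nonvanishing.
Variables (R : realType) (d : nat) (chi : int -> R[i]).
Hypothesis d0 : (0 < d)%N.
Hypothesis chiP : dirichlet_character R[i] d chi.

Lemma dirichlet_L1_neq0 (c : int) : chi c != 0 -> chi c != 1 -> dirichlet_L 1 chi != 0.
Proof.
move=> c0 c1; have S0 := sum_dirichlet_character0 d0 chiP c0 c1.
have [[n [n0 n1]]|H] := pselect (exists n, chi n != 0 /\ chi n * chi n != 1).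
  apply: complex_dirichlet_L_neq0 d0 chiP S0 _.
  apply: (sum_dirichlet_character0 d0 (dirichlet_characterM chiP chiP) (c := n)) => //=.
  by rewrite mulf_neq0.
apply: real_dirichlet_L_neq0 d0 chiP S0 _ => n n0; apply/eqP/negPn/negP => n1.
by apply: H; exists n.
Qed.

Lemma sum_inv_sqr_le n :
  \sum_(2 <= r < n.+3) (r%:R ^+ 2)^-1 <= 3 / 4 - (n.+2%:R)^-1 :> R.
Proof.
elim: n => [|n IH]; first by rewrite big_nat1; lra.
rewrite big_nat_recr//= (le_trans (lerD IH (lexx _)))//.
have q0 : 0 < n.+2%:R :> R by [].
have -> : n.+3%:R = n.+2%:R + 1 :> R by rewrite natr1.
move: (n.+2%:R : R) q0 => q q0.
have : ((q + 1) ^+ 2)^-1 <= q^-1 - (q + 1)^-1.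
  have -> : q^-1 - (q + 1)^-1 = (q * (q + 1))^-1.
    by field; rewrite !gt_eqF// addr_gt0.
  by rewrite lef_pV2 ?posrE ?mulr_gt0 ?exprn_gt0 ?addr_gt0// expr2 ler_pM2r ?addr_gt0// lerDl.
lra.
Qed.

(* For k >= 2 the first term dominates: the others add up to at most 3/4. *)
Lemma dirichlet_L_neq0 k : (2 <= k)%N -> ccvg (partial_L k chi) (dirichlet_L k chi) ->
  dirichlet_L k chi != 0.
Proof.
move=> k2 cv; apply/negP => /eqP L0; rewrite L0 in cv.
have [chi1 _ _ _] := chiP.
(* With tolerance 1/4, 1 <= |1 + T| + |T| < 1/4 + 3/4 is the contradiction. *)
have [|M HM] := (ccvg_cabsP _ _).1 cv 4^-1; first by rewrite invr_gt0.
have := HM M.+3 (leq_trans (leqnSn _) (leq_trans (leqnSn _) (leqnSn _))).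
rewrite subr0 /partial_L big_ltn// chi1 expr1n divr1.
set T := \sum_(2 <= r < _) _ => H1.
have HT : cabs T <= 3 / 4.
  apply: (@le_trans _ _ (\sum_(2 <= r < M.+3) (r%:R ^+ 2)^-1)).
    rewrite (le_trans (cabs_sum _ _ _))//; apply: ler_sum_nat => r /andP[r2 _].
    have r0 : 0 < r%:R :> R by rewrite ltr0n ltnW.
    rewrite cabsM -(rmorph_nat (real_complex R) r) -rmorphXn -fmorphV cabs_real.
    rewrite ger0_norm ?invr_ge0 ?exprn_ge0 ?(ltW r0)// -[leRHS]mul1r.
    rewrite ler_pM ?cabs_ge0 ?invr_ge0 ?exprn_ge0 ?(ltW r0)//.
      exact: dirichlet_character_cabs_le1 d0 chiP _.
    by rewrite lef_pV2 ?posrE ?exprn_gt0// ler_weXn2l// ler1n ltnW.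
  by rewrite (le_trans (sum_inv_sqr_le M))// lerBlDr lerDl invr_ge0.
have : cabs (1 : R[i]) <= cabs (1 + T) + cabs T by rewrite -{1}(addrK T 1) cabsB.
rewrite cabs1; lra.
Qed.

End Nonvanishing.

Theorem theorem3p2 (R : realType) (N k : nat) (hN : (2 <= N)%N)
    (hk : (1 <= k)%N) :
  [/\ ~~ odd k ->
      (\det (bernoulli_mx R k N))%:C =
        (-1) ^+ (Nplus N * (Nplus N).+1)./2
        * (N%:R `^ ((Nplus N).+1%:R / 2))%:C
        * 2 ^+ ((Nplus N).+1 - Nminus N)
        * \prod_(d <- divisors N)
            \big[*%R/1]_(chi \in even_characters R[i] d)
              ((-1) ^+ (k./2).+1 * k`!%:R / ((2 * pi) ^+ k)%:C
               * dirichlet_L k chi),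
      odd k ->
      (\det (bernoulli_mx R k N))%:C =
        (-1) ^+ (Nminus N * (Nminus N).-1)./2
        * (N%:R `^ ((Nminus N)%:R / 2))%:C
        * \prod_(d <- divisors N | (2 < d)%N)
            \big[*%R/1]_(chi \in odd_characters R[i] d)
              ((-1) ^+ (k.+1)./2 * k`!%:R / ((2 * pi) ^+ k)%:C
               * dirichlet_L k chi)
    & \det (bernoulli_mx R k N) != 0].
Proof.
have N0 : (0 < N)%N by apply: leq_trans hN.
have fcE : (-1) ^+ (k./2).+1 * k`!%:R / ((2 * pi) ^+ k)%:C = (fourier_coef R k)%:C :> R[i].
  by rewrite /fourier_coef rmorphM fmorphV rmorphM rmorph_sign rmorph_nat.
have E := det_bernoulli_mx R hk N0.
have Wneq0 : 2 ^+ Nminus N != 0 :> R by rewrite expf_neq0.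
have sE n : (-1) ^+ n = ((-1) ^+ n)%:C :> R[i] by rewrite rmorph_sign.
have tE n : 2 ^+ n = (2 ^+ n)%:C :> R[i] by rewrite rmorphXn rmorph_nat.
split=> [ke|ko|].
- rewrite E (negbTE ke) det_trig_mx// prod_orbit_size// fcE; congr (_ * _).
  rewrite /symdim powR_half// (mulnC (Nplus N)).
  rewrite sE tE -!rmorphM/=; congr _%:C.
  (* Each row brings a factor 2 from the Fourier series and the orbit sizes take away 2^(N^-); this
     inequality makes the subtraction in [nat] exact. *)
  have le : (Nminus N <= (Nplus N).+1)%N by case: (Nplus_cases N0) => ->; rewrite ?leqnSn// ltnW.
  by rewrite -{1}(subnK le) exprD -mulrA [2 ^+ Nminus N * _]mulrC divfK// mulrC.
- rewrite E ko det_trig_mx// prod_orbit_size// /symdim powR_half//.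
  have -> : ((k.+1)./2 = (k./2).+1)%N by rewrite -uphalfE uphalf_half ko.
  rewrite fcE; congr (_ * _).
    (* In odd parity the dimension is N^-, so the powers of 2 cancel. *)
    by rewrite sE -!rmorphM/= mulrC divfK.
  rewrite [RHS]big_mkcond big_seq_cond [RHS]big_seq_cond; apply: eq_bigr => d /andP[dN _].
  have d0 := divisors_gt0 N0 dN.
  (* Modulo 1 and 2, -1 is congruent to 1, so there are no odd characters and these products are
     empty. *)
  case: ltnP => // d2; rewrite (_ : sym_characters _ _ = set0) ?fsbig_set0//.
  rewrite -subset0 => chi [[chi1 _ chiD _]] chiN1.
  have : chi (-1) = chi 1.
    have [d1|d2'] : d = 1%N \/ d = 2%N by lia.
      by rewrite -(chiD (-1)) -(chiD (_ + _)) d1.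
    by rewrite -(chiD (-1)) d2'.
  rewrite chiN1 chi1 => /eqP; rewrite -subr_eq0 -opprD oppr_eq0.
  by rewrite -[1 + 1]/(2%:R) pnatr_eq0.
- apply: det_bernoulli_mx_neq0 => // d chi P; have [/= dN chiP chi1] := P.
  have d0 : (0 < d)%N := dvdn_gt0 N0 dN.
  have [k1|k1] := ltnP 1 k.
    exact: (dirichlet_L_neq0 d0 chiP k1 (partial_L_cvg hk N0 P)).
  have k1' : k = 1%N by lia.
  (* Odd parity gives chi(-1) = -1, so -1 witnesses that [chi] is nonprincipal. *)
  rewrite k1' in chi1 *; apply: (dirichlet_L1_neq0 d0 chiP (c := -1)).
    by rewrite chi1 /= expr1 oppr_eq0 oner_eq0.
  by rewrite chi1 /= expr1 -subr_eq0 -opprD oppr_eq0 -[1 + 1]/(2%:R) pnatr_eq0.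
Qed.
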